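(* Suppose $x_1:C_1,\dots,x_a:C_a;\ y_1:M_1,\dots,y_b:M_b\vdash t:A$ is derivable in $\mathrm{DIAL}$. Then there is a higher order polynomial $p(x_1,\dots,x_a):o(A)$, with free variables $x_i$ of type $o(C_i)$, such that for every valuation $\eta$: whenever $u_i,q_i\Vdash_\eta C_i$ for $1\le i\le a$ and $s_j,m_j\Vdash_\eta M_j$ for $1\le j\le b$, we have $t\langle u_1/x_1,\dots,u_a/x_a,s_1/y_1,\dots,s_b/y_b\rangle,\ p(q_1,\dots,q_a)+m_1+\cdots+m_b\Vdash_\eta A$. Moreover, if each $x_i$ occurs $c_i$ times in $t$, then $|t|+c_1\downarrow q_1+\cdots+c_a\downarrow q_a\le\ \downarrow p(q_1,\dots,q_a)$ (for closed $q_i$ of type $o(C_i)$).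
   Context: $\lambda$-terms $t::=x\mid\lambda x.t\mid tu$; values are variables and abstractions; size $|x|=1$, $|\lambda x.t|=|t|+1$, $|tu|=|t|+|u|$. Weak call-by-value reduction: $(\lambda x.t)v\to t[v/x]$ for $v$ a value, closed under $t_1\to t_2\Rightarrow t_1u\to t_2u,\ ut_1\to ut_2$. A step $t\to u$ costs $\max\{|u|-|t|,1\}$; costs add. $t\Downarrow$ means $t$ reduces to a value; $Time(t)$ total cost; $TS(t)=Time(t)+|t|$. Notation $t\langle u_1/x_1,\dots,u_n/x_n\rangle=(\lambda x_1\cdots x_n.t)u_1\cdots u_n$; $\theta,\xi$ lists of bindings; $\vec u$ lists of terms. DIAL: linear formulas $L::=\alpha\mid\forall\alpha L\mid\mu\alpha L\mid L\multimap M$ ($\mu\alpha L$ only when $\alpha$ occurs only positively in $L$); formulas $A::=L\mid\forall\alpha A\mid L\multimap B\mid A\Rightarrow B$. Judgments $\Gamma;\Delta\vdash t:A$, $\Delta$ assigning linear formulas, variables distinct. Rules: (ax1) $x:A;\vdash x:A$; (ax2) $;x:L\vdash x:L$; ($\mu_e$)/($\mu_i$) pass between $t:\mu\alpha L$ and $t:L[\mu\alpha L/\alpha]$; ($\forall_i$) $t:A\leadsto t:\forall\alpha A$ if $\alpha$ not free in $\Gamma,\Delta$; ($\forall_e$) $t:\forall\alpha A\leadsto t:A[L/\alpha]$, $L$ linear; ($\Rightarrow_e$) from $\Gamma_1;\Delta\vdash t:A\Rightarrow B$ and $\Gamma_2;\vdash u:A$ infer $\Gamma_1,\Gamma_2;\Delta\vdash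 tu:B$; ($\Rightarrow_i$) from $\Gamma,z:A;\Delta\vdash t:B$ infer $\Gamma;\Delta\vdash\lambda z.t:A\Rightarrow B$; ($\multimap_e$) from $\Gamma_1;\Delta_1\vdash t:L\multimap B$ and $\Gamma_2;\Delta_2\vdash u:L$ infer $\Gamma_1,\Gamma_2;\Delta_1,\Delta_2\vdash tu:B$; ($\multimap_i$) from $\Gamma;\Delta,z:L\vdash t:B$ infer $\Gamma;\Delta\vdash\lambda z.t:L\multimap B$; (Contr) from $\Gamma,x:A,y:A;\Delta\vdash t:B$ infer $\Gamma,z:A;\Delta\vdash t[z/x,z/y]:B$; (Derel) from $\Gamma;\Delta,x:L\vdash t:B$ infer $\Gamma,x:L;\Delta\vdash t:B$; (Weak) from $\Gamma;\Delta\vdash t:B$ infer $\Gamma,\Gamma';\Delta,\Delta'\vdash t:B$. Higher order polynomials: simple types $\sigma::=o\mid\sigma\to\sigma$; terms from typed variables, application, abstraction, constants $n:o$, $+:o\to o\to o$, modulo $\alpha\beta\eta$ and arithmetic; $\Pi$ the closed ones. For $p:\tau_1\to\cdots\to\tau_k\to o$, $q:o$: $p+q=\lambda\vec x.(p\vec x+q)$; $\downarrow p=p\,0_{\tau_1}\cdots0_{\tau_k}$, $0_\tau=\lambda\vec x.0$. Type translation: $o(L)=o$, $o(L\multimap A)=o(A)$, $o(A\Rightarrow B)=o(A)\to o(B)$, $o(\forall\alpha A)=o(A)$. Saturated set of type $\tau$: nonempty $X\subseteq\Lambda\times\Pi$ such that for $(t,p)\in X$: $t\Downarrow$, $p$ closed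 of type $\tau$, and (bound) $TS(t)\le\downarrow p$; (monotonicity) $(t,p+n)\in X$; (exchange) $t=t_0\langle\theta,v_1/y_1,v_2/y_2,\xi\rangle\vec u\Rightarrow(t_0\langle\theta,v_2/y_2,v_1/y_1,\xi\rangle\vec u,p)\in X$; (weakening) $t=t_0\langle\theta\rangle\vec u$, $z\notin FV(t_0)$, $w\Downarrow\Rightarrow(t_0\langle\theta,w/z\rangle\vec u,p+TS(w)+2)\in X$; (contraction) $t=t_0\langle\theta,w/z_1,w/z_2\rangle\vec u\Rightarrow(t_0[z/z_1,z/z_2]\langle\theta,w/z\rangle\vec u,p)\in X$; (concatenation) $t=(t_0\langle\theta\rangle)(t_1\langle\xi\rangle)\vec u\Rightarrow((t_0t_1)\langle\theta,\xi\rangle\vec u,p)\in X$; (identity) $t=t_0\vec u\Rightarrow((x\langle t_0/x\rangle)\vec u,p+3)\in X$. A valuation $\eta$ maps propositional variables to saturated sets of type $o$. Realizability $t,p\Vdash_\eta A$ ($p$ closed of type $o(A)$): $t,n\Vdash_\eta\alpha$ iff $(t,n)\in\eta(\alpha)$; $t,p\Vdash_\eta L\multimap A$ iff $TS(t)\le\downarrow p$ and $u,m\Vdash_\eta L$ implies $tu,p+m\Vdash_\eta A$; $t,p\Vdash_\eta B\Rightarrow A$ iff $TS(t)\le\downarrow p$ and $u,q\Vdash_\eta B$ implies $tu,p(q)\Vdash_\eta A$; $t,p\Vdash_\eta\forall\alpha A$ iff $t,p\Vdash_{\eta\{\alpha\leftarrow X\}}A$ for all saturated $X$ of type $o$; $t,p\Vdash_\eta\mu\alpha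 L$ iff $(t,p)\in X$ for all saturated $X$ of type $o$ with $\{(s,r):s,r\Vdash_{\eta\{\alpha\leftarrow X\}}L\}\subseteq X$.
   Formalization: Saturated sets may be empty here (in valuations and in the ∀ and μ clauses): with nonempty sets only, ∀β.β has no realizer and the claim fails, e.g. for x:∀α((α⊸γ)⊸δ) ⊢ x:((∀β.β)⊸γ)⊸δ. *)

(* Defs.v *)
From Stdlib Require Import Arith List Permutation.
Import ListNotations.

Definition scons {T : Type} (x : T) (s : nat -> T) (n : nat) : T :=
  match n with 0 => x | S m => s m end.

(** * Lambda-terms *)

(** De Bruijn terms represent named terms modulo alpha: at top level the name
    [x : nat] is the free index [x], and [lam x t] is the term "lambda x. t",
    which binds the name [x] in [t]. *)
Inductive term : Type :=
| Var (x : nat)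
| App (t u : term)
| Abs (t : term).

Definition up_ren (f : nat -> nat) : nat -> nat := scons 0 (fun x => S (f x)).

Fixpoint ren (f : nat -> nat) (t : term) : term :=
  match t with
  | Var x => Var (f x)
  | App t u => App (ren f t) (ren f u)
  | Abs t => Abs (ren (up_ren f) t)
  end.

Definition up (s : nat -> term) : nat -> term :=
  scons (Var 0) (fun x => ren S (s x)).

Fixpoint subst (s : nat -> term) (t : term) : term :=
  match t with
  | Var x => s x
  | App t u => App (subst s t) (subst s u)
  | Abs t => Abs (subst (up s) t)
  end.

Definition lam (x : nat) (t : term) : term :=
  Abs (ren (fun y => if y =? x then 0 else S y) t).

Fixpoint size (t : term) : nat :=
  match t with
  | Var _ => 1
  | App t u => size t + size u
  | Abs t => S (size t)
  end.

(** Number of free occurrences of [x]. *)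
Fixpoint occ (x : nat) (t : term) : nat :=
  match t with
  | Var y => if y =? x then 1 else 0
  | App t u => occ x t + occ x u
  | Abs t => occ (S x) t
  end.

Definition fresh (x : nat) (t : term) : Prop := occ x t = 0.

Definition value (t : term) : Prop :=
  match t with App _ _ => False | _ => True end.

Inductive step : term -> term -> Prop :=
| step_beta t v : value v -> step (App (Abs t) v) (subst (scons v Var) t)
| step_appl t1 t2 u : step t1 t2 -> step (App t1 u) (App t2 u)
| step_appr u t1 t2 : step t1 t2 -> step (App u t1) (App u t2).

(** The truncated subtraction is harmless below the [max]. *)
Definition step_cost (t u : term) : nat := Nat.max (size u - size t) 1.

(** [reds t u c]: [t] reduces to [u] with total cost [c]. *)
Inductive reds : term -> term -> nat -> Prop :=
| reds_refl t : reds t t 0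
| reds_step t u v c : step t u -> reds u v c -> reds t v (step_cost t u + c).

Definition converges (t : term) : Prop := exists v c, value v /\ reds t v c.

(** Graphs of the partial functions Time and TS.  They are single-valued since
    reduction has the diamond property and commuting steps keep their costs. *)
Definition Time (t : term) (c : nat) : Prop := exists v, value v /\ reds t v c.
Definition TS (t : term) (k : nat) : Prop := exists c, Time t c /\ k = c + size t.

Definition apps (t : term) (us : list term) : term := fold_left App us t.
Definition lams (xs : list nat) (t : term) : term := fold_right lam t xs.

(** [clo t [(x1,u1); ...; (xn,un)]] is t<u1/x1,...,un/xn>. *)
Definition clo (t : term) (th : list (nat * term)) : term :=
  apps (lams (map fst th) t) (map snd th).

(** t[z/x,z/y]. *)
Definition merge (x y z : nat) (t : term) : term :=
  ren (fun w => if (w =? x) || (w =? y) then z else w)%bool t.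

(** * Higher order polynomials *)

Inductive sty : Type := Base | Arr (s t : sty).

Inductive hop : Type :=
| HVar (x : nat)
| HApp (p q : hop)
| HLam (s : sty) (p : hop)
| HNum (n : nat)
| HPlus.

Definition hadd (p q : hop) : hop := HApp (HApp HPlus p) q.

Fixpoint hren (f : nat -> nat) (p : hop) : hop :=
  match p with
  | HVar x => HVar (f x)
  | HApp p q => HApp (hren f p) (hren f q)
  | HLam s p => HLam s (hren (up_ren f) p)
  | HNum n => HNum n
  | HPlus => HPlus
  end.

Definition hup (s : nat -> hop) : nat -> hop :=
  scons (HVar 0) (fun x => hren S (s x)).

Fixpoint hsubst (f : nat -> hop) (p : hop) : hop :=
  match p with
  | HVar x => f x
  | HApp p q => HApp (hsubst f p) (hsubst f q)
  | HLam s p => HLam s (hsubst (hup f) p)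
  | HNum n => HNum n
  | HPlus => HPlus
  end.

Inductive hty : list sty -> hop -> sty -> Prop :=
| hty_var G x s : nth_error G x = Some s -> hty G (HVar x) s
| hty_app G p q s t : hty G p (Arr s t) -> hty G q s -> hty G (HApp p q) t
| hty_lam G s p t : hty (s :: G) p t -> hty G (HLam s p) (Arr s t)
| hty_num G n : hty G (HNum n) Base
| hty_plus G : hty G HPlus (Arr Base (Arr Base Base)).

(** Equality of polynomials: beta, eta and the laws of addition.  Alpha is
    taken care of by the indices. *)
Inductive heq : list sty -> hop -> hop -> sty -> Prop :=
| heq_refl G p s : hty G p s -> heq G p p s
| heq_sym G p q s : heq G p q s -> heq G q p s
| heq_trans G p q r s : heq G p q s -> heq G q r s -> heq G p r s
| heq_app G p p' q q' s t :
    heq G p p' (Arr s t) -> heq G q q' s -> heq G (HApp p q) (HApp p' q') t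
| heq_lam G s p p' t :
    heq (s :: G) p p' t -> heq G (HLam s p) (HLam s p') (Arr s t)
| heq_beta G s p q t :
    hty (s :: G) p t -> hty G q s ->
    heq G (HApp (HLam s p) q) (hsubst (scons q HVar) p) t
| heq_eta G p s t :
    hty G p (Arr s t) ->
    heq G (HLam s (HApp (hren S p) (HVar 0))) p (Arr s t)
| heq_num G m n : heq G (hadd (HNum m) (HNum n)) (HNum (m + n)) Base
| heq_add0 G p : hty G p Base -> heq G (hadd p (HNum 0)) p Base
| heq_addC G p q : hty G p Base -> hty G q Base -> heq G (hadd p q) (hadd q p) Base
| heq_addA G p q r :
    hty G p Base -> hty G q Base -> hty G r Base ->
    heq G (hadd p (hadd q r)) (hadd (hadd p q) r) Base.

(** [hplus s p q] is p + q for p of type [s] and q of type [Base]. *)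
Fixpoint hplus (s : sty) (p q : hop) : hop :=
  match s with
  | Base => hadd p q
  | Arr s1 s2 => HLam s1 (hplus s2 (HApp (hren S p) (HVar 0)) (hren S q))
  end.

Fixpoint hzero (s : sty) : hop :=
  match s with
  | Base => HNum 0
  | Arr s1 s2 => HLam s1 (hzero s2)
  end.

Fixpoint down (s : sty) (p : hop) : hop :=
  match s with
  | Base => p
  | Arr s1 s2 => down s2 (HApp p (hzero s1))
  end.

(** The closed polynomial [p] of type [s] satisfies (down p) = n; every closed
    polynomial of type [Base] is equal to exactly one numeral. *)
Definition down_val (s : sty) (p : hop) (n : nat) : Prop :=
  heq [] (down s p) (HNum n) Base.

(** p(q1,...,qa), where the free variables of [p] are [HVar 0], ...,
    [HVar (a-1)]. *)
Definition hinst (p : hop) (qs : list hop) : hop :=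
  hsubst (fun i => nth i qs (HVar i)) p.

(** * Saturated sets *)

(** TS(t) is defined and TS(t) <= down p. *)
Definition TS_bound (s : sty) (t : term) (p : hop) : Prop :=
  exists k n, TS t k /\ down_val s p n /\ k <= n.

(** Bound names are distinct and fresh where the notation requires it, as
    otherwise they would capture each other.

    The empty set is allowed: forall alpha. alpha has no realizer (distinct
    values have disjoint saturated sets of terms evaluating to them), so with
    nonempty sets only, realizers of a formula would not be saturated and the
    rule instantiating forall alpha. A at forall alpha. alpha would be unsound. *)
Record saturated (s : sty) (X : term -> hop -> Prop) : Prop := {
  sat_type : forall t p, X t p -> hty [] p s;
  (* [X] is a set of polynomials modulo equality *)
  sat_heq : forall t p p', X t p -> heq [] p p' s -> X t p';
  sat_conv : forall t p, X t p -> converges t;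
  sat_bound : forall t p, X t p -> TS_bound s t p;
  sat_mono : forall t p n, X t p -> X t (hplus s p (HNum n));
  sat_exch : forall t0 th y1 v1 y2 v2 xi us p,
    NoDup (map fst (th ++ [(y1, v1); (y2, v2)] ++ xi)) ->
    X (apps (clo t0 (th ++ [(y1, v1); (y2, v2)] ++ xi)) us) p ->
    X (apps (clo t0 (th ++ [(y2, v2); (y1, v1)] ++ xi)) us) p;
  sat_weak : forall t0 th z w k us p,
    NoDup (map fst (th ++ [(z, w)])) ->
    fresh z t0 -> TS w k ->
    X (apps (clo t0 th) us) p ->
    X (apps (clo t0 (th ++ [(z, w)])) us) (hplus s p (HNum (k + 2)));
  sat_contr : forall t0 th z1 z2 z w us p,
    NoDup (map fst (th ++ [(z1, w); (z2, w)])) ->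
    NoDup (map fst (th ++ [(z, w)])) ->
    (fresh z t0 \/ z = z1 \/ z = z2) ->
    X (apps (clo t0 (th ++ [(z1, w); (z2, w)])) us) p ->
    X (apps (clo (merge z1 z2 z t0) (th ++ [(z, w)])) us) p;
  sat_concat : forall t0 th t1 xi us p,
    NoDup (map fst (th ++ xi)) ->
    (forall x, In x (map fst th) -> fresh x t1) ->
    (forall x, In x (map fst xi) -> fresh x t0) ->
    X (apps (App (clo t0 th) (clo t1 xi)) us) p ->
    X (apps (clo (App t0 t1) (th ++ xi)) us) p;
  sat_id : forall t0 x us p,
    X (apps t0 us) p ->
    X (apps (clo (Var x) [(x, t0)]) us) (hplus s p (HNum 3))
}.

(** * Formulas of DIAL *)

(** Raw formulas; propositional variables are de Bruijn indices. *)
Inductive form : Type :=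
| FVar (a : nat)
| FAll (A : form)
| FMu (A : form)
| FLolli (A B : form)
| FImp (A B : form).

Fixpoint fren (f : nat -> nat) (A : form) : form :=
  match A with
  | FVar a => FVar (f a)
  | FAll A => FAll (fren (up_ren f) A)
  | FMu A => FMu (fren (up_ren f) A)
  | FLolli A B => FLolli (fren f A) (fren f B)
  | FImp A B => FImp (fren f A) (fren f B)
  end.

Definition fup (s : nat -> form) : nat -> form :=
  scons (FVar 0) (fun a => fren S (s a)).

Fixpoint fsubst (s : nat -> form) (A : form) : form :=
  match A with
  | FVar a => s a
  | FAll A => FAll (fsubst (fup s) A)
  | FMu A => FMu (fsubst (fup s) A)
  | FLolli A B => FLolli (fsubst s A) (fsubst s B)
  | FImp A B => FImp (fsubst s A) (fsubst s B)
  end.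

(** A[L/alpha], for alpha the index 0. *)
Definition fsubst1 (A L : form) : form := fsubst (scons L FVar) A.

(** Every free occurrence of [a] in [A] is positive (if [b] is true), resp.
    negative (if [b] is false). *)
Fixpoint polarity (b : bool) (a : nat) (A : form) : Prop :=
  match A with
  | FVar c => c = a -> b = true
  | FAll A | FMu A => polarity b (S a) A
  | FLolli A B | FImp A B => polarity (negb b) a A /\ polarity b a B
  end.

Fixpoint linear (A : form) : Prop :=
  match A with
  | FVar _ => True
  | FAll A => linear A
  | FMu A => linear A /\ polarity true 0 A
  | FLolli A B => linear A /\ linear B
  | FImp _ _ => False
  end.

(** A ::= L | forall alpha A | L -o B | A => B *)
Inductive formula : form -> Prop :=
| formula_lin L : linear L -> formula L
| formula_all A : formula A -> formula (FAll A)
| formula_lolli L B : linear L -> formula B -> formula (FLolli L B)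
| formula_imp A B : formula A -> formula B -> formula (FImp A B).

(** The translation o(A); it yields [Base] on every linear formula. *)
Fixpoint oty (A : form) : sty :=
  match A with
  | FVar _ => Base
  | FAll A => oty A
  | FMu _ => Base
  | FLolli _ A => oty A
  | FImp A B => Arr (oty A) (oty B)
  end.

(** * Typing *)

Definition ctx : Type := list (nat * form).

Definition distinct (G D : ctx) : Prop := NoDup (map fst (G ++ D)).

Definition lift_ctx (G : ctx) : ctx := map (fun b => (fst b, fren S (snd b))) G.

(** Contexts are unordered; they are lists here, whence [dial_perm]. *)
Inductive dial : ctx -> ctx -> term -> form -> Prop :=
| dial_ax1 x A : formula A -> dial [(x, A)] [] (Var x) A
| dial_ax2 x L : linear L -> dial [] [(x, L)] (Var x) L
| dial_mu_e G D t L :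
    dial G D t (FMu L) -> dial G D t (fsubst1 L (FMu L))
| dial_mu_i G D t L :
    linear (FMu L) ->
    dial G D t (fsubst1 L (FMu L)) -> dial G D t (FMu L)
| dial_all_i G D t A :
    dial (lift_ctx G) (lift_ctx D) t A -> dial G D t (FAll A)
| dial_all_e G D t A L :
    linear L -> dial G D t (FAll A) -> dial G D t (fsubst1 A L)
| dial_imp_e G1 G2 D t u A B :
    distinct (G1 ++ G2) D ->
    dial G1 D t (FImp A B) -> dial G2 [] u A ->
    dial (G1 ++ G2) D (App t u) B
| dial_imp_i G D z t A B :
    dial (G ++ [(z, A)]) D t B -> dial G D (lam z t) (FImp A B)
| dial_lolli_e G1 G2 D1 D2 t u L B :
    distinct (G1 ++ G2) (D1 ++ D2) ->
    dial G1 D1 t (FLolli L B) -> dial G2 D2 u L ->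
    dial (G1 ++ G2) (D1 ++ D2) (App t u) B
| dial_lolli_i G D z t L B :
    dial G (D ++ [(z, L)]) t B -> dial G D (lam z t) (FLolli L B)
| dial_contr G D x y z t A B :
    distinct (G ++ [(z, A)]) D ->
    dial (G ++ [(x, A); (y, A)]) D t B ->
    dial (G ++ [(z, A)]) D (merge x y z t) B
| dial_derel G D x t L B :
    dial G (D ++ [(x, L)]) t B -> dial (G ++ [(x, L)]) D t B
| dial_weak G G' D D' t B :
    distinct (G ++ G') (D ++ D') ->
    (forall b, In b G' -> formula (snd b)) ->
    (forall b, In b D' -> linear (snd b)) ->
    dial G D t B -> dial (G ++ G') (D ++ D') t B
| dial_perm G G' D D' t A :
    Permutation G G' -> Permutation D D' ->
    dial G D t A -> dial G' D' t A.

(** * Realizability *)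

Definition valuation (eta : nat -> term -> hop -> Prop) : Prop :=
  forall a, saturated Base (eta a).

(** [realizes A eta t p] is t,p |=_eta A. *)
Fixpoint realizes (A : form) (eta : nat -> term -> hop -> Prop)
    (t : term) (p : hop) : Prop :=
  hty [] p (oty A) /\
  match A with
  | FVar a => eta a t p
  | FAll A =>
      forall X, saturated Base X -> realizes A (scons X eta) t p
  | FMu L =>
      forall X, saturated Base X ->
        (forall s r, realizes L (scons X eta) s r -> X s r) -> X t p
  | FLolli L B =>
      TS_bound (oty B) t p /\
      forall u m, realizes L eta u m ->
        realizes B eta (App t u) (hplus (oty B) p m)
  | FImp B C =>
      TS_bound (Arr (oty B) (oty C)) t p /\
      forall u q, realizes B eta u q -> realizes C eta (App t u) (HApp p q)
  end.

(* Main.v *)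
(** Big-step evaluation with costs is deterministic and computes Time, so the
    effect on TS of every closure operation of saturation can be calculated
    exactly; hence the pairs [(t, p)] with TS t <= down p form a saturated set,
    and all realizability sets are saturated.  Positivity makes [mu] a least
    fixed point.  The polynomial of a derivation is then built rule by rule.
    Application of [p1] to [p2] yields [p1 p2 + down p2], whose last summand
    pays for the size of the argument when [p1] ignores its input; abstraction
    adds what evaluating and substituting all bindings costs, which is bounded
    because linear variables occur at most once and the size bound
    [|t| + sum ci * down qi <= down p] accounts for the others. *)

Require Import Defs.
From Stdlib Require Import Arith Lia List Permutation FunctionalExtensionality.
Import ListNotations.

(** * Renaming and substitution *)

(** A closure [clo t th] is a nest of redexes. Its cost can be computed because contracting the
    binder [x] costs an amount that depends only on the number of occurrences of [x] in the original
    body and on the size of the value put there: the values substituted earlier cancel in the size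
    difference. Bindings can therefore be exchanged and regrouped without changing the total cost.

    A different obstacle shapes the treatment of polynomials. Equality is a derivability relation,
    and uniqueness of the numeral equal to a closed polynomial is not established, so inequalities
    are expressed by derivable equations: one side is the other plus a numeral, or both are a common
    base plus numerals that are compared. A binary logical relation built on the same idea yields
    normalization and monotonicity together; monotonicity gives [down p <= down (p q)], on which the
    size bound for an application rests. Linear arguments enter the induction through one numeral,
    the sum of their values, which makes their order irrelevant. *)

Lemma up_up_ren (s : nat -> term) f :
  (fun x => up s (up_ren f x)) = up (fun x => s (f x)).
Proof. extensionality x; destruct x; reflexivity. Qed.

Lemma subst_ren t : forall s f, subst s (ren f t) = subst (fun x => s (f x)) t.
Proof.
  induction t as [x|t1 IH1 t2 IH2|t IH]; intros s f; simpl.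
  - reflexivity.
  - now rewrite IH1, IH2.
  - now rewrite IH, up_up_ren.
Qed.

Lemma up_ren_comp f g :
  (fun x => up_ren f (up_ren g x)) = up_ren (fun x => f (g x)).
Proof. extensionality x; destruct x; reflexivity. Qed.

Lemma ren_ren t : forall f g, ren f (ren g t) = ren (fun x => f (g x)) t.
Proof.
  induction t as [x|t1 IH1 t2 IH2|t IH]; intros f g; simpl.
  - reflexivity.
  - now rewrite IH1, IH2.
  - now rewrite IH, up_ren_comp.
Qed.

Lemma ren_up f s :
  (fun x => ren (up_ren f) (up s x)) = up (fun x => ren f (s x)).
Proof.
  extensionality x; destruct x; simpl; [reflexivity|].
  now rewrite !ren_ren.
Qed.

Lemma ren_subst t : forall f s, ren f (subst s t) = subst (fun x => ren f (s x)) t.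
Proof.
  induction t as [x|t1 IH1 t2 IH2|t IH]; intros f s; simpl.
  - reflexivity.
  - now rewrite IH1, IH2.
  - now rewrite IH, ren_up.
Qed.

Lemma subst_up s1 s2 :
  (fun x => subst (up s2) (up s1 x)) = up (fun x => subst s2 (s1 x)).
Proof.
  extensionality x; destruct x; simpl; [reflexivity|].
  now rewrite subst_ren, ren_subst.
Qed.

Lemma subst_subst t : forall s1 s2,
  subst s2 (subst s1 t) = subst (fun x => subst s2 (s1 x)) t.
Proof.
  induction t as [x|t1 IH1 t2 IH2|t IH]; intros s1 s2; simpl.
  - reflexivity.
  - now rewrite IH1, IH2.
  - now rewrite IH, subst_up.
Qed.

Lemma up_Var : up Var = Var.
Proof. extensionality x; destruct x; reflexivity. Qed.

Lemma subst_Var t : subst Var t = t.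
Proof.
  induction t as [x|t1 IH1 t2 IH2|t IH]; simpl.
  - reflexivity.
  - now rewrite IH1, IH2.
  - now rewrite up_Var, IH.
Qed.

Lemma size_ren t : forall f, size (ren f t) = size t.
Proof. induction t; intros; simpl; auto. Qed.

(** * Counting free occurrences and sizes *)

Lemma list_sum_indicator x l : NoDup l ->
  list_sum (map (fun a => if x =? a then 1 else 0) l)
  = if in_dec Nat.eq_dec x l then 1 else 0.
Proof.
  induction 1 as [|a l Ha _ IH]; [reflexivity|].
  cbn [map list_sum fold_right].
  change (fold_right Nat.add 0) with list_sum; rewrite IH.
  destruct (Nat.eqb_spec x a) as [->|E];
  destruct (in_dec Nat.eq_dec _ l), (in_dec Nat.eq_dec _ (a :: l)); simpl in *;
    try tauto; try reflexivity; intuition congruence.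
Qed.

Lemma list_sum_map_add {T} (f g : T -> nat) l :
  list_sum (map (fun a => f a + g a) l) = list_sum (map f l) + list_sum (map g l).
Proof. induction l; simpl; lia. Qed.

(** Merging two names is not injective, so occurrences are counted over a duplicate-free list [l]
    that enumerates the preimage of [y]. Under a binder the preimage of [S y] is [map S l]. *)
Lemma occ_ren t : forall f y l, NoDup l -> (forall x, f x = y <-> In x l) ->
  occ y (ren f t) = list_sum (map (fun x => occ x t) l).
Proof.
  induction t as [x|t1 IH1 t2 IH2|t IH]; intros f y l Hl Hf; simpl.
  - rewrite list_sum_indicator by assumption.
    destruct (Nat.eqb_spec (f x) y) as [E|E], (in_dec Nat.eq_dec x l); auto;
      rewrite Hf in E; tauto.
  - now rewrite list_sum_map_add, (IH1 f y l), (IH2 f y l).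
  - rewrite (IH _ _ (map S l)).
    + now rewrite map_map.
    + apply NoDup_map_inv with (f := pred). rewrite map_map; simpl.
      now rewrite map_id.
    + intros [|x]; simpl.
      * rewrite in_map_iff; split; [discriminate|intros (? & ? & _); discriminate].
      * rewrite in_map_iff; split.
        -- intros [= E]. exists x; split; auto; now apply Hf.
        -- intros (x' & [= ->] & H). f_equal; now apply Hf.
Qed.

Lemma occ_ren1 t f y x : (forall x', f x' = y <-> x' = x) ->
  occ y (ren f t) = occ x t.
Proof.
  intros H. rewrite (occ_ren t f y [x]); simpl; [lia| |].
  - repeat constructor; auto.
  - intros x'; rewrite H; intuition congruence.
Qed.

Lemma occ_ren0 t f y : (forall x, f x <> y) -> occ y (ren f t) = 0.
Proof.
  intros H. rewrite (occ_ren t f y []); [reflexivity|constructor|].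
  intros x; simpl; split; [apply H|tauto].
Qed.

Lemma occ_subst t : forall s a b, s a = Var b ->
  (forall c, c <> a -> occ b (s c) = 0) -> occ b (subst s t) = occ a t.
Proof.
  induction t as [x|t1 IH1 t2 IH2|t IH]; intros s a b Ha Hs; simpl.
  - destruct (Nat.eqb_spec x a) as [->|E].
    + rewrite Ha; simpl; now rewrite Nat.eqb_refl.
    + auto.
  - now rewrite (IH1 s a b), (IH2 s a b).
  - apply IH; simpl; [now rewrite Ha|].
    intros [|c] E; simpl; [reflexivity|].
    rewrite (occ_ren1 _ _ _ b); [apply Hs; congruence|intros; split; congruence].
Qed.

(** Each of the [occ a t] replaced variables has size 1 and is traded for a term of size [m];
    writing this additively keeps truncated subtraction out. *)
Lemma size_subst t : forall s a m, size (s a) = m ->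
  (forall c, c <> a -> size (s c) = 1) ->
  size (subst s t) + occ a t = size t + occ a t * m.
Proof.
  induction t as [x|t1 IH1 t2 IH2|t IH]; intros s a m Ha Hs; simpl.
  - destruct (Nat.eqb_spec x a) as [->|E]; [lia|rewrite Hs by auto; lia].
  - specialize (IH1 s a m Ha Hs); specialize (IH2 s a m Ha Hs); lia.
  - rewrite IH with (m := m); [reflexivity|simpl; now rewrite size_ren|].
    intros [|c] E; simpl; [reflexivity|].
    rewrite size_ren; apply Hs; congruence.
Qed.

Lemma subst_ext_occ t : forall s1 s2,
  (forall x, occ x t <> 0 -> s1 x = s2 x) -> subst s1 t = subst s2 t.
Proof.
  induction t as [x|t1 IH1 t2 IH2|t IH]; intros s1 s2 H; simpl in *.
  - apply H; now rewrite Nat.eqb_refl.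
  - rewrite (IH1 s1 s2), (IH2 s1 s2); auto; intros; apply H; lia.
  - f_equal; apply IH. intros [|x] Hx; simpl; [reflexivity|]. now rewrite H.
Qed.

Lemma occ_lam x z t : occ x (lam z t) = if x =? z then 0 else occ x t.
Proof.
  unfold lam; simpl. destruct (Nat.eqb_spec x z) as [->|E].
  - apply occ_ren0. intros y; destruct (Nat.eqb_spec y z); congruence.
  - apply occ_ren1. intros y; destruct (Nat.eqb_spec y z); split; congruence.
Qed.

Lemma occ_lams x xs t : ~ In x xs -> occ x (lams xs t) = occ x t.
Proof.
  induction xs as [|y xs IH]; intros H; [reflexivity|]. simpl in H.
  change (occ x (lam y (lams xs t)) = occ x t).
  rewrite occ_lam. destruct (Nat.eqb_spec x y) as [->|E]; [tauto|].
  apply IH; tauto.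
Qed.

Lemma size_lam z t : size (lam z t) = S (size t).
Proof. simpl; now rewrite size_ren. Qed.

Lemma size_lams xs t : size (lams xs t) = length xs + size t.
Proof. induction xs as [|y xs IH]; simpl; [|rewrite size_ren, IH]; lia. Qed.

Lemma apps_app t us vs : apps t (us ++ vs) = apps (apps t us) vs.
Proof. apply fold_left_app. Qed.

Lemma size_apps us : forall t, size (apps t us) = size t + list_sum (map size us).
Proof. induction us as [|u us IH]; intros t; simpl; [|rewrite IH; simpl]; lia. Qed.

Lemma size_clo t th :
  size (clo t th) = size t + length th + list_sum (map (fun b => size (snd b)) th).
Proof. unfold clo. rewrite size_apps, size_lams, !length_map, map_map. lia. Qed.

Definition upd (x : nat) (w : term) (s : nat -> term) : nat -> term :=
  fun y => if y =? x then w else s y.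

(** Binding the name [x] and contracting only overrides [s] at [x]: the other names are shifted up
    by [lam] and [up] and shifted back by the contraction. A chain of bindings thus acts as one
    growing substitution on names. *)
Lemma beta_lam x t s w :
  subst (scons w Var)
    (subst (up s) (ren (fun y => if y =? x then 0 else S y) t))
  = subst (upd x w s) t.
Proof.
  rewrite subst_ren, subst_subst. f_equal. extensionality y. unfold upd.
  destruct (y =? x); simpl; [reflexivity|].
  rewrite subst_ren. simpl. apply subst_Var.
Qed.

(** * Big-step evaluation with costs *)

Inductive eval : term -> term -> nat -> Prop :=
| eval_val v : value v -> eval v v 0
| eval_app t u b w v c1 c2 c3 :
    eval t (Abs b) c1 -> eval u w c2 -> eval (subst (scons w Var) b) v c3 ->
    eval (App t u) v
      (c1 + c2 + step_cost (App (Abs b) w) (subst (scons w Var) b) + c3).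

Lemma eval_value t v c : eval t v c -> value v.
Proof. induction 1; auto. Qed.

Lemma eval_of_value v w c : value v -> eval v w c -> w = v /\ c = 0.
Proof. intros Hv H; destruct H; simpl in *; tauto. Qed.

Lemma eval_fun t v c : eval t v c -> forall v' c', eval t v' c' -> v' = v /\ c' = c.
Proof.
  induction 1 as [v Hv|t u b w v c1 c2 c3 _ IH1 _ IH2 _ IH3]; intros v' c' H'.
  - now apply eval_of_value.
  - inversion H' as [|? ? ? ? ? ? ? ? H1 H2 H3]; subst; [contradiction|].
    apply IH1 in H1 as [[= ->] ->]. apply IH2 in H2 as [-> ->].
    apply IH3 in H3 as [-> ->]. auto.
Qed.

(** A contraction never adds more to the size than it costs. This bounds the size of a substituted
    value by [TS] of the argument. *)
Lemma eval_size t v c : eval t v c -> size v <= size t + c.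
Proof. induction 1; unfold step_cost in *; simpl in *; lia. Qed.

(** The context of a step adds the same amount to both sizes, so [step_cost] does not see it, and
    the step can be charged to the subderivation where it occurs. Iterated, this turns a reduction
    to a value in any order into an evaluation of equal cost. *)
Lemma step_eval t u : step t u -> forall v c, eval u v c ->
  eval t v (step_cost t u + c).
Proof.
  induction 1 as [t w Hw|t1 t2 u _ IH|u t1 t2 _ IH]; intros v c H.
  - change (step_cost (App (Abs t) w) (subst (scons w Var) t) + c)
      with (0 + 0 + step_cost (App (Abs t) w) (subst (scons w Var) t) + c).
    apply eval_app with (b := t) (w := w); auto; apply eval_val; simpl; auto.
  - inversion H as [|? ? b w ? c1 c2 c3 H1 H2 H3]; subst; [contradiction|].
    replace (_ + _) with ((step_cost t1 t2 + c1) + c2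
      + step_cost (App (Abs b) w) (subst (scons w Var) b) + c3)
      by (unfold step_cost; simpl; lia).
    eapply eval_app; eauto.
  - inversion H as [|? ? b w ? c1 c2 c3 H1 H2 H3]; subst; [contradiction|].
    replace (_ + _) with (c1 + (step_cost t1 t2 + c2)
      + step_cost (App (Abs b) w) (subst (scons w Var) b) + c3)
      by (unfold step_cost; simpl; lia).
    eapply eval_app; eauto.
Qed.

Lemma reds_trans t u c : reds t u c -> forall v d, reds u v d -> reds t v (c + d).
Proof.
  induction 1; intros; auto. rewrite <- Nat.add_assoc. econstructor; eauto.
Qed.

Lemma reds_appl t1 t2 c u : reds t1 t2 c -> reds (App t1 u) (App t2 u) c.
Proof.
  induction 1 as [|t1 t2 t3 c H _ IH]; [constructor|].
  replace (step_cost t1 t2) with (step_cost (App t1 u) (App t2 u))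
    by (unfold step_cost; simpl; lia).
  econstructor; eauto using step_appl.
Qed.

Lemma reds_appr t1 t2 c u : reds t1 t2 c -> reds (App u t1) (App u t2) c.
Proof.
  induction 1 as [|t1 t2 t3 c H _ IH]; [constructor|].
  replace (step_cost t1 t2) with (step_cost (App u t1) (App u t2))
    by (unfold step_cost; simpl; lia).
  econstructor; eauto using step_appr.
Qed.

Lemma eval_reds t v c : eval t v c -> reds t v c.
Proof.
  induction 1 as [|t u b w v c1 c2 c3 H1 IH1 H2 IH2 H3 IH3]; [constructor|].
  rewrite <- !Nat.add_assoc.
  eapply reds_trans; [eapply reds_appl; eassumption|].
  eapply reds_trans; [eapply reds_appr; eassumption|].
  econstructor; eauto. constructor. eapply eval_value; eauto.
Qed.

Lemma Time_eval t c : Time t c <-> exists v, eval t v c.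
Proof.
  split.
  - intros (v & Hv & H). exists v. induction H.
    + now constructor.
    + eapply step_eval; eauto.
  - intros (v & H). exists v; eauto using eval_value, eval_reds.
Qed.

Lemma TS_eval t k : TS t k <-> exists v c, eval t v c /\ k = c + size t.
Proof.
  unfold TS. setoid_rewrite Time_eval. firstorder.
Qed.

Lemma eval_app_head t u v c : eval (App t u) v c <->
  exists h c1 c2, eval t h c1 /\ eval (App h u) v c2 /\ c = c1 + c2.
Proof.
  split.
  - intros H. inversion H as [|? ? b w ? c1 c2 c3 H1 H2 H3]; subst; [contradiction|].
    exists (Abs b), c1, (0 + c2 + step_cost (App (Abs b) w) (subst (scons w Var) b) + c3).
    split; [|split]; [assumption| |lia].
    eapply eval_app; eauto. now constructor.
  - intros (h & c1 & c2 & H1 & H2 & ->).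
    inversion H2 as [|? ? b w ? d1 d2 d3 H3 H4 H5]; subst; [contradiction|].
    apply eval_of_value in H3 as [<- ->]; [|eapply eval_value; eauto].
    replace (_ + _) with (c1 + d2 + step_cost (App (Abs b) w) (subst (scons w Var) b) + d3)
      by lia.
    eapply eval_app; eauto.
Qed.

(** A spine sees its head only through the value of the head and the cost of reaching it. The
    closure conditions carry a spine [us], and this is how it is removed. *)
Lemma eval_apps_head us : forall t v c, eval (apps t us) v c <->
  exists h c1 c2, eval t h c1 /\ eval (apps h us) v c2 /\ c = c1 + c2.
Proof.
  induction us as [|u us IH]; intros t v c; simpl.
  - split.
    + intros H. exists v, c, 0. split; [|split]; auto.
      constructor; eapply eval_value; eauto.
    + intros (h & c1 & c2 & H1 & H2 & ->).
      apply eval_of_value in H2 as [-> ->]; [|eapply eval_value; eauto].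
      now rewrite Nat.add_0_r.
  - rewrite IH. split.
    + intros (h & c1 & c2 & H1 & H2 & ->).
      apply eval_app_head in H1 as (h' & d1 & d2 & H1 & H3 & ->).
      exists h', d1, (d2 + c2). split; [|split]; [assumption| |lia].
      apply IH. eauto 6.
    + intros (h & c1 & c2 & H1 & H2 & ->).
      apply IH in H2 as (h' & d1 & d2 & H2 & H3 & ->).
      exists h', (c1 + d1), d2. split; [|split]; [|assumption|lia].
      apply eval_app_head. eauto 6.
Qed.

(** * Cost of evaluating a closure *)

(** Contracting [App (Abs b) w] changes the size from [size b + 1 + size w] to
    [size b + o * size w - o], where [o] is the number of occurrences replaced. *)
Definition beta_cost (o m : nat) : nat := Nat.max (o * m - (o + 1 + m)) 1.

(** Evaluating the bindings [th] turns the substitution [s] into [s'] at total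
    cost [c], in a body where the name [x] occurs [o x] times. *)
Inductive eval_env (o : nat -> nat) :
  list (nat * term) -> (nat -> term) -> (nat -> term) -> nat -> Prop :=
| eval_env_nil s : eval_env o [] s s 0
| eval_env_cons x u th s s' w c1 c2 :
    eval u w c1 -> eval_env o th (upd x w s) s' c2 ->
    eval_env o ((x, u) :: th) s s' (c1 + beta_cost (o x) (size w) + c2).

(** Induction on the bindings, with the substitution [s] accumulated so far kept general:
    contracting the first binder turns [s] into [upd x w s] on the remaining abstractions. The cost
    of this involves [occ x t] for the original [t], whatever [s] has put in. *)
Lemma eval_lams t th : forall s v c, NoDup (map fst th) ->
  eval (apps (subst s (lams (map fst th) t)) (map snd th)) v c <->
  exists s' c1 c2, eval_env (fun x => occ x t) th s s' c1 /\
    eval (subst s' t) v c2 /\ c = c1 + c2.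
Proof.
  induction th as [|[x u] th IH]; intros s v c Hnd; simpl map in *.
  - simpl. split.
    + intros H; exists s, 0, c; split; [constructor|auto].
    + intros (s' & c1 & c2 & H1 & H2 & ->). inversion H1; subst; auto.
  - inversion Hnd as [|? ? Hx Hnd']; subst.
    cbn [lams fold_right apps fold_left]. fold (lams (map fst th) t).
    unfold lam at 1. cbn [subst].
    set (b := subst (up s) _).
    assert (Hb : forall w, subst (scons w Var) b = subst (upd x w s) (lams (map fst th) t))
      by (intros; apply beta_lam).
    assert (Hc : forall w, step_cost (App (Abs b) w) (subst (scons w Var) b)
                           = beta_cost (occ x t) (size w)).
    { intros w. assert (Hs := size_subst b (scons w Var) 0 (size w) eq_refl).
      (* Substituted terms are shifted by [up s], so they contribute no index 0, and the inner
         binders have names other than [x]; the index 0 of [b] marks exactly the occurrences of [x]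
         in [t]. *)
      assert (Ho : occ 0 b = occ x t).
      { unfold b. rewrite (occ_subst _ (up s) 0 0); [|reflexivity|].
        - rewrite (occ_ren1 _ _ _ x); [now apply occ_lams|].
          intros y; destruct (Nat.eqb_spec y x); split; congruence.
        - intros [|y] Hy; [congruence|]. apply occ_ren0; congruence. }
      rewrite Ho in Hs. unfold step_cost, beta_cost. cbn [size].
      cut (forall c, c <> 0 -> size (scons w Var c) = 1).
      - intros H; apply Hs in H. lia.
      - intros [|y]; simpl; congruence. }
    fold (apps (App (Abs b) u) (map snd th)).
    rewrite eval_apps_head. split.
    + intros (h & c1 & c2 & H1 & H2 & ->).
      inversion H1 as [|? ? b' w ? d1 d2 d3 H3 H4 H5]; subst; [contradiction|].
      apply eval_of_value in H3 as [[= ->] ->]; [|exact I].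
      assert (H6 : eval (apps (subst (scons w Var) b) (map snd th)) v (d3 + c2))
        by (apply eval_apps_head; eauto 6).
      rewrite Hb in H6. apply IH in H6 as (s' & e1 & e2 & H6 & H7 & E); [|assumption].
      rewrite Hc.
      exists s', (d2 + beta_cost (occ x t) (size w) + e1), e2.
      split; [|split]; [econstructor; eauto|assumption|lia].
    + intros (s' & c1 & c2 & H1 & H2 & ->).
      inversion H1 as [|? ? ? ? ? w d1 d2 H3 H4]; subst.
      assert (H6 : eval (apps (subst (upd x w s) (lams (map fst th) t)) (map snd th)) v (d2 + c2))
        by (apply IH; eauto 6).
      rewrite <- Hb in H6.
      apply eval_apps_head in H6 as (h & e1 & e2 & H6 & H7 & E).
      exists h, (0 + d1 + step_cost (App (Abs b) w) (subst (scons w Var) b) + e1), e2.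
      split; [|split]; [|assumption|rewrite Hc; lia].
      eapply eval_app; eauto. now constructor.
Qed.

Lemma eval_clo t th v c : NoDup (map fst th) ->
  eval (clo t th) v c <->
  exists s c1 c2, eval_env (fun x => occ x t) th Var s c1 /\
    eval (subst s t) v c2 /\ c = c1 + c2.
Proof.
  intros H. rewrite <- eval_lams by assumption. now rewrite subst_Var.
Qed.

Lemma eval_env_app o th1 th2 : forall s s' c,
  eval_env o (th1 ++ th2) s s' c <->
  exists s1 c1 c2, eval_env o th1 s s1 c1 /\ eval_env o th2 s1 s' c2 /\ c = c1 + c2.
Proof.
  induction th1 as [|[x u] th1 IH]; intros s s' c; simpl.
  - split.
    + intros H; exists s, 0, c; split; [constructor|auto].
    + intros (s1 & c1 & c2 & H1 & H2 & ->). inversion H1; subst; auto.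
  - split.
    + intros H; inversion H as [|? ? ? ? ? w d1 d2 H3 H4]; subst.
      apply IH in H4 as (s1 & c1 & c2 & H4 & H5 & ->).
      exists s1, (d1 + beta_cost (o x) (size w) + c1), c2.
      split; [|split]; [econstructor; eauto|assumption|lia].
    + intros (s1 & c1 & c2 & H1 & H2 & ->).
      inversion H1 as [|? ? ? ? ? w d1 d2 H3 H4]; subst.
      replace (_ + _ + _ + _) with (d1 + beta_cost (o x) (size w) + (d2 + c2)) by lia.
      econstructor; eauto. apply IH; eauto 6.
Qed.

Lemma eval_env_single o x u s w c : eval u w c ->
  eval_env o [(x, u)] s (upd x w s) (c + beta_cost (o x) (size w)).
Proof.
  intros H. rewrite <- (Nat.add_0_r (_ + _)). econstructor; eauto. constructor.
Qed.

Lemma eval_env_single_inv o x u s s' c : eval_env o [(x, u)] s s' c ->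
  exists w d, eval u w d /\ s' = upd x w s /\ c = d + beta_cost (o x) (size w).
Proof.
  intros H; inversion H as [|? ? ? ? ? w d1 d2 H3 H4]; subst.
  inversion H4; subst. exists w, d1. repeat split; auto; lia.
Qed.

Lemma eval_env_occ_ext o o' th : forall s s' c,
  (forall x, In x (map fst th) -> o x = o' x) ->
  eval_env o th s s' c -> eval_env o' th s s' c.
Proof.
  induction th as [|[x u] th IH]; intros s s' c Ho H; inversion H; subst.
  - constructor.
  - rewrite Ho by (simpl; auto). econstructor; eauto. apply IH; simpl in *; auto.
Qed.

Lemma eval_env_out o th s s' c x : eval_env o th s s' c ->
  ~ In x (map fst th) -> s' x = s x.
Proof.
  induction 1 as [|y u th s s' w c1 c2 _ _ IH]; simpl; intros Hx; [reflexivity|].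
  rewrite IH by tauto. unfold upd. destruct (Nat.eqb_spec x y); [|reflexivity].
  subst; tauto.
Qed.

(** Arguments lie outside the scope of the binders, so neither their evaluation nor its cost depends
    on the initial substitution. Concatenation relies on this, since there the second group starts
    from the substitution left by the first. *)
Lemma eval_env_base o th s s' c : eval_env o th s s' c -> forall r,
  exists r', eval_env o th r r' c /\ forall x, In x (map fst th) -> r' x = s' x.
Proof.
  induction 1 as [|y u th s s' w c1 c2 H1 H2 IH]; intros r.
  - exists r; split; [constructor|simpl; tauto].
  - destruct (IH (upd y w r)) as (r' & H3 & H4).
    exists r'; split; [econstructor; eauto|].
    intros x Hx. destruct (in_dec Nat.eq_dec x (map fst th)) as [Hi|Hi]; auto.
    destruct Hx as [<-|Hx]; [|tauto]. simpl.
    rewrite (eval_env_out _ _ _ _ _ _ H2), (eval_env_out _ _ _ _ _ _ H3) by assumption.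
    unfold upd. now rewrite Nat.eqb_refl.
Qed.

(** * The generators of saturation *)

(** A saturated set containing [(t, p)] contains [(t', p + n)] whenever
    [tr n t t']; all closure conditions have this form. *)
Inductive tr : nat -> term -> term -> Prop :=
| tr_mono t n : tr n t t
| tr_exch t0 th y1 v1 y2 v2 xi us :
    NoDup (map fst (th ++ [(y1, v1); (y2, v2)] ++ xi)) ->
    tr 0 (apps (clo t0 (th ++ [(y1, v1); (y2, v2)] ++ xi)) us)
         (apps (clo t0 (th ++ [(y2, v2); (y1, v1)] ++ xi)) us)
| tr_weak t0 th z w k us :
    NoDup (map fst (th ++ [(z, w)])) -> fresh z t0 -> TS w k ->
    tr (k + 2) (apps (clo t0 th) us) (apps (clo t0 (th ++ [(z, w)])) us)
| tr_contr t0 th z1 z2 z w us :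
    NoDup (map fst (th ++ [(z1, w); (z2, w)])) ->
    NoDup (map fst (th ++ [(z, w)])) ->
    (fresh z t0 \/ z = z1 \/ z = z2) ->
    tr 0 (apps (clo t0 (th ++ [(z1, w); (z2, w)])) us)
         (apps (clo (merge z1 z2 z t0) (th ++ [(z, w)])) us)
| tr_concat t0 th t1 xi us :
    NoDup (map fst (th ++ xi)) ->
    (forall x, In x (map fst th) -> fresh x t1) ->
    (forall x, In x (map fst xi) -> fresh x t0) ->
    tr 0 (apps (App (clo t0 th) (clo t1 xi)) us)
         (apps (clo (App t0 t1) (th ++ xi)) us)
| tr_id t0 x us :
    tr 3 (apps t0 us) (apps (clo (Var x) [(x, t0)]) us).

Lemma tr_app n t t' u : tr n t t' -> tr n (App t u) (App t' u).
Proof.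
  assert (E : forall s us, App (apps s us) u = apps s (us ++ [u]))
    by (intros; now rewrite apps_app).
  destruct 1; rewrite ?E; constructor; auto.
Qed.

(** * Effect of each generator on time and size *)

Definition TS_le (n : nat) (t t' : term) : Prop :=
  forall h c, eval t h c -> exists c', eval t' h c' /\ c' + size t' <= c + size t + n.

(** Here it matters that [TS_le] demands the same value [h] on both sides: behind an unchanged value
    the spine costs the same, and it adds the same to both sizes. *)
Lemma TS_le_apps n t t' us : TS_le n t t' -> TS_le n (apps t us) (apps t' us).
Proof.
  intros H h c Hc. apply eval_apps_head in Hc as (v & c1 & c2 & H1 & H2 & ->).
  apply H in H1 as (c' & H1 & Hle). exists (c' + c2). split.
  - apply eval_apps_head. eauto 6.
  - rewrite !size_apps. lia.
Qed.

Lemma NoDup_swap {T} (l1 l2 : list T) a b :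
  NoDup (l1 ++ a :: b :: l2) -> NoDup (l1 ++ b :: a :: l2).
Proof.
  apply Permutation_NoDup, Permutation_app_head, perm_swap.
Qed.

(** Exchange changes neither cost nor size: each contraction is charged by its own name, and updates
    at distinct names commute. *)
Lemma TS_le_exch t0 th y1 v1 y2 v2 xi :
  NoDup (map fst (th ++ [(y1, v1); (y2, v2)] ++ xi)) ->
  TS_le 0 (clo t0 (th ++ [(y1, v1); (y2, v2)] ++ xi))
          (clo t0 (th ++ [(y2, v2); (y1, v1)] ++ xi)).
Proof.
  intros Hnd h c H.
  apply eval_clo in H as (s & c1 & c2 & H1 & H2 & ->); [|assumption].
  apply eval_env_app in H1 as (s1 & d1 & d2 & H1 & H3 & ->).
  apply eval_env_app in H3 as (s2 & d3 & d4 & H3 & H4 & ->).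
  inversion H3 as [|? ? ? ? ? w1 e1 e2 H5 H6]; subst.
  apply eval_env_single_inv in H6 as (w2 & e3 & H6 & -> & ->).
  exists (d1 + (e3 + beta_cost (occ y2 t0) (size w2)
                + (e1 + beta_cost (occ y1 t0) (size w1)) + d4) + c2).
  split.
  - apply eval_clo.
    + rewrite !map_app in Hnd |- *; simpl in Hnd |- *. apply NoDup_swap. assumption.
    + exists s, (d1 + (e3 + beta_cost (occ y2 t0) (size w2)
                + (e1 + beta_cost (occ y1 t0) (size w1)) + d4)), c2.
      split; [|auto].
      apply eval_env_app. exists s1, d1. eexists; split; [eassumption|]. split; [|reflexivity].
      apply eval_env_app. exists (upd y1 w1 (upd y2 w2 s1)). do 2 eexists. split; [|split].
      * eapply eval_env_cons; [exact H6|]. apply eval_env_single. exact H5.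
      * replace (upd y1 w1 (upd y2 w2 s1)) with (upd y2 w2 (upd y1 w1 s1)); [eassumption|].
        extensionality y; unfold upd.
        destruct (Nat.eqb_spec y y1), (Nat.eqb_spec y y2); auto. subst.
        rewrite !map_app in Hnd; simpl in Hnd.
        apply NoDup_app_remove_l in Hnd. inversion Hnd; subst. simpl in *; tauto.
      * lia.
  - rewrite !size_clo, !length_app, !map_app, !list_sum_app; simpl. lia.
Qed.

(** A binder without occurrences costs 1 to contract and adds 1 to the size; these make up the
    constant 2. The rest is the time and size of [w], that is [k]. *)
Lemma TS_le_weak t0 th z w k :
  NoDup (map fst (th ++ [(z, w)])) -> fresh z t0 -> TS w k ->
  TS_le (k + 2) (clo t0 th) (clo t0 (th ++ [(z, w)])).
Proof.
  intros Hnd Hz Hw h c H.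
  apply eval_clo in H as (s & c1 & c2 & H1 & H2 & ->);
    [|rewrite map_app in Hnd; now apply NoDup_app_remove_r in Hnd].
  apply TS_eval in Hw as (v & cw & Hw & ->).
  exists (c1 + (cw + beta_cost (occ z t0) (size v)) + c2). split.
  - apply eval_clo; [assumption|].
    exists (upd z v s), (c1 + (cw + beta_cost (occ z t0) (size v))), c2.
    split; [|split]; [| |reflexivity].
    + apply eval_env_app. do 3 eexists. split; [eassumption|].
      split; [|reflexivity]. now apply eval_env_single.
    + rewrite (subst_ext_occ t0 _ s); [assumption|].
      intros x Hx. unfold upd. destruct (Nat.eqb_spec x z); [subst; tauto|reflexivity].
  - rewrite !size_clo, !length_app, !map_app, !list_sum_app; simpl.
    unfold beta_cost. rewrite Hz; simpl. lia.
Qed.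

Lemma NoDup_snoc_neq {T} (l : list T) a b : NoDup (l ++ [a]) -> In b l -> b <> a.
Proof.
  intros H Hb ->. apply NoDup_remove_2 in H. rewrite app_nil_r in H. tauto.
Qed.

Lemma occ_merge_other x y z w t : w <> x -> w <> y -> w <> z ->
  occ w (merge x y z t) = occ w t.
Proof.
  intros. apply occ_ren1. intros v.
  destruct (Nat.eqb_spec v x), (Nat.eqb_spec v y); simpl; split; congruence.
Qed.

(** The names sent to [z] are [x], [y] and [z] itself; if [z] differs from the other two, it
    contributes nothing by freshness. *)
Lemma occ_merge x y z t : x <> y -> (fresh z t \/ z = x \/ z = y) ->
  occ z (merge x y z t) = occ x t + occ y t.
Proof.
  intros Hxy Hz. unfold merge.
  destruct (Nat.eq_dec z x) as [E1|E1]; [|destruct (Nat.eq_dec z y) as [E2|E2]].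
  1, 2: rewrite (occ_ren _ _ _ [x; y]);
    [simpl; lia|repeat constructor; simpl; intuition congruence|];
    intros v; destruct (Nat.eqb_spec v x), (Nat.eqb_spec v y); simpl; intuition congruence.
  rewrite (occ_ren _ _ _ [x; y; z]).
  - simpl. unfold fresh in Hz. intuition lia.
  - repeat constructor; simpl; intuition congruence.
  - intros v; destruct (Nat.eqb_spec v x), (Nat.eqb_spec v y); simpl; intuition congruence.
Qed.

(** Merging adds the occurrence counts, and the single contraction can exceed the sum of the two
    former costs by at most [size v + 1]. The dropped copy of [w] pays for this: it saves its
    evaluation cost, its size and one binder, and [size v] is at most the size plus the cost of
    [w]. *)
Lemma TS_le_contr t0 th z1 z2 z w :
  NoDup (map fst (th ++ [(z1, w); (z2, w)])) ->
  NoDup (map fst (th ++ [(z, w)])) ->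
  (fresh z t0 \/ z = z1 \/ z = z2) ->
  TS_le 0 (clo t0 (th ++ [(z1, w); (z2, w)]))
          (clo (merge z1 z2 z t0) (th ++ [(z, w)])).
Proof.
  intros Hnd Hnd' Hz h c H.
  apply eval_clo in H as (s & c1 & c2 & H1 & H2 & ->); [|assumption].
  apply eval_env_app in H1 as (s1 & d1 & d2 & H1 & H3 & ->).
  inversion H3 as [|? ? ? ? ? v e1 e2 H5 H6]; subst.
  apply eval_env_single_inv in H6 as (v2 & e3 & H6 & -> & ->).
  destruct (eval_fun _ _ _ H5 _ _ H6) as [-> ->].
  rewrite !map_app in Hnd, Hnd'; simpl in Hnd, Hnd'.
  assert (H12 : z1 <> z2).
  { apply NoDup_app_remove_l in Hnd. inversion Hnd; subst; simpl in *; intuition. }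
  assert (Ho := occ_merge z1 z2 z t0 H12 Hz).
  exists (d1 + (e1 + beta_cost (occ z (merge z1 z2 z t0)) (size v)) + c2). split.
  - apply eval_clo; [rewrite map_app; assumption|].
    exists (upd z v s1), (d1 + (e1 + beta_cost (occ z (merge z1 z2 z t0)) (size v))), c2.
    split; [|split]; [| |reflexivity].
    + apply eval_env_app. do 3 eexists. split; [|split; [|reflexivity]].
      * eapply eval_env_occ_ext; [|eassumption].
        intros x Hx. simpl. symmetry; apply occ_merge_other.
        -- apply NoDup_snoc_neq with (map fst th); [|assumption].
           change [z1; z2] with ([z1] ++ [z2]) in Hnd. rewrite app_assoc in Hnd.
           now apply NoDup_app_remove_r in Hnd.
        -- apply NoDup_snoc_neq with (map fst th); [|assumption].
           now apply NoDup_remove_1 in Hnd.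
        -- eapply NoDup_snoc_neq; eassumption.
      * now apply (eval_env_single (fun x => occ x (merge z1 z2 z t0))).
    + unfold merge. rewrite subst_ren.
      erewrite (subst_ext_occ t0); [eassumption|].
      intros x Hx. simpl. unfold upd.
      destruct (Nat.eqb_spec x z1), (Nat.eqb_spec x z2); simpl; rewrite ?Nat.eqb_refl; auto.
      destruct (Nat.eqb_spec x z); auto. subst. unfold fresh in Hz; intuition.
  - rewrite !size_clo, !length_app, !map_app, !list_sum_app; simpl.
    unfold merge at 2. rewrite size_ren, Ho. apply eval_size in H5.
    unfold beta_cost. rewrite Nat.mul_add_distr_r. lia.
Qed.

Lemma NoDup_app_disjoint {T} (l1 l2 : list T) x :
  NoDup (l1 ++ l2) -> In x l1 -> In x l2 -> False.
Proof.
  intros H H1 H2. apply in_split in H1 as (l & l' & ->).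
  rewrite <- app_assoc in H; simpl in H. apply NoDup_remove_2 in H.
  apply H. rewrite !in_app_iff; auto.
Qed.

(** By freshness each name occurs in [App t0 t1] as often as in its own half, so both sides contract
    the same binders at the same cost and have the same size. The combined substitution [r] agrees
    with [s0] on [t0] and with [s1] on [t1]. *)
Lemma TS_le_concat t0 th t1 xi :
  NoDup (map fst (th ++ xi)) ->
  (forall x, In x (map fst th) -> fresh x t1) ->
  (forall x, In x (map fst xi) -> fresh x t0) ->
  TS_le 0 (App (clo t0 th) (clo t1 xi)) (clo (App t0 t1) (th ++ xi)).
Proof.
  intros Hnd H1 H0 h c H. assert (Hnd' := Hnd). rewrite map_app in Hnd'.
  inversion H as [|? ? b w ? c1 c2 c3 Hb Hw Hh]; subst; [contradiction|].
  apply eval_clo in Hb as (s0 & d1 & d2 & E0 & Hb & ->);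
    [|now apply NoDup_app_remove_r in Hnd'].
  apply eval_clo in Hw as (s1 & e1 & e2 & E1 & Hw & ->);
    [|now apply NoDup_app_remove_l in Hnd'].
  destruct (eval_env_base _ _ _ _ _ E1 s0) as (r & E1' & Hr).
  assert (Ht0 : subst r t0 = subst s0 t0).
  { apply subst_ext_occ. intros x Hx. eapply eval_env_out; [eassumption|].
    intros Hi; now apply H0 in Hi. }
  assert (Ht1 : subst r t1 = subst s1 t1).
  { apply subst_ext_occ. intros x Hx.
    destruct (in_dec Nat.eq_dec x (map fst xi)) as [Hi|Hi]; [auto|].
    rewrite (eval_env_out _ _ _ _ _ _ E1' Hi), (eval_env_out _ _ _ _ _ _ E1 Hi).
    eapply eval_env_out; [eassumption|]. intros Hj; now apply H1 in Hj. }
  eexists. split.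
  - apply eval_clo; [assumption|]. exists r, (d1 + e1). eexists.
    split; [|split; [|reflexivity]].
    + apply eval_env_app. exists s0, d1, e1. split; [|split; [|reflexivity]];
        (eapply eval_env_occ_ext; [|eassumption]); intros x Hx; simpl.
      * rewrite (H1 x Hx). lia.
      * rewrite (H0 x Hx). lia.
    + simpl. rewrite Ht0, Ht1. eapply eval_app; eassumption.
  - simpl. rewrite !size_clo, !length_app, !map_app, !list_sum_app; simpl. lia.
Qed.

(** The closure is the identity applied to [t0]: the identity has size 2, and contracting it costs
    the minimum 1. *)
Lemma TS_le_id t0 x : TS_le 3 t0 (clo (Var x) [(x, t0)]).
Proof.
  intros h c H. exists (c + beta_cost 1 (size h) + 0). split.
  - apply eval_clo; [repeat constructor; simpl; auto|].
    exists (upd x h Var), (c + beta_cost 1 (size h)), 0. split; [|split; [|reflexivity]].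
    + assert (E := eval_env_single (fun y => occ y (Var x)) x t0 Var h c H).
      simpl in E. now rewrite Nat.eqb_refl in E.
    + simpl. unfold upd. rewrite Nat.eqb_refl. constructor. eapply eval_value; eauto.
  - rewrite size_clo. simpl. unfold beta_cost. lia.
Qed.

Lemma tr_TS n t t' k : tr n t t' -> TS t k -> exists k', TS t' k' /\ k' <= k + n.
Proof.
  intros Htr. cut (TS_le n t t').
  - intros H Hk. apply TS_eval in Hk as (v & c & Hv & ->).
    apply H in Hv as (c' & Hv & Hle). exists (c' + size t'). split; [|assumption].
    apply TS_eval; eauto.
  - destruct Htr.
    + intros h c H; exists c; split; [assumption|lia].
    + now apply TS_le_apps, TS_le_exch.
    + now apply TS_le_apps, TS_le_weak.
    + now apply TS_le_apps, TS_le_contr.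
    + now apply TS_le_apps, TS_le_concat.
    + now apply TS_le_apps, TS_le_id.
Qed.

(** * Higher order polynomials *)

Lemma hup_up_ren (s : nat -> hop) f :
  (fun x => hup s (up_ren f x)) = hup (fun x => s (f x)).
Proof. extensionality x; destruct x; reflexivity. Qed.

Lemma hsubst_hren p : forall s f, hsubst s (hren f p) = hsubst (fun x => s (f x)) p.
Proof.
  induction p as [x|p IHp q IHq|a p IHp|n|]; intros s f; simpl; try reflexivity.
  - now rewrite IHp, IHq.
  - now rewrite IHp, hup_up_ren.
Qed.

Lemma hren_hsubst_HVar p : forall f, hren f p = hsubst (fun x => HVar (f x)) p.
Proof.
  induction p as [x|p IHp q IHq|a p IHp|n|]; intros f; simpl; try reflexivity.
  - now rewrite IHp, IHq.
  - rewrite IHp. do 2 f_equal. extensionality x; destruct x; reflexivity.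
Qed.

Lemma hren_hren p f g : hren f (hren g p) = hren (fun x => f (g x)) p.
Proof. now rewrite (hren_hsubst_HVar (hren g p)), hsubst_hren, <- hren_hsubst_HVar. Qed.

Lemma hren_hup f s :
  (fun x => hren (up_ren f) (hup s x)) = hup (fun x => hren f (s x)).
Proof.
  extensionality x; destruct x; simpl; [reflexivity|].
  now rewrite !hren_hren.
Qed.

Lemma hren_hsubst p : forall f s, hren f (hsubst s p) = hsubst (fun x => hren f (s x)) p.
Proof.
  induction p as [x|p IHp q IHq|a p IHp|n|]; intros f s; simpl; try reflexivity.
  - now rewrite IHp, IHq.
  - now rewrite IHp, hren_hup.
Qed.

Lemma hsubst_hup s1 s2 :
  (fun x => hsubst (hup s2) (hup s1 x)) = hup (fun x => hsubst s2 (s1 x)).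
Proof.
  extensionality x; destruct x; simpl; [reflexivity|].
  now rewrite hsubst_hren, hren_hsubst.
Qed.

Lemma hsubst_hsubst p : forall s1 s2,
  hsubst s2 (hsubst s1 p) = hsubst (fun x => hsubst s2 (s1 x)) p.
Proof.
  induction p as [x|p IHp q IHq|a p IHp|n|]; intros s1 s2; simpl; try reflexivity.
  - now rewrite IHp, IHq.
  - now rewrite IHp, hsubst_hup.
Qed.

Lemma hsubst_ext_hty G p s : hty G p s -> forall f g,
  (forall x, x < length G -> f x = g x) -> hsubst f p = hsubst g p.
Proof.
  induction 1 as [G x s H|G p q s t _ IHp _ IHq|G s p t _ IH|G n|G];
    intros f g Hfg; simpl; try reflexivity.
  - apply Hfg. apply nth_error_Some. congruence.
  - now rewrite (IHp f g), (IHq f g).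
  - f_equal. apply IH. intros [|x] Hx; simpl in *; [reflexivity|].
    rewrite Hfg by lia. reflexivity.
Qed.

Lemma hup_HVar : hup HVar = HVar.
Proof. extensionality x; destruct x; reflexivity. Qed.

Lemma hsubst_HVar p : hsubst HVar p = p.
Proof.
  induction p as [x|p IHp q IHq|a p IHp|n|]; simpl; try reflexivity.
  - now rewrite IHp, IHq.
  - now rewrite hup_HVar, IHp.
Qed.

Lemma hsubst_closed p s f : hty [] p s -> hsubst f p = p.
Proof.
  intros H. rewrite <- (hsubst_HVar p) at 2.
  eapply hsubst_ext_hty; [eassumption|]. simpl; lia.
Qed.

(** * Typing and equality under renaming and substitution *)

Definition ren_ok (f : nat -> nat) (G G' : list sty) : Prop :=
  forall x s, nth_error G x = Some s -> nth_error G' (f x) = Some s.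

Lemma ren_ok_up f G G' s : ren_ok f G G' -> ren_ok (up_ren f) (s :: G) (s :: G').
Proof. intros H [|x] s' E; [exact E|now apply H]. Qed.

Lemma ren_ok_S G s : ren_ok S G (s :: G).
Proof. intros x s' H; exact H. Qed.

Lemma hty_hren G p s : hty G p s -> forall f G', ren_ok f G G' -> hty G' (hren f p) s.
Proof.
  induction 1; intros f G' Hf; simpl; try econstructor; eauto using ren_ok_up.
Qed.

Lemma hty_S G p s a : hty G p s -> hty (a :: G) (hren S p) s.
Proof. intros H; eapply hty_hren; eauto using ren_ok_S. Qed.

Lemma hty_hsubst G p s : hty G p s -> forall f G',
  (forall x s, nth_error G x = Some s -> hty G' (f x) s) -> hty G' (hsubst f p) s.
Proof.
  induction 1; intros f G' Hf; simpl; try (econstructor; eauto; fail); auto.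
  constructor. apply IHhty. intros [|x] s' Hx; simpl in *.
  - injection Hx as ->. constructor; reflexivity.
  - now apply hty_S, Hf.
Qed.

Lemma hty_beta G a p t q : hty (a :: G) p t -> hty G q a ->
  hty G (hsubst (scons q HVar) p) t.
Proof.
  intros Hp Hq. eapply hty_hsubst; [eassumption|].
  intros [|x] s Hx; simpl in *; [congruence|now constructor].
Qed.

Lemma hty_hadd G p q : hty G p Base -> hty G q Base -> hty G (hadd p q) Base.
Proof. intros. repeat (econstructor; eauto). Qed.

Lemma heq_hty G p q s : heq G p q s -> hty G p s /\ hty G q s.
Proof.
  induction 1; repeat match goal with H : _ /\ _ |- _ => destruct H end;
    split; eauto using hty_hadd, hty_num; try (econstructor; eauto; fail).
  - econstructor; eauto. constructor; auto.
  - eapply hty_beta; eauto.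
  - constructor. econstructor; [apply hty_S; eassumption|]. now constructor.
Qed.

Lemma heq_hty_l G p q s : heq G p q s -> hty G p s.
Proof. intros H; now apply heq_hty in H. Qed.

Lemma heq_hty_r G p q s : heq G p q s -> hty G q s.
Proof. intros H; now apply heq_hty in H. Qed.

Lemma heq_hren G p q s : heq G p q s -> forall f G', ren_ok f G G' ->
  heq G' (hren f p) (hren f q) s.
Proof.
  induction 1; intros f G' Hf; cbn [hren hadd];
    try (econstructor; eauto using hty_hren, ren_ok_up; fail).
  - replace (hren f (hsubst (scons q HVar) p))
      with (hsubst (scons (hren f q) HVar) (hren (up_ren f) p)).
    + apply heq_beta; eauto using hty_hren, ren_ok_up.
    + rewrite hsubst_hren, hren_hsubst. f_equal.
      extensionality x; destruct x; reflexivity.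
  - replace (hren (up_ren f) (hren S p)) with (hren S (hren f p))
      by now rewrite !hren_hren.
    apply heq_eta. eapply hty_hren; eauto.
Qed.

Lemma heq_S G p q s a : heq G p q s -> heq (a :: G) (hren S p) (hren S q) s.
Proof. intros H; eapply heq_hren; eauto using ren_ok_S. Qed.

Lemma heq_hadd G p p' q q' : heq G p p' Base -> heq G q q' Base ->
  heq G (hadd p q) (hadd p' q') Base.
Proof.
  intros. eapply heq_app; eauto. eapply heq_app; eauto.
  apply heq_refl; constructor.
Qed.

(** * Laws of pointwise addition *)

Lemma hren_hplus s : forall f p q, hren f (hplus s p q) = hplus s (hren f p) (hren f q).
Proof.
  induction s as [|s1 IH1 s2 IH2]; intros f p q; simpl; [reflexivity|].
  rewrite IH2. simpl. now rewrite !hren_hren.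
Qed.

Lemma hsubst_hplus s : forall f p q,
  hsubst f (hplus s p q) = hplus s (hsubst f p) (hsubst f q).
Proof.
  induction s as [|s1 IH1 s2 IH2]; intros f p q; simpl; [reflexivity|].
  rewrite IH2. simpl. now rewrite !hsubst_hren, !hren_hsubst.
Qed.

Lemma hty_hplus s : forall G p q, hty G p s -> hty G q Base -> hty G (hplus s p q) s.
Proof.
  induction s as [|s1 IH1 s2 IH2]; intros G p q Hp Hq; simpl.
  - now apply hty_hadd.
  - constructor. apply IH2; [|now apply hty_S].
    econstructor; [apply hty_S; eassumption|]. now constructor.
Qed.

Lemma heq_hplus s : forall G p p' q q', heq G p p' s -> heq G q q' Base ->
  heq G (hplus s p q) (hplus s p' q') s.
Proof.
  induction s as [|s1 IH1 s2 IH2]; intros G p p' q q' Hp Hq; simpl.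
  - now apply heq_hadd.
  - apply heq_lam. apply IH2; [|now apply heq_S].
    eapply heq_app; [apply heq_S; eassumption|]. apply heq_refl. now constructor.
Qed.

(** Addition is pointwise, so it passes through an application by one beta step. In this form an
    offset follows a polynomial through all its arguments. *)
Lemma heq_app_hplus G s1 s2 p m q :
  hty G p (Arr s1 s2) -> hty G m Base -> hty G q s1 ->
  heq G (HApp (hplus (Arr s1 s2) p m) q) (hplus s2 (HApp p q) m) s2.
Proof.
  intros Hp Hm Hq. simpl.
  replace (hplus s2 (HApp p q) m)
    with (hsubst (scons q HVar) (hplus s2 (HApp (hren S p) (HVar 0)) (hren S m))).
  - apply heq_beta; [|assumption]. apply hty_hplus; [|now apply hty_S].
    econstructor; [apply hty_S; eassumption|]. now constructor.
  - rewrite hsubst_hplus. simpl. rewrite !hsubst_hren. simpl.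
    change (fun x : nat => HVar x) with HVar. now rewrite !hsubst_HVar.
Qed.

Lemma heq_hplus_hplus s : forall G p m n,
  hty G p s -> hty G m Base -> hty G n Base ->
  heq G (hplus s (hplus s p m) n) (hplus s p (hadd m n)) s.
Proof.
  induction s as [|s1 IH1 s2 IH2]; intros G p m n Hp Hm Hn.
  - simpl. apply heq_sym. now apply heq_addA.
  - assert (Hv : hty (s1 :: G) (HVar 0) s1) by now constructor.
    assert (Ha : hty (s1 :: G) (HApp (hren S p) (HVar 0)) s2)
      by (econstructor; [apply hty_S|]; eassumption).
    change (hplus (Arr s1 s2) (hplus (Arr s1 s2) p m) n) with
      (HLam s1 (hplus s2 (HApp (hren S (hplus (Arr s1 s2) p m)) (HVar 0)) (hren S n))).
    apply heq_lam. rewrite hren_hplus.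
    eapply heq_trans.
    + apply heq_hplus; [|apply heq_refl; now apply hty_S].
      apply heq_app_hplus; auto using hty_S.
    + apply IH2; auto using hty_S.
Qed.

Lemma heq_hplus_0 s : forall G p, hty G p s -> heq G (hplus s p (HNum 0)) p s.
Proof.
  induction s as [|s1 IH1 s2 IH2]; intros G p Hp; simpl.
  - now apply heq_add0.
  - eapply heq_trans; [|apply heq_eta; assumption].
    apply heq_lam, IH2. econstructor; [apply hty_S; eassumption|]. now constructor.
Qed.

Lemma heq_hplus_num G s p m n : hty G p s ->
  heq G (hplus s (hplus s p (HNum m)) (HNum n)) (hplus s p (HNum (m + n))) s.
Proof.
  intros Hp. eapply heq_trans; [apply heq_hplus_hplus; auto using hty_num|].
  apply heq_hplus; [now apply heq_refl|apply heq_num].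
Qed.

(** * Zero polynomials and the values of [down] *)

Lemma hty_hzero s : forall G, hty G (hzero s) s.
Proof. induction s; intros; simpl; constructor; auto. Qed.

Lemma hsubst_hzero s f : hsubst f (hzero s) = hzero s.
Proof. eapply hsubst_closed. apply hty_hzero. Qed.

Lemma hty_down s : forall G p, hty G p s -> hty G (down s p) Base.
Proof.
  induction s as [|s1 IH1 s2 IH2]; intros G p Hp; simpl; [assumption|].
  apply IH2. econstructor; eauto. apply hty_hzero.
Qed.

Lemma hsubst_down s : forall f p, hsubst f (down s p) = down s (hsubst f p).
Proof.
  induction s as [|s1 IH1 s2 IH2]; intros f p; simpl; [reflexivity|].
  rewrite IH2. simpl. now rewrite hsubst_hzero.
Qed.

Lemma heq_down s : forall G p q, heq G p q s -> heq G (down s p) (down s q) Base.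
Proof.
  induction s as [|s1 IH1 s2 IH2]; intros G p q H; simpl; [assumption|].
  apply IH2. eapply heq_app; eauto. apply heq_refl, hty_hzero.
Qed.

Lemma heq_down_hplus s : forall G p m, hty G p s -> hty G m Base ->
  heq G (down s (hplus s p m)) (hadd (down s p) m) Base.
Proof.
  induction s as [|s1 IH1 s2 IH2]; intros G p m Hp Hm.
  - apply heq_refl. now apply hty_hadd.
  - cbn [down]. eapply heq_trans.
    + apply heq_down. apply heq_app_hplus; auto using hty_hzero.
    + apply IH2; auto. econstructor; eauto using hty_hzero.
Qed.

Lemma heq_hadd_num G p q m n : heq G p (HNum m) Base -> heq G q (HNum n) Base ->
  heq G (hadd p q) (HNum (m + n)) Base.
Proof. intros. eapply heq_trans; [apply heq_hadd; eassumption|apply heq_num]. Qed.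

Lemma down_val_hplus s p m k n : hty [] p s -> down_val s p k -> heq [] m (HNum n) Base ->
  down_val s (hplus s p m) (k + n).
Proof.
  intros Hp Hk Hn. unfold down_val.
  eapply heq_trans; [apply heq_down_hplus; [assumption|]|].
  - eapply heq_hty_l; eassumption.
  - now apply heq_hadd_num.
Qed.

Lemma down_val_heq s p q n : heq [] p q s -> down_val s p n -> down_val s q n.
Proof.
  intros H Hn. eapply heq_trans; [|eassumption]. apply heq_sym, heq_down, H.
Qed.

Lemma down_val_hzero s : down_val s (hzero s) 0.
Proof.
  unfold down_val. induction s as [|s1 IH1 s2 IH2]; simpl.
  - apply heq_refl; constructor.
  - eapply heq_trans; [|exact IH2]. apply heq_down.
    replace (hzero s2) with (hsubst (scons (hzero s1) HVar) (hzero s2)) at 2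
      by apply hsubst_hzero.
    apply heq_beta; apply hty_hzero.
Qed.

(** * Normalization and monotonicity of closed polynomials *)

(** At the base type [hle p q] says that [p] is a numeral and that [q] is [p]
    plus a numeral.  Stating it this way avoids having to show that distinct
    numerals are not provably equal. *)
Fixpoint hle (s : sty) (p q : hop) : Prop :=
  match s with
  | Base => exists m r, heq [] p (HNum m) Base /\ heq [] q (hadd p (HNum r)) Base
  | Arr s1 s2 => hty [] p (Arr s1 s2) /\ hty [] q (Arr s1 s2) /\
      forall a b, hle s1 a b -> hle s2 (HApp p a) (HApp q b)
  end.

Lemma hle_hty s p q : hle s p q -> hty [] p s /\ hty [] q s.
Proof.
  destruct s; simpl; [|tauto]. intros (m & r & H1 & H2).
  split; eapply heq_hty_l; eassumption.
Qed.

Lemma hle_heq s : forall p p' q q', heq [] p p' s -> heq [] q q' s ->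
  hle s p q -> hle s p' q'.
Proof.
  induction s as [|s1 IH1 s2 IH2]; intros p p' q q' Hp Hq H; simpl in *.
  - destruct H as (m & r & H1 & H2). exists m, r. split.
    + eapply heq_trans; [apply heq_sym|]; eassumption.
    + eapply heq_trans; [apply heq_sym; eassumption|].
      eapply heq_trans; [eassumption|]. apply heq_hadd; [assumption|].
      apply heq_refl; constructor.
  - destruct H as (H1 & H2 & H3).
    split; [|split]; [eapply heq_hty_r; eassumption|eapply heq_hty_r; eassumption|].
    intros a b Hab. destruct (hle_hty _ _ _ Hab) as [Ha Hb].
    eapply IH2; [| |apply H3, Hab]; eapply heq_app; eauto using heq_refl.
Qed.

Lemma hle_hplus_const : hle (Arr Base (Arr Base Base)) HPlus HPlus.
Proof.
  simpl. split; [constructor|split; [constructor|]].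
  intros a b (m & r & Ha & Hb).
  assert (Ta := heq_hty_l _ _ _ _ Ha). assert (Tb := heq_hty_l _ _ _ _ Hb).
  split; [econstructor; eauto; constructor|split; [econstructor; eauto; constructor|]].
  intros a' b' (m' & r' & Ha' & Hb').
  assert (Ta' := heq_hty_l _ _ _ _ Ha').
  exists (m + m'), (r + r'). split; [now apply heq_hadd_num|].
  fold (hadd b b') (hadd a a').
  eapply heq_trans; [apply heq_hadd; eassumption|].
  assert (Hn : forall n, hty [] (HNum n) Base) by constructor.
  (* From here on, [(a + r) + (a' + r')] is regrouped as [(a + a') + (r + r')]. *)
  eapply heq_trans; [apply heq_sym, heq_addA; auto using hty_hadd|].
  eapply heq_trans; [|apply heq_addA; auto using hty_hadd].
  apply heq_hadd; [now apply heq_refl|].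
  eapply heq_trans; [apply heq_addA; auto using hty_hadd|].
  eapply heq_trans; [apply heq_hadd; [apply heq_addC; auto|apply heq_refl; auto]|].
  eapply heq_trans; [apply heq_sym, heq_addA; auto using hty_hadd|].
  apply heq_hadd; [now apply heq_refl|apply heq_num].
Qed.

(** Fundamental lemma of the logical relation [hle]. Taken at the identity substitution on closed
    polynomials it gives reflexivity, which contains both normalization at base type and
    monotonicity at arrow types. *)
Lemma hle_fundamental G p s : hty G p s -> forall f g,
  (forall x a, nth_error G x = Some a -> hle a (f x) (g x)) ->
  hle s (hsubst f p) (hsubst g p).
Proof.
  induction 1 as [G x s H|G p q s t Hp IHp Hq IHq|G s p t Hp IH|G n|G];
    intros f g Hfg; simpl hsubst.
  - now apply Hfg.
  - destruct (IHp f g Hfg) as (_ & _ & H). apply H. now apply IHq.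
  - assert (T : forall h, (forall x a, nth_error G x = Some a -> hty [] (h x) a) ->
      hty [s] (hsubst (hup h) p) t).
    { intros h Hh. eapply hty_hsubst; [eassumption|].
      intros [|x] a Hx; simpl in *; [injection Hx as ->; now constructor|].
      now apply hty_S, Hh. }
    assert (Tf : hty [s] (hsubst (hup f) p) t)
      by (apply T; intros x a Hx; now destruct (hle_hty _ _ _ (Hfg _ _ Hx))).
    assert (Tg : hty [s] (hsubst (hup g) p) t)
      by (apply T; intros x a Hx; now destruct (hle_hty _ _ _ (Hfg _ _ Hx))).
    split; [now constructor|split; [now constructor|]].
    intros a b Hab. destruct (hle_hty _ _ _ Hab) as [Ta Tb].
    (* Both redexes are contracted, which [hle] allows since it respects equality; the bodies are
       then related under the substitutions extended by [a] and [b]. *)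
    eapply hle_heq; [apply heq_sym, heq_beta; assumption
                    |apply heq_sym, heq_beta; assumption|].
    rewrite !hsubst_hsubst. apply IH.
    intros [|x] c Hx; simpl in *; [injection Hx as ->; exact Hab|].
    rewrite !hsubst_hren. simpl. change (fun x : nat => HVar x) with HVar.
    rewrite !hsubst_HVar. auto.
  - exists n, 0. split; [apply heq_refl; constructor|].
    apply heq_sym, heq_add0; constructor.
  - apply hle_hplus_const.
Qed.

Lemma hle_refl p s : hty [] p s -> hle s p p.
Proof.
  intros H. assert (E := hle_fundamental _ _ _ H HVar HVar).
  rewrite hsubst_HVar in E. apply E. intros [|x] a; discriminate.
Qed.

(** A zero function applied to anything is zero again, so the claim descends along the type. At base
    type the assumption [hle s p q] supplies the value [m + r] of [q], which is zero plus itself. *)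
Lemma hle_hzero s : forall p q, hle s p q -> hle s (hzero s) q.
Proof.
  induction s as [|s1 IH1 s2 IH2]; intros p q H; simpl in *.
  - destruct H as (m & r & H1 & H2). exists 0, (m + r).
    split; [apply heq_refl; constructor|].
    eapply heq_trans; [eassumption|].
    eapply heq_trans; [apply heq_hadd_num; [eassumption|apply heq_refl; constructor]|].
    apply heq_sym. apply (heq_num [] 0 (m + r)).
  - destruct H as (H1 & H2 & H3). split; [|split]; [apply (hty_hzero (Arr s1 s2))|assumption|].
    intros a b Hab. destruct (hle_hty _ _ _ Hab) as [Ta _].
    eapply hle_heq; [apply heq_sym, heq_beta; [apply hty_hzero|exact Ta]|
                     |rewrite hsubst_hzero; eapply IH2; apply H3, Hab].
    apply heq_refl. econstructor; eauto. now apply hle_hty in Hab.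
Qed.

Lemma hle_down s : forall p q, hle s p q -> hle Base (down s p) (down s q).
Proof.
  induction s as [|s1 IH1 s2 IH2]; intros p q H; [exact H|]. cbn [down].
  apply IH2. destruct H as (_ & _ & H). apply H. apply hle_refl, hty_hzero.
Qed.

Lemma down_val_exists s p : hty [] p s -> exists n, down_val s p n.
Proof.
  intros H. apply hle_refl, hle_down in H as (m & r & Hm & _). now exists m.
Qed.

Lemma num_exists p : hty [] p Base -> exists n, heq [] p (HNum n) Base.
Proof. exact (down_val_exists Base p). Qed.

(** [down] feeds zero to [p] where the application feeds [q], and [p] is monotone. The size bound of
    a function passes to its applications this way. *)
Lemma down_val_app s1 s2 p q n : hty [] p (Arr s1 s2) -> hty [] q s1 ->
  down_val (Arr s1 s2) p n -> exists n', down_val s2 (HApp p q) n' /\ n <= n'.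
Proof.
  intros Hp Hq Hn.
  destruct (hle_refl _ _ Hp) as (_ & _ & H).
  destruct (hle_down _ _ _ (H _ _ (hle_hzero _ _ _ (hle_refl _ _ Hq)))) as (m & r & _ & Hr).
  exists (n + r). split; [|lia].
  eapply heq_trans; [exact Hr|]. apply heq_hadd_num; [exact Hn|].
  apply heq_refl; constructor.
Qed.

Lemma heq_fold_hplus s ms ks :
  Forall2 (fun m k => heq [] m (HNum k) Base) ms ks -> forall p, hty [] p s ->
  heq [] (fold_left (hplus s) ms p) (hplus s p (HNum (list_sum ks))) s.
Proof.
  induction 1 as [|m k ms ks H _ IH]; intros p Hp; simpl.
  - apply heq_sym, heq_hplus_0, Hp.
  - assert (Hm := heq_hty_l _ _ _ _ H).
    eapply heq_trans; [apply IH; now apply hty_hplus|].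
    eapply heq_trans; [|apply heq_hplus_num, Hp].
    apply heq_hplus; [|apply heq_refl; constructor].
    apply heq_hplus; [now apply heq_refl|assumption].
Qed.

(** * Instantiation *)

Lemma Forall2_nth_error_r {S T} (P : S -> T -> Prop) l1 l2 : Forall2 P l1 l2 ->
  forall i b, nth_error l2 i = Some b -> exists a, nth_error l1 i = Some a /\ P a b.
Proof.
  induction 1 as [|a b l1 l2 H _ IH]; intros [|i] c Hc; simpl in *; try discriminate.
  - injection Hc as <-. eauto.
  - auto.
Qed.

Lemma hty_hinst G p s qs : hty G p s -> Forall2 (hty []) qs G ->
  hty [] (hinst p qs) s.
Proof.
  intros Hp Hqs. eapply hty_hsubst; [eassumption|]. intros x a Hx. simpl.
  destruct (Forall2_nth_error_r _ _ _ Hqs _ _ Hx) as (q & Hq & Tq).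
  now rewrite (nth_error_nth _ _ _ Hq).
Qed.

Lemma hinst_hren G p s f qs qs' : hty G p s -> length G = length qs ->
  (forall i, i < length qs -> nth_error qs' (f i) = nth_error qs i) ->
  hinst (hren f p) qs' = hinst p qs.
Proof.
  intros Hp Hl Hf. unfold hinst. rewrite hsubst_hren.
  eapply hsubst_ext_hty; [eassumption|]. intros i Hi. rewrite Hl in Hi.
  apply nth_error_nth. rewrite Hf by assumption. now apply nth_error_nth'.
Qed.

Lemma hinst_app_l G p s qs qs' : hty G p s -> length G = length qs ->
  hinst p (qs ++ qs') = hinst p qs.
Proof.
  intros Hp Hl. eapply hsubst_ext_hty; [eassumption|].
  intros i Hi. apply app_nth1. lia.
Qed.

Lemma hty_app_l G G' p s : hty G p s -> hty (G ++ G') p s.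
Proof.
  intros H. rewrite <- (hsubst_HVar p). change HVar with (fun x => HVar (id x)).
  rewrite <- hren_hsubst_HVar. eapply hty_hren; [eassumption|].
  intros x a Hx. unfold id. rewrite nth_error_app1; [assumption|].
  apply nth_error_Some; congruence.
Qed.

Fixpoint down_sum (i : nat) (G : list sty) : hop :=
  match G with
  | [] => HNum 0
  | s :: G => hadd (down s (HVar i)) (down_sum (S i) G)
  end.

Lemma hty_down_sum G2 : forall G1, hty (G1 ++ G2) (down_sum (length G1) G2) Base.
Proof.
  induction G2 as [|s G2 IH]; intros G1; simpl; [constructor|].
  apply hty_hadd.
  - apply hty_down. constructor. rewrite nth_error_app2, Nat.sub_diag; auto.
  - specialize (IH (G1 ++ [s])). rewrite length_app, Nat.add_comm, <- app_assoc in IH.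
    exact IH.
Qed.

Lemma hsubst_down_sum G qs ns : Forall2 (fun qa n => down_val (snd qa) (fst qa) n)
    (combine qs G) ns -> length qs = length G -> forall i f,
  (forall j q, nth_error qs j = Some q -> f (i + j) = q) ->
  heq [] (hsubst f (down_sum i G)) (HNum (list_sum ns)) Base.
Proof.
  revert qs ns; induction G as [|s G IH]; intros qs ns H Hl i f Hf;
    destruct qs as [|q qs]; try discriminate; simpl in H; inversion H; subst.
  - apply heq_refl; constructor.
  - cbn [down_sum hsubst]. cbn [list_sum fold_right]. fold (list_sum l').
    apply (heq_hadd_num [] (hsubst f (down s (HVar i))) (hsubst f (down_sum (S i) G))).
    + rewrite hsubst_down. simpl. rewrite <- (Nat.add_0_r i), (Hf 0 q); auto.
    + apply (IH qs); auto.
      intros j q' Hj. simpl. rewrite <- Nat.add_succ_r. now apply Hf.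
Qed.

(** * Saturated sets *)

Lemma TS_bound_heq s t p p' : heq [] p p' s -> TS_bound s t p -> TS_bound s t p'.
Proof.
  intros H (k & n & Hk & Hn & Hle). exists k, n. eauto using down_val_heq.
Qed.

Lemma TS_bound_tr s n t t' p : tr n t t' -> hty [] p s -> TS_bound s t p ->
  TS_bound s t' (hplus s p (HNum n)).
Proof.
  intros Htr Hp (k & m & Hk & Hm & Hle).
  destruct (tr_TS _ _ _ _ Htr Hk) as (k' & Hk' & Hle').
  exists k', (m + n). split; [assumption|]. split; [|lia].
  apply down_val_hplus; auto. apply heq_refl; constructor.
Qed.

Lemma saturated_tr s X : saturated s X -> forall n t t' p,
  tr n t t' -> X t p -> X t' (hplus s p (HNum n)).
Proof.
  intros HX n t t' p Htr H.
  assert (E : heq [] p (hplus s p (HNum 0)) s)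
    by (apply heq_sym, heq_hplus_0; eapply sat_type; eauto).
  destruct Htr; try (eapply sat_heq; [exact HX| |exact E]).
  - eapply sat_mono; eassumption.
  - eapply sat_exch; eassumption.
  - eapply sat_weak; eassumption.
  - eapply sat_contr; eassumption.
  - eapply sat_concat; eassumption.
  - eapply sat_id; eassumption.
Qed.

(** With the generators packed into [tr], four conditions suffice. A generator of offset 0 adds the
    numeral 0, which equality removes, and convergence is part of the bound on [TS]. *)
Lemma saturated_intro s (X : term -> hop -> Prop) :
  (forall t p, X t p -> hty [] p s) ->
  (forall t p p', X t p -> heq [] p p' s -> X t p') ->
  (forall t p, X t p -> TS_bound s t p) ->
  (forall n t t' p, tr n t t' -> X t p -> X t' (hplus s p (HNum n))) ->
  saturated s X.
Proof.
  intros H1 H2 H3 H4.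
  assert (H0 : forall t t' p, tr 0 t t' -> X t p -> X t' p).
  { intros t t' p Htr H. eapply H2; [eapply H4; eauto|]. eauto using heq_hplus_0. }
  constructor; auto.
  - intros t p H. destruct (H3 _ _ H) as (k & _ & (c & (v & Hv & Hc) & _) & _).
    now exists v, c.
  - intros t p n. apply H4. constructor.
  - intros. eapply H0; [apply tr_exch|]; eassumption.
  - intros. eapply H4; [apply tr_weak|]; eassumption.
  - intros. eapply H0; [apply tr_contr|]; eassumption.
  - intros. eapply H0; [apply tr_concat|]; eassumption.
  - intros. eapply H4; [apply tr_id|]; eassumption.
Qed.

(** This is the largest saturated set of type [s]. It is the witness wherever a family of saturated
    sets has to be nonempty. *)
Lemma saturated_TS_bound s : saturated s (fun t p => hty [] p s /\ TS_bound s t p).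
Proof.
  apply saturated_intro.
  - tauto.
  - intros t p p' [Hp Hb] E. eauto using heq_hty_r, TS_bound_heq.
  - tauto.
  - intros n t t' p Htr [Hp Hb]. split; [|eapply TS_bound_tr; eauto].
    apply hty_hplus; [assumption|constructor].
Qed.

(** The bound on [TS] comes from one member, which is why the family must have one; the other
    conditions pass to intersections directly. *)
Lemma saturated_inter {I} (P : I -> Prop) s (F : I -> term -> hop -> Prop) :
  (exists i, P i) -> (forall i, P i -> saturated s (F i)) ->
  saturated s (fun t p => hty [] p s /\ forall i, P i -> F i t p).
Proof.
  intros [i0 Hi0] HF. apply saturated_intro.
  - tauto.
  - intros t p p' [Hp H] E. split; [eauto using heq_hty_r|].
    intros i Hi. eapply sat_heq; eauto.
  - intros t p [_ H]. eapply sat_bound; eauto.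
  - intros n t t' p Htr [Hp H]. split; [apply hty_hplus; auto; constructor|].
    intros i Hi. eapply saturated_tr; eauto.
Qed.

Lemma heq_hplus_comm s p m n : hty [] p s -> hty [] m Base -> hty [] n Base ->
  heq [] (hplus s (hplus s p m) n) (hplus s (hplus s p n) m) s.
Proof.
  intros Hp Hm Hn. eapply heq_trans; [now apply heq_hplus_hplus|].
  eapply heq_trans; [|apply heq_sym; now apply heq_hplus_hplus].
  apply heq_hplus; [now apply heq_refl|now apply heq_addC].
Qed.

(** Generators are stable under applying both sides to [u], so closure is inherited from [X]. The
    offset [n] is then moved past the argument value [m] by commutativity. *)
Lemma saturated_lolli s X (Y : term -> hop -> Prop) : saturated s X ->
  (forall u m, Y u m -> hty [] m Base) ->
  saturated s (fun t p => hty [] p s /\ TS_bound s t p /\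
    forall u m, Y u m -> X (App t u) (hplus s p m)).
Proof.
  intros HX HY. apply saturated_intro.
  - tauto.
  - intros t p p' (Hp & Hb & H) E. split; [eauto using heq_hty_r|].
    split; [eauto using TS_bound_heq|]. intros u m Hm.
    eapply sat_heq; [eassumption|eauto|]. apply heq_hplus; [assumption|].
    apply heq_refl; eauto.
  - tauto.
  - intros n t t' p Htr (Hp & Hb & H). split; [apply hty_hplus; auto; constructor|].
    split; [eapply TS_bound_tr; eauto|]. intros u m Hm.
    eapply sat_heq; [exact HX|eapply (saturated_tr _ X HX); [apply tr_app; eassumption|eauto]|].
    apply heq_hplus_comm; eauto using hty_num.
Qed.

Lemma saturated_imp s1 s2 X (Y : term -> hop -> Prop) : saturated s2 X ->
  (forall u q, Y u q -> hty [] q s1) ->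
  saturated (Arr s1 s2) (fun t p => hty [] p (Arr s1 s2) /\ TS_bound (Arr s1 s2) t p /\
    forall u q, Y u q -> X (App t u) (HApp p q)).
Proof.
  intros HX HY. apply saturated_intro.
  - tauto.
  - intros t p p' (Hp & Hb & H) E. split; [eauto using heq_hty_r|].
    split; [eauto using TS_bound_heq|]. intros u m Hm.
    eapply sat_heq; [eassumption|eauto|]. eapply heq_app; [eassumption|].
    apply heq_refl; eauto.
  - tauto.
  - intros n t t' p Htr (Hp & Hb & H).
    split; [apply (hty_hplus (Arr s1 s2)); auto; constructor|].
    split; [eapply TS_bound_tr; eauto|]. intros u m Hm.
    eapply sat_heq; [exact HX|eapply (saturated_tr _ X HX); [apply tr_app; eassumption|eauto]|].
    apply heq_sym, heq_app_hplus; eauto using hty_num.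
Qed.

Lemma saturated_iff s (X Y : term -> hop -> Prop) :
  (forall t p, X t p <-> Y t p) -> saturated s X -> saturated s Y.
Proof.
  intros E HX. apply saturated_intro.
  - intros t p H; apply E in H; eapply sat_type; eauto.
  - intros t p p' H Hp; apply E in H; apply E; eapply sat_heq; eauto.
  - intros t p H; apply E in H; eapply sat_bound; eauto.
  - intros n t t' p Htr H; apply E in H; apply E; eapply saturated_tr; eauto.
Qed.

(** * Saturation of the realizability sets *)

Lemma realizes_hty A eta t p : realizes A eta t p -> hty [] p (oty A).
Proof. destruct A; simpl; tauto. Qed.

Lemma oty_linear L : linear L -> oty L = Base.
Proof. induction L; simpl; tauto. Qed.

Lemma valuation_scons X eta : saturated Base X -> valuation eta -> valuation (scons X eta).
Proof. intros HX H [|a]; simpl; auto. Qed.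

Lemma saturated_realizes_all A eta :
  (forall eta, valuation eta -> saturated (oty A) (realizes A eta)) ->
  valuation eta -> saturated (oty (FAll A)) (realizes (FAll A) eta).
Proof.
  intros IH He. simpl.
  apply (saturated_inter (saturated Base) (oty A) (fun X => realizes A (scons X eta))).
  - exists (fun t p => hty [] p Base /\ TS_bound Base t p). apply saturated_TS_bound.
  - intros X HX. apply IH. now apply valuation_scons.
Qed.

Lemma saturated_realizes_linear L : linear L -> forall eta, valuation eta ->
  saturated (oty L) (realizes L eta).
Proof.
  induction L as [a|L IH|L IH|L IH1 M IH2|A _ B _]; intros HL eta He.
  - apply saturated_iff with (eta a); [|apply He].
    intros t p; simpl; split; [|tauto].
    intros H; split; [eapply sat_type; eauto|assumption].
  - apply saturated_realizes_all; auto.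
  - destruct HL as [HL _]. simpl. rewrite (oty_linear _ HL) in IH.
    eapply saturated_iff;
      [|apply (saturated_inter (fun X => saturated Base X /\
           forall s r, realizes L (scons X eta) s r -> X s r) Base (fun X => X))].
    + intros t p; simpl. firstorder.
    (* The family of saturated pre-fixed points has a member: the largest saturated set contains
       every saturated set, in particular its own image. *)
    + exists (fun t p => hty [] p Base /\ TS_bound Base t p).
      split; [apply saturated_TS_bound|]. intros s r H.
      assert (HX : saturated Base (realizes L (scons (fun t p => hty [] p Base /\ TS_bound Base t p) eta))).
      { apply IH; auto. apply valuation_scons; auto. apply saturated_TS_bound. }
      split; [eapply sat_type; eauto|eapply sat_bound; eauto].
    + tauto.
  - destruct HL as [H1 H2]. apply saturated_lolli; auto.
    intros u m H. apply realizes_hty in H. now rewrite oty_linear in H.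
  - destruct HL.
Qed.

Lemma saturated_realizes A : formula A -> forall eta, valuation eta ->
  saturated (oty A) (realizes A eta).
Proof.
  induction 1 as [L HL|A _ IH|L B HL _ IH|A B _ _ _ IH]; intros eta He.
  - now apply saturated_realizes_linear.
  - apply saturated_realizes_all; auto.
  - apply saturated_lolli; auto.
    intros u m H. apply realizes_hty in H. now rewrite oty_linear in H.
  - apply saturated_imp; auto. intros u q. apply realizes_hty.
Qed.

(** * Formulas *)

(** Each variable satisfies an inclusion unless it occurs with one sign only: left to right unless
    all occurrences are negative, right to left unless all are positive. The two hypotheses exchange
    roles on the left of an arrow, so the induction closes. *)
Lemma realizes_mono A : forall eta eta',
  (forall a, (forall t p, eta a t p -> eta' a t p) \/ polarity false a A) ->
  (forall a, (forall t p, eta' a t p -> eta a t p) \/ polarity true a A) ->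
  forall t p, realizes A eta t p -> realizes A eta' t p.
Proof.
  assert (Hs : forall (P : nat -> Prop) (eta eta' : nat -> term -> hop -> Prop) X,
    (forall a, (forall t p, eta a t p -> eta' a t p) \/ P (S a)) ->
    forall a, (forall t p, scons X eta a t p -> scons X eta' a t p) \/ P a).
  { intros P eta eta' X H [|a]; simpl; [left; auto|apply H]. }
  induction A as [a|A IH|A IH|A IHA B IHB|A IHA B IHB]; intros eta eta' H1 H2 t p H;
    simpl in *.
  - destruct (H1 a) as [E|E]; [|discriminate (E eq_refl)]. split; [tauto|apply E, H].
  - destruct H as [Hp H]; split; [assumption|]. intros X HX.
    apply IH with (scons X eta); auto.
    + apply (Hs (fun a => polarity false a A)), H1.
    + apply (Hs (fun a => polarity true a A)), H2.
  - destruct H as [Hp H]; split; [assumption|]. intros X HX Hcl.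
    apply H; [assumption|]. intros s r Hr. apply Hcl. revert Hr.
    apply IH.
    + apply (Hs (fun a => polarity false a A)), H1.
    + apply (Hs (fun a => polarity true a A)), H2.
  - destruct H as (Hp & Hb & H). split; [assumption|]. split; [assumption|].
    intros u m Hm. apply IHB with eta.
    + intros a; destruct (H1 a); tauto.
    + intros a; destruct (H2 a); tauto.
    + apply H. revert Hm. apply IHA; intros a; [destruct (H2 a)|destruct (H1 a)]; tauto.
  - destruct H as (Hp & Hb & H). split; [assumption|]. split; [assumption|].
    intros u m Hm. apply IHB with eta.
    + intros a; destruct (H1 a); tauto.
    + intros a; destruct (H2 a); tauto.
    + apply H. revert Hm. apply IHA; intros a; [destruct (H2 a)|destruct (H1 a)]; tauto.
Qed.

Lemma realizes_ext A eta eta' : (forall a t p, eta a t p <-> eta' a t p) ->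
  forall t p, realizes A eta t p <-> realizes A eta' t p.
Proof.
  intros H t p; split; apply realizes_mono; intros a; left; intros; now apply H.
Qed.

Lemma oty_fren A : forall f, oty (fren f A) = oty A.
Proof. induction A; intros f; simpl; congruence. Qed.

Lemma scons_up_ren {T} (X : T) eta f :
  (fun a => scons X eta (up_ren f a)) = scons X (fun a => eta (f a)).
Proof. extensionality a; destruct a; reflexivity. Qed.

Lemma realizes_fren A : forall f eta t p,
  realizes (fren f A) eta t p <-> realizes A (fun a => eta (f a)) t p.
Proof.
  induction A as [a|A IH|A IH|A IHA B IHB|A IHA B IHB]; intros f eta t p; simpl.
  - tauto.
  - rewrite oty_fren. split; intros [Hp H]; (split; [assumption|]); intros X HX.
    + rewrite <- scons_up_ren. apply IH, H, HX.
    + apply IH. rewrite scons_up_ren. apply H, HX.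
  - split; intros [Hp H]; (split; [assumption|]); intros X HX Hcl; apply (H X HX);
      intros s r Hr; apply Hcl.
    + rewrite <- scons_up_ren. now apply IH.
    + apply IH. rewrite scons_up_ren. assumption.
  - rewrite oty_fren. setoid_rewrite IHA. setoid_rewrite IHB. tauto.
  - rewrite !oty_fren. setoid_rewrite IHA. setoid_rewrite IHB. tauto.
Qed.

Lemma oty_fup s : (forall a, oty (s a) = Base) -> forall a, oty (fup s a) = Base.
Proof. intros H [|a]; simpl; [reflexivity|]. now rewrite oty_fren. Qed.

Lemma oty_fsubst A : forall s, (forall a, oty (s a) = Base) -> oty (fsubst s A) = oty A.
Proof.
  induction A as [a|A IH|A IH|A IHA B IHB|A IHA B IHB]; intros s Hs; simpl; auto.
  - apply IH, oty_fup, Hs.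
  - now rewrite IHA, IHB.
Qed.

(** At index 0 the two valuations differ only by the typing condition built into [realizes] of a
    variable, and a saturated [X] satisfies it already. *)
Lemma realizes_fup s eta X A : saturated Base X -> forall t p,
  realizes A (fun a => realizes (fup s a) (scons X eta)) t p <->
  realizes A (scons X (fun a => realizes (s a) eta)) t p.
Proof.
  intros HX. apply realizes_ext. intros [|a] t p; simpl.
  - split; [tauto|]. intros H; split; [eapply sat_type; eauto|assumption].
  - apply (realizes_fren (s a) S (scons X eta)).
Qed.

(** The images must have type [Base], as propositional variables have: then [oty A] is unchanged,
    and the bounds on [TS] coincide on both sides. *)
Lemma realizes_fsubst A : forall s, (forall a, oty (s a) = Base) -> forall eta t p,
  realizes (fsubst s A) eta t p <-> realizes A (fun a => realizes (s a) eta) t p.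
Proof.
  induction A as [a|A IH|A IH|A IHA B IHB|A IHA B IHB]; intros s Hs eta t p; simpl.
  - split; [|tauto]. intros H; split; [|assumption].
    apply realizes_hty in H. now rewrite Hs in H.
  - rewrite oty_fsubst by now apply oty_fup.
    split; intros [Hp H]; (split; [assumption|]); intros X HX.
    + apply realizes_fup; [assumption|]. apply IH; [now apply oty_fup|]. now apply H.
    + apply IH; [now apply oty_fup|]. apply realizes_fup; [assumption|]. now apply H.
  - split; intros [Hp H]; (split; [assumption|]); intros X HX Hcl; apply (H X HX);
      intros u r Hr; apply Hcl.
    + apply realizes_fup; [assumption|]. apply IH; [now apply oty_fup|]. assumption.
    + apply IH; [now apply oty_fup|]. apply realizes_fup; [assumption|]. assumption.
  - rewrite oty_fsubst by assumption.
    setoid_rewrite (IHA s Hs). setoid_rewrite (IHB s Hs). tauto.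
  - rewrite !oty_fsubst by assumption.
    setoid_rewrite (IHA s Hs). setoid_rewrite (IHB s Hs). tauto.
Qed.

Lemma oty_scons_FVar L : linear L -> forall a, oty (scons L FVar a) = Base.
Proof. intros HL [|a]; simpl; [now apply oty_linear|reflexivity]. Qed.

Lemma oty_fsubst1 A L : linear L -> oty (fsubst1 A L) = oty A.
Proof. intros HL. apply oty_fsubst, oty_scons_FVar, HL. Qed.

Lemma realizes_fsubst1 A L eta : linear L -> valuation eta -> forall t p,
  realizes (fsubst1 A L) eta t p <-> realizes A (scons (realizes L eta) eta) t p.
Proof.
  intros HL He t p. unfold fsubst1.
  rewrite realizes_fsubst by now apply oty_scons_FVar.
  apply realizes_ext. intros [|a] s r; simpl; [tauto|].
  split; [tauto|]. intros H; split; [eapply sat_type; eauto|assumption].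
Qed.

Lemma saturated_realizes_Base L eta : linear L -> valuation eta ->
  saturated Base (realizes L eta).
Proof.
  intros HL He. rewrite <- (oty_linear _ HL). now apply saturated_realizes_linear.
Qed.

Lemma realizes_mono_0 L eta X Y : polarity true 0 L ->
  (forall t p, X t p -> Y t p) -> forall t p,
  realizes L (scons X eta) t p -> realizes L (scons Y eta) t p.
Proof.
  intros HL H. apply realizes_mono.
  - intros [|a]; left; simpl; auto.
  - intros [|a]; simpl; auto.
Qed.

(** [FMu L] lies below each saturated pre-fixed point [X], so by positivity [L] at [FMu L] lies
    below [L] at [X], hence below [X]. *)
Lemma realizes_mu_fold L eta : linear (FMu L) -> valuation eta -> forall t p,
  realizes (fsubst1 L (FMu L)) eta t p -> realizes (FMu L) eta t p.
Proof.
  intros HL He t p H. apply (realizes_fsubst1 _ _ _ HL He) in H.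
  destruct HL as [HL Hpol].
  split; [apply realizes_hty in H; now rewrite (oty_linear _ HL) in H|].
  intros X HX Hcl. apply Hcl. revert H. apply realizes_mono_0; [assumption|].
  intros s r [_ Hr]. exact (Hr X HX Hcl).
Qed.

(** By folding and positivity, [L] at [FMu L] is itself a saturated pre-fixed point, so the least
    one is contained in it. *)
Lemma realizes_mu_unfold L eta : linear (FMu L) -> valuation eta -> forall t p,
  realizes (FMu L) eta t p -> realizes (fsubst1 L (FMu L)) eta t p.
Proof.
  intros HL He t p H. apply (realizes_fsubst1 _ _ _ HL He).
  assert (HM := saturated_realizes_Base _ _ HL He).
  assert (HF := realizes_mu_fold _ _ HL He).
  setoid_rewrite (realizes_fsubst1 L (FMu L) eta HL He) in HF.
  destruct HL as [HL Hpol]. destruct H as [_ H]. apply H.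
  - apply saturated_realizes_Base; auto. now apply valuation_scons.
  - apply realizes_mono_0; assumption.
Qed.

(** * Polarity, linearity and well-formedness under substitution *)

Lemma polarity_fren A : forall b f a a', (forall c, f c = a' <-> c = a) ->
  polarity b a' (fren f A) <-> polarity b a A.
Proof.
  assert (Hup : forall f a a', (forall c, f c = a' <-> c = a) ->
    forall c, up_ren f c = S a' <-> c = S a).
  { intros f a a' H [|c]; simpl; [split; discriminate|].
    specialize (H c). split; intros [= E]; f_equal; tauto. }
  induction A as [c|A IH|A IH|A IHA B IHB|A IHA B IHB]; intros b f a a' H; simpl.
  - rewrite H. tauto.
  - apply IH; auto.
  - apply IH; auto.
  - rewrite (IHA _ f a a'), (IHB _ f a a'); tauto.
  - rewrite (IHA _ f a a'), (IHB _ f a a'); tauto.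
Qed.

Lemma polarity_fren_fresh A : forall b f a, (forall c, f c <> a) -> polarity b a (fren f A).
Proof.
  assert (Hup : forall f a, (forall c, f c <> a) -> forall c, up_ren f c <> S a).
  { intros f a H [|c]; simpl; [discriminate|]. intros [= E]; now apply H in E. }
  induction A as [c|A IH|A IH|A IHA B IHB|A IHA B IHB]; intros b f a H; simpl; auto.
  intros E; now apply H in E.
Qed.

(** Through this, substitution preserves the positivity of a variable bound by [FMu]. Asking for
    both polarities of [a'] in the other images says that [a'] does not occur free in them. *)
Lemma polarity_fsubst A : forall b s a a', s a = FVar a' ->
  (forall c, c <> a -> forall b, polarity b a' (s c)) ->
  polarity b a A -> polarity b a' (fsubst s A).
Proof.
  assert (Hup : forall s a a', (forall c, c <> a -> forall b, polarity b a' (s c)) ->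
    forall c, c <> S a -> forall b, polarity b (S a') (fup s c)).
  { intros s a a' H [|c] Hc b; simpl; [discriminate|].
    apply (polarity_fren _ b S a'); [split; congruence|]. apply H; congruence. }
  induction A as [c|A IH|A IH|A IHA B IHB|A IHA B IHB]; intros b s a a' Ha Hs HA;
    simpl in *.
  - destruct (Nat.eq_dec c a) as [->|E]; [|now apply Hs].
    rewrite Ha; simpl. intros _; auto.
  - apply IH with (S a); [simpl; now rewrite Ha|exact (Hup s a a' Hs)|exact HA].
  - apply IH with (S a); [simpl; now rewrite Ha|exact (Hup s a a' Hs)|exact HA].
  - split; [apply IHA with a|apply IHB with a]; tauto.
  - split; [apply IHA with a|apply IHB with a]; tauto.
Qed.

Lemma linear_fren A : forall f, linear (fren f A) <-> linear A.
Proof.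
  induction A as [c|A IH|A IH|A IHA B IHB|A IHA B IHB]; intros f; simpl; auto; try tauto.
  - rewrite IH, (polarity_fren A true (up_ren f) 0 0); [tauto|].
    intros [|c]; simpl; split; congruence.
  - rewrite IHA, IHB; tauto.
Qed.

Lemma formula_all_inv A : formula (FAll A) -> formula A.
Proof. inversion 1; subst; [now apply formula_lin|assumption]. Qed.

Lemma formula_lolli_inv L B : formula (FLolli L B) -> linear L /\ formula B.
Proof.
  inversion 1 as [? HL| | |]; subst; [|auto]. destruct HL; split; auto using formula.
Qed.

Lemma formula_imp_inv A B : formula (FImp A B) -> formula A /\ formula B.
Proof. inversion 1 as [? HL| | |]; subst; [destruct HL|auto]. Qed.

Lemma formula_mu_inv L : formula (FMu L) -> linear (FMu L).
Proof. now inversion 1. Qed.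

Lemma formula_fren_inv A : forall f, formula (fren f A) -> formula A.
Proof.
  induction A as [c|A IH|A IH|A IHA B IHB|A IHA B IHB]; intros f H; simpl in H.
  - now apply formula_lin.
  - apply formula_all. eapply IH, formula_all_inv, H.
  - apply formula_mu_inv in H. apply formula_lin. exact (proj1 (linear_fren (FMu A) f) H).
  - apply formula_lolli_inv in H as [H1 H2]. apply formula_lolli; [|eauto].
    now apply linear_fren in H1.
  - apply formula_imp_inv in H as [H1 H2]. apply formula_imp; eauto.
Qed.

Lemma linear_fsubst A : forall s, (forall a, linear (s a)) -> linear A -> linear (fsubst s A).
Proof.
  assert (Hup : forall s, (forall a, linear (s a)) -> forall a, linear (fup s a)).
  { intros s H [|a]; simpl; [exact I|]. now apply linear_fren. }
  induction A as [c|A IH|A IH|A IHA B IHB|A IHA B IHB]; intros s Hs HA; simpl in *; auto.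
  - destruct HA as [HA Hpol]. split; [auto|].
    apply polarity_fsubst with 0; auto.
    intros [|c] Hc b; [congruence|]. apply polarity_fren_fresh. discriminate.
  - destruct HA; auto.
Qed.

Lemma formula_fsubst A : forall s, (forall a, linear (s a)) -> formula A -> formula (fsubst s A).
Proof.
  induction A as [c|A IH|A IH|A IHA B IHB|A IHA B IHB]; intros s Hs HA; simpl.
  - now apply formula_lin.
  - apply formula_all. apply IH; [|now apply formula_all_inv].
    intros [|a]; simpl; [exact I|]. now apply linear_fren.
  - apply formula_lin. apply (linear_fsubst (FMu A)); auto using formula_mu_inv.
  - apply formula_lolli_inv in HA as [H1 H2].
    apply formula_lolli; auto using linear_fsubst.
  - apply formula_imp_inv in HA as [H1 H2]. apply formula_imp; auto.
Qed.

Lemma linear_scons_FVar L : linear L -> forall a, linear (scons L FVar a).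
Proof. intros HL [|a]; simpl; auto. Qed.

(** * Invariants of typing *)

Lemma map_fst_lift_ctx G : map fst (lift_ctx G) = map fst G.
Proof. unfold lift_ctx. rewrite map_map. reflexivity. Qed.

Lemma dial_distinct G D t A : dial G D t A -> distinct G D.
Proof.
  induction 1; unfold distinct in *; rewrite ?map_app, ?map_fst_lift_ctx in *; simpl in *; auto.
  - repeat constructor; auto.
  - repeat constructor; auto.
  - rewrite <- app_assoc in IHdial. eapply NoDup_remove_1. exact IHdial.
  - rewrite app_assoc in IHdial. now apply NoDup_app_remove_r in IHdial.
  - revert IHdial. apply Permutation_NoDup. rewrite <- app_assoc.
    apply Permutation_app_head, Permutation_app_comm.
  - revert IHdial. apply Permutation_NoDup.
    now apply Permutation_app; apply Permutation_map.
Qed.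

(** Realizability sets are shown saturated for well-formed formulas, and unfolding [FMu] relies on
    positivity; both become available at every node of a derivation. *)
Lemma dial_formula G D t A : dial G D t A ->
  (forall b, In b G -> formula (snd b)) /\ (forall b, In b D -> linear (snd b)) /\ formula A.
Proof.
  induction 1 as [x A HA|x L HL|G D t L _ IH|G D t L HL _ IH|G D t A _ IH
    |G D t A L HL _ IH|G1 G2 D t u A B _ _ IH1 _ IH2|G D z t A B _ IH
    |G1 G2 D1 D2 t u L B _ _ IH1 _ IH2|G D z t L B _ IH|G D x y z t A B _ _ IH
    |G D x t L B _ IH|G G' D D' t B _ H1 H2 _ IH|G G' D D' t A HG HD _ IH].
  - split; [|split]; auto; simpl; [|tauto]. intros b [<-|[]]; auto.
  - split; [|split]; simpl; [tauto| |now apply formula_lin]. intros b [<-|[]]; auto.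
  - destruct IH as (? & ? & H); split; [|split]; auto.
    apply formula_mu_inv in H. apply formula_lin.
    apply linear_fsubst; [now apply linear_scons_FVar|]. apply H.
  - destruct IH as (? & ? & H); split; [|split]; auto. now apply formula_lin.
  - destruct IH as (H1 & H2 & H); split; [|split]; [| |now apply formula_all].
    + intros b Hb. apply (in_map (fun b => (fst b, fren S (snd b)))) in Hb.
      apply H1 in Hb. eapply formula_fren_inv, Hb.
    + intros b Hb. apply (in_map (fun b => (fst b, fren S (snd b)))) in Hb.
      apply H2 in Hb. eapply linear_fren, Hb.
  - destruct IH as (? & ? & H); split; [|split]; auto.
    apply formula_fsubst; [now apply linear_scons_FVar|now apply formula_all_inv].
  - destruct IH1 as (HG1 & HD & H1), IH2 as (HG2 & _ & _).
    apply formula_imp_inv in H1 as [_ HB]. split; [|auto].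
    intros b Hb; apply in_app_or in Hb as []; auto.
  - destruct IH as (H1 & H2 & H). split; [|split]; auto.
    + intros b Hb; apply H1, in_or_app; auto.
    + apply formula_imp; auto. apply (H1 (z, A)), in_or_app; simpl; auto.
  - destruct IH1 as (HG1 & HD1 & H1), IH2 as (HG2 & HD2 & _).
    apply formula_lolli_inv in H1 as [_ HB]. split; [|split]; auto;
    intros b Hb; apply in_app_or in Hb as []; auto.
  - destruct IH as (H1 & H2 & H). split; [|split]; auto.
    + intros b Hb; apply H2, in_or_app; auto.
    + apply formula_lolli; auto. apply (H2 (z, L)), in_or_app; simpl; auto.
  - destruct IH as (H1 & H2 & H). split; [|split]; auto.
    intros b Hb; apply in_app_or in Hb as [Hb|[<-|[]]].
    + apply H1, in_or_app; auto.
    + apply (H1 (x, A)), in_or_app; simpl; auto.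
  - destruct IH as (H1 & H2 & H). split; [|split]; auto.
    + intros b Hb; apply in_app_or in Hb as [Hb|[<-|[]]]; auto.
      apply formula_lin, (H2 (x, L)), in_or_app; simpl; auto.
    + intros b Hb; apply H2, in_or_app; auto.
  - destruct IH as (H3 & H4 & H). split; [|split]; auto;
    intros b Hb; apply in_app_or in Hb as []; auto.
  - destruct IH as (H1 & H2 & H). split; [|split]; auto; intros b Hb.
    + apply H1. eapply Permutation_in; [apply Permutation_sym|]; eassumption.
    + apply H2. eapply Permutation_in; [apply Permutation_sym|]; eassumption.
Qed.

Lemma occ_merge_le x y z w t : occ w (merge x y z t) <> 0 ->
  w = z \/ occ w t <> 0 /\ w <> x /\ w <> y.
Proof.
  intros H. destruct (Nat.eq_dec w z) as [E|E]; [auto|right].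
  destruct (Nat.eq_dec w x) as [->|Ex]; [|destruct (Nat.eq_dec w y) as [->|Ey]].
  1, 2: exfalso; apply H, occ_ren0; intros v;
    destruct (Nat.eqb_spec v x), (Nat.eqb_spec v y); simpl; congruence.
  rewrite occ_merge_other in H; auto.
Qed.

Lemma dial_occ G D t A : dial G D t A -> forall x, occ x t <> 0 ->
  In x (map fst G ++ map fst D).
Proof.
  induction 1; intros w Hw; rewrite ?map_app, ?map_fst_lift_ctx in *;
    rewrite ?occ_lam in Hw; cbn [occ] in Hw; simpl map in *; auto.
  - destruct (Nat.eqb_spec x w); simpl; auto.
  - destruct (Nat.eqb_spec x w); simpl; auto.
  - specialize (IHdial1 w); specialize (IHdial2 w). rewrite !in_app_iff in *.
    simpl in IHdial2. destruct (Nat.eq_dec (occ w t) 0); [|tauto].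
    destruct (Nat.eq_dec (occ w u) 0); [lia|tauto].
  - destruct (Nat.eqb_spec w z); [tauto|]. specialize (IHdial w Hw).
    rewrite !in_app_iff in *. simpl in IHdial. intuition congruence.
  - specialize (IHdial1 w); specialize (IHdial2 w). rewrite !in_app_iff in *.
    destruct (Nat.eq_dec (occ w t) 0); [|tauto].
    destruct (Nat.eq_dec (occ w u) 0); [lia|tauto].
  - destruct (Nat.eqb_spec w z); [tauto|]. specialize (IHdial w Hw).
    rewrite !in_app_iff in *. simpl in IHdial. intuition congruence.
  - apply occ_merge_le in Hw. rewrite !in_app_iff. simpl.
    destruct Hw as [->|(Hw & ? & ?)]; [tauto|]. specialize (IHdial w Hw).
    rewrite !in_app_iff in *. simpl in IHdial. intuition congruence.
  - specialize (IHdial w Hw). rewrite !in_app_iff in *. tauto.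
  - specialize (IHdial w Hw). rewrite !in_app_iff in *. tauto.
  - specialize (IHdial w Hw). rewrite !in_app_iff in *.
    destruct IHdial as [Hi|Hi]; [left|right];
      (eapply Permutation_in; [apply Permutation_map; eassumption|assumption]).
Qed.

Lemma dial_fresh G D t A x : dial G D t A -> ~ In x (map fst G ++ map fst D) -> occ x t = 0.
Proof.
  intros H Hx. destruct (Nat.eq_dec (occ x t) 0); [assumption|].
  exfalso; eapply Hx, dial_occ; eassumption.
Qed.

(** Contraction acts on the first context only, and the premises of an application share no names,
    so a linear name is counted in at most one of them. *)
Lemma dial_occ_linear G D t A : dial G D t A -> forall x, In x (map fst D) -> occ x t <= 1.
Proof.
  induction 1; intros w Hw; rewrite ?map_app, ?map_fst_lift_ctx in *;
    rewrite ?occ_lam; cbn [occ]; auto.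
  - destruct Hw.
  - destruct (x =? w); lia.
  - rewrite (dial_fresh _ _ _ _ w H1), Nat.add_0_r; [auto|].
    unfold distinct in H. rewrite !map_app in H. rewrite app_nil_r.
    intros Hi. eapply NoDup_app_disjoint; [exact H| |exact Hw].
    apply in_or_app; auto.
  - destruct (w =? z); auto.
  - unfold distinct in H. rewrite !map_app in H.
    apply in_app_or in Hw as [Hw|Hw].
    + rewrite (dial_fresh _ _ _ _ w H1), Nat.add_0_r; [auto|].
      intros Hi. apply in_app_or in Hi as [Hi|Hi].
      * eapply NoDup_app_disjoint; [exact H|apply in_or_app|apply in_or_app]; eauto.
      * apply NoDup_app_remove_l in H. eapply NoDup_app_disjoint; eauto.
    + rewrite (dial_fresh _ _ _ _ w H0); [simpl; auto|].
      intros Hi. apply in_app_or in Hi as [Hi|Hi].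
      * eapply NoDup_app_disjoint; [exact H|apply in_or_app|apply in_or_app]; eauto.
      * apply NoDup_app_remove_l in H. eapply NoDup_app_disjoint; eauto.
  - destruct (w =? z); [lia|]. apply IHdial. apply in_or_app; auto.
  - assert (Hd := dial_distinct _ _ _ _ H0). unfold distinct in *.
    rewrite !map_app in *. simpl in *. rewrite occ_merge_other; auto;
      intros ->; eapply NoDup_app_disjoint; [exact Hd| |exact Hw
        |exact Hd| |exact Hw|exact H| |exact Hw]; apply in_or_app; simpl; auto.
  - apply IHdial, in_or_app; auto.
  - apply in_app_or in Hw as [Hw|Hw]; [auto|].
    rewrite (dial_fresh _ _ _ _ w H2); [lia|]. unfold distinct in H.
    rewrite !map_app in H. intros Hi. apply in_app_or in Hi as [Hi|Hi].
    + eapply NoDup_app_disjoint; [exact H|apply in_or_app|apply in_or_app]; eauto.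
    + apply NoDup_app_remove_l in H. eapply NoDup_app_disjoint; eauto.
  - apply IHdial. eapply Permutation_in; [|exact Hw].
    now apply Permutation_map, Permutation_sym.
Qed.

(** * Realizing bindings *)

(** Saturation exchanges adjacent bindings, so an arbitrary permutation is broken into adjacent
    swaps. The prefix [l0] collects the elements already skipped, so that [P] always speaks of the
    whole list. *)
Lemma Permutation_swap_ind {T} (P : list T -> Prop) :
  (forall l1 a b l2, P (l1 ++ a :: b :: l2) -> P (l1 ++ b :: a :: l2)) ->
  forall l l', Permutation l l' -> forall l0, P (l0 ++ l) -> P (l0 ++ l').
Proof.
  intros HP l l' H. induction H as [|x l l' _ IH|x y l|l1 l2 l3 _ IH1 _ IH2]; intros l0 H0.
  - assumption.
  - specialize (IH (l0 ++ [x])). rewrite <- !app_assoc in IH. auto.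
  - auto.
  - auto.
Qed.

Lemma realizes_heq A eta t p p' : formula A -> valuation eta ->
  realizes A eta t p -> heq [] p p' (oty A) -> realizes A eta t p'.
Proof. intros HA He. apply sat_heq, saturated_realizes; assumption. Qed.

Lemma realizes_tr0 A eta t t' p : formula A -> valuation eta -> tr 0 t t' ->
  realizes A eta t p -> realizes A eta t' p.
Proof.
  intros HA He Htr H. eapply realizes_heq; auto.
  - eapply (saturated_tr _ _ (saturated_realizes A HA eta He)); eassumption.
  - apply heq_hplus_0. now apply realizes_hty in H.
Qed.

Lemma realizes_perm A eta t th th' p : formula A -> valuation eta ->
  NoDup (map fst th) -> Permutation th th' ->
  realizes A eta (clo t th) p -> realizes A eta (clo t th') p.
Proof.
  intros HA He Hnd Hth H.
  cut (NoDup (map fst ([] ++ th')) /\ realizes A eta (clo t ([] ++ th')) p); [tauto|].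
  apply (Permutation_swap_ind (fun th => NoDup (map fst th) /\ realizes A eta (clo t th) p))
    with th; auto.
  intros l1 [y1 v1] [y2 v2] l2 [Hn Hr]. split.
  - rewrite !map_app in Hn |- *; simpl in Hn |- *. apply NoDup_swap. assumption.
  - eapply realizes_tr0; [assumption|assumption|apply (tr_exch t l1 y1 v1 y2 v2 l2 [])|]; assumption.
Qed.

Lemma TS_bound_realizes A eta t p : formula A -> valuation eta ->
  realizes A eta t p -> TS_bound (oty A) t p.
Proof. intros HA He. apply sat_bound, saturated_realizes; assumption. Qed.

(** * Comparing polynomials by numerical offsets *)

Definition plus_num (s : sty) (q : hop) (k : nat) (p : hop) : Prop :=
  heq [] p (hplus s q (HNum k)) s.

Lemma plus_num_0 s p : hty [] p s -> plus_num s p 0 p.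
Proof. intros H. apply heq_sym, heq_hplus_0, H. Qed.

Lemma plus_num_hplus s q k p m n : hty [] q s -> plus_num s q k p ->
  heq [] m (HNum n) Base -> plus_num s q (k + n) (hplus s p m).
Proof.
  intros Hq Hp Hm. eapply heq_trans; [apply heq_hplus; eassumption|].
  now apply heq_hplus_num.
Qed.

Lemma plus_num_num s q k p n : hty [] q s -> plus_num s q k p ->
  plus_num s q (k + n) (hplus s p (HNum n)).
Proof.
  intros Hq Hp. apply plus_num_hplus; auto. apply heq_refl; constructor.
Qed.

Lemma plus_num_app s1 s2 q k p r : hty [] q (Arr s1 s2) -> plus_num (Arr s1 s2) q k p ->
  hty [] r s1 -> plus_num s2 (HApp q r) k (HApp p r).
Proof.
  intros Hq Hp Hr. eapply heq_trans; [eapply heq_app; [exact Hp|apply heq_refl, Hr]|].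
  apply heq_app_hplus; auto. constructor.
Qed.

Lemma plus_num_base s q q' k p : heq [] q q' s -> plus_num s q k p -> plus_num s q' k p.
Proof.
  intros Hq Hp. eapply heq_trans; [exact Hp|]. apply heq_hplus; [exact Hq|].
  apply heq_refl; constructor.
Qed.

Lemma down_val_plus_num s q k p n : hty [] q s -> plus_num s q k p -> down_val s q n ->
  down_val s p (n + k).
Proof.
  intros Hq Hp Hn. eapply down_val_heq; [apply heq_sym, Hp|].
  apply down_val_hplus; auto. apply heq_refl; constructor.
Qed.

(** Two polynomials are compared through their distances from a common base: from [p = q + k] and
    [p' = q + k'] the numbers give [p' = p + (k' - k)], and monotonicity applies. *)
Lemma realizes_plus_num A eta t q k k' p p' : formula A -> valuation eta ->
  hty [] q (oty A) -> plus_num (oty A) q k p -> plus_num (oty A) q k' p' -> k <= k' ->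
  realizes A eta t p -> realizes A eta t p'.
Proof.
  intros HA He Hq Hp Hp' Hle H.
  eapply realizes_heq; [assumption|assumption| |].
  - eapply (saturated_tr _ _ (saturated_realizes A HA eta He)); [|exact H].
    apply (tr_mono t (k' - k)).
  - eapply heq_trans; [apply plus_num_num; eassumption|].
    replace (k + (k' - k)) with k' by lia. apply heq_sym, Hp'.
Qed.

(** * Closures built from realizers *)

Definition binds (G : ctx) (us : list (term * hop)) : list (nat * term) :=
  combine (map fst G) (map fst us).

Definition reals (eta : nat -> term -> hop -> Prop) : list (term * hop) -> ctx -> Prop :=
  Forall2 (fun r b => realizes (snd b) eta (fst r) (snd r)).

(** The bound on TS is part of the relation because we do not show that the
    numeral equal to a given polynomial is unique. *)
Definition num_vals : list (term * hop) -> list nat -> Prop :=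
  Forall2 (fun r k => heq [] (snd r) (HNum k) Base /\ exists j, TS (fst r) j /\ j <= k).

Definition down_vals : list (hop * nat) -> ctx -> Prop :=
  Forall2 (fun qn b => hty [] (fst qn) (oty (snd b)) /\
                       down_val (oty (snd b)) (fst qn) (snd qn)).

Definition tys (G : ctx) : list sty := map (fun b => oty (snd b)) G.

Definition occ_sum (t : term) (G : ctx) (ns : list nat) : nat :=
  list_sum (map (fun bk => occ (fst (fst bk)) t * snd bk) (combine G ns)).

Lemma combine_app {S T} (l1 l2 : list S) (m1 m2 : list T) : length l1 = length m1 ->
  combine (l1 ++ l2) (m1 ++ m2) = combine l1 m1 ++ combine l2 m2.
Proof.
  revert m1; induction l1 as [|a l1 IH]; intros [|b m1] H; simpl in *; try discriminate;
    [reflexivity|]. now rewrite IH by lia.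
Qed.

Lemma map_fst_combine {S T} (l : list S) (m : list T) : length l = length m ->
  map fst (combine l m) = l.
Proof.
  revert m; induction l as [|a l IH]; intros [|b m] H; simpl in *; try discriminate;
    [reflexivity|]. now rewrite IH by lia.
Qed.

Lemma reals_length eta us G : reals eta us G -> length us = length G.
Proof. apply Forall2_length. Qed.

Lemma binds_app G G' us us' : length us = length G ->
  binds (G ++ G') (us ++ us') = binds G us ++ binds G' us'.
Proof. intros H. unfold binds. rewrite !map_app. apply combine_app. now rewrite !length_map. Qed.

Lemma map_fst_binds G us : length us = length G -> map fst (binds G us) = map fst G.
Proof. intros H. apply map_fst_combine. now rewrite !length_map. Qed.

Lemma occ_sum_app t G G' ns ns' : length ns = length G ->
  occ_sum t (G ++ G') (ns ++ ns') = occ_sum t G ns + occ_sum t G' ns'.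
Proof.
  intros H. unfold occ_sum. rewrite combine_app by auto. now rewrite map_app, list_sum_app.
Qed.

Lemma occ_sum_ext t t' G : (forall x, In x (map fst G) -> occ x t = occ x t') ->
  forall ns, occ_sum t G ns = occ_sum t' G ns.
Proof.
  intros H. unfold occ_sum. induction G as [|[x C] G IH]; intros [|n ns]; simpl in *; auto.
Qed.

Lemma down_vals_hty qns G : down_vals qns G -> Forall2 (hty []) (map fst qns) (tys G).
Proof. induction 1 as [|qn b qns G [H _] _ IH]; simpl; constructor; auto. Qed.

Lemma down_vals_length qns G : down_vals qns G -> length qns = length G.
Proof. apply Forall2_length. Qed.

Lemma reals_hty eta us G : reals eta us G -> Forall2 (hty []) (map snd us) (tys G).
Proof.
  induction 1 as [|r b us G H _ IH]; simpl; constructor; auto. now apply realizes_hty in H.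
Qed.

Lemma reals_down_vals eta us G : valuation eta -> (forall b, In b G -> formula (snd b)) ->
  reals eta us G -> exists qns, map fst qns = map snd us /\ down_vals qns G /\
    Forall2 (fun r n => exists j, TS (fst r) j /\ j <= n) us (map snd qns).
Proof.
  intros He HG H. induction H as [|r b us G H _ IH].
  - exists []. repeat constructor.
  - destruct IH as (qns & E & Hd & Hb); [intros; apply HG; simpl; auto|].
    destruct (TS_bound_realizes _ _ _ _ (HG b (or_introl eq_refl)) He H) as (k & n & Hk & Hn & Hle).
    exists ((snd r, n) :: qns). split; [simpl; congruence|].
    split; constructor; simpl; eauto using realizes_hty.
Qed.

Lemma reals_num_vals eta ss D : valuation eta -> (forall b, In b D -> linear (snd b)) ->
  reals eta ss D -> exists ks, num_vals ss ks.
Proof.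
  intros He HD H. induction H as [|r b ss D H _ IH].
  - exists []. constructor.
  - destruct IH as (ks & Hks); [intros; apply HD; simpl; auto|].
    assert (Hb := HD b (or_introl eq_refl)).
    destruct (TS_bound_realizes _ _ _ _ (formula_lin _ Hb) He H) as (k & n & Hk & Hn & Hle).
    rewrite (oty_linear _ Hb) in Hn. exists (n :: ks). constructor; eauto.
Qed.

(** * Cost of closing an abstraction *)

Lemma num_vals_TS ss ks : num_vals ss ks ->
  Forall2 (fun r n => exists j, TS (fst r) j /\ j <= n) ss ks.
Proof. apply Forall2_impl. tauto. Qed.

(** [n] covers the evaluation cost and the size of an argument. Each binder adds 1 for its
    abstraction and 1 as the least price of a contraction, which gives the 2; each copy beyond the
    first adds at most [n]. The subtraction is truncated, so a name occurring at most once adds only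
    [n + 2]. *)
Lemma eval_env_bound o xs us ns : length xs = length us ->
  Forall2 (fun (r : term * hop) n => exists j, TS (fst r) j /\ j <= n) us ns ->
  forall s, exists s' c, eval_env o (combine xs (map fst us)) s s' c /\
    c + length xs + list_sum (map (fun r => size (fst r)) us) <=
    list_sum (map (fun xn => snd xn + 2 + (o (fst xn) - 1) * snd xn) (combine xs ns)).
Proof.
  intros Hl H. revert xs Hl.
  induction H as [|r n us ns (j & Hj & Hle) _ IH]; intros [|x xs] Hl s; try discriminate.
  - exists s, 0. split; [constructor|simpl; lia].
  - apply TS_eval in Hj as (w & c & Hw & ->).
    destruct (IH xs (eq_add_S _ _ Hl) (upd x w s)) as (s' & c' & Hc & Hb).
    exists s'. eexists. split; [simpl; econstructor; eassumption|].
    cbn [length map combine]. cbn [list_sum fold_right fst snd].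
    change (fold_right Nat.add 0) with list_sum.
    apply eval_size in Hw.
    assert (Hbc : beta_cost (o x) (size w) <= 1 + (o x - 1) * n).
    { unfold beta_cost. destruct (o x) as [|k]; [simpl; lia|].
      replace (S k - 1) with k by lia.
      assert (k * size w <= k * n) by (apply Nat.mul_le_mono_l; lia). lia. }
    lia.
Qed.

(** The last binding is the outermost argument, so a closed abstraction applied to [u] is literally
    the closure of its body with one more binding. Realizing an arrow thus reduces to the bound for
    the body. *)
Lemma clo_snoc t th z u : clo t (th ++ [(z, u)]) = App (clo (lam z t) th) u.
Proof.
  unfold clo. rewrite !map_app, apps_app. unfold lams. now rewrite fold_right_app.
Qed.

(** Once the bindings are substituted the abstraction is a value, so only the bindings cost. The
    summand 1 is the abstraction itself, each binding gives 2, and linear names bring no product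
    with [occ] because they occur at most once. *)
Lemma TS_clo_lam G D z t us ss ns ks :
  distinct G D -> (forall x, In x (map fst D) -> occ x (lam z t) <= 1) ->
  length us = length G -> length ss = length D ->
  Forall2 (fun r n => exists j, TS (fst r) j /\ j <= n) us ns ->
  Forall2 (fun r n => exists j, TS (fst r) j /\ j <= n) ss ks ->
  exists k, TS (clo (lam z t) (binds G us ++ binds D ss)) k /\
    k <= size t + 1 + occ_sum (lam z t) G ns + list_sum ns + 2 * length G
         + list_sum ks + 2 * length D.
Proof.
  intros Hd HD Hus Hss HG Hk. set (l := lam z t) in *.
  assert (Hlu := Forall2_length HG). assert (Hlk := Forall2_length Hk).
  destruct (eval_env_bound (fun x => occ x l) (map fst G ++ map fst D) (us ++ ss) (ns ++ ks))
    with (s := Var) as (s & c & Hc & Hle).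
  { rewrite !length_app, !length_map. lia. }
  { now apply Forall2_app. }
  rewrite map_app, combine_app in Hc by (rewrite !length_map; lia).
  fold (binds G us) (binds D ss) in Hc.
  rewrite combine_app, !map_app, !list_sum_app in Hle by (rewrite !length_map; lia).
  exists (c + 0 + size (clo l (binds G us ++ binds D ss))). split.
  - apply TS_eval. exists (subst s l), (c + 0). split; [|reflexivity].
    apply eval_clo.
    + rewrite map_app, !map_fst_binds by assumption.
      unfold distinct in Hd. now rewrite map_app in Hd.
    + exists s, c, 0. split; [assumption|]. split; [|reflexivity]. constructor. exact I.
  - rewrite size_clo. unfold l at 1. rewrite size_lam.
    clearbody l. rewrite length_app, map_app, list_sum_app.
    assert (E : forall (G : ctx) (us : list (term * hop)), length us = length G ->
      length (binds G us) = length G /\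
      list_sum (map (fun b => size (snd b)) (binds G us)) = list_sum (map (fun r => size (fst r)) us)).
    { clear. intros G; unfold binds; induction G as [|b G IH]; intros [|r us] H; simpl in *;
        try discriminate; auto. destruct (IH us); auto; lia. }
    destruct (E G us Hus) as [-> ->], (E D ss Hss) as [-> ->].
    assert (E1 : list_sum (map (fun xn => snd xn + 2 + (occ (fst xn) l - 1) * snd xn)
      (combine (map fst G) ns)) <= occ_sum l G ns + list_sum ns + 2 * length G).
    { clear - Hus Hlu. assert (Hl : length ns = length G) by lia. clear Hus Hlu.
      revert ns Hl. unfold occ_sum. induction G as [|b G IH]; intros [|n ns] Hl; simpl in *;
        try discriminate; auto.
      specialize (IH ns (eq_add_S _ _ Hl)).
      assert ((occ (fst b) l - 1) * n <= occ (fst b) l * n) by (apply Nat.mul_le_mono_r; lia).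
      lia. }
    assert (E2 : list_sum (map (fun xn => snd xn + 2 + (occ (fst xn) l - 1) * snd xn)
      (combine (map fst D) ks)) <= list_sum ks + 2 * length D).
    { clear - Hss Hlk HD. assert (Hl : length ks = length D) by lia. clear Hss Hlk.
      revert ks Hl. induction D as [|b D IH]; intros [|n ks] Hl; simpl in *;
        try discriminate; auto.
      specialize (IH (fun x Hx => HD x (or_intror Hx)) ks (eq_add_S _ _ Hl)).
      replace (occ (fst b) l - 1) with 0 by (specialize (HD (fst b) (or_introl eq_refl)); lia).
      lia. }
    rewrite !length_app, !length_map in Hle. lia.
Qed.

(** * The polynomial of a derivation *)

(** The induction invariant. Linear arguments are represented by numerals [ks], of which only the
    sum enters. In the size clause the arguments of [p] come with chosen numerals for their [down],
    so that the clause is an inequality between natural numbers for any such choice. *)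
Record bounds (p : hop) (G D : ctx) (t : term) (A : form) : Prop := {
  bounds_hty : hty (tys G) p (oty A);
  bounds_realizes : forall eta, valuation eta -> forall us ss ks,
    reals eta us G -> reals eta ss D -> num_vals ss ks ->
    realizes A eta (clo t (binds G us ++ binds D ss))
      (hplus (oty A) (hinst p (map snd us)) (HNum (list_sum ks)));
  bounds_size : forall qns, down_vals qns G -> exists n,
    down_val (oty A) (hinst p (map fst qns)) n /\
    size t + occ_sum t G (map snd qns) <= n
}.

Definition bounded (G D : ctx) (t : term) (A : form) : Prop :=
  exists p, bounds p G D t A.

Lemma tys_app G G' : tys (G ++ G') = tys G ++ tys G'.
Proof. apply map_app. Qed.

Lemma length_tys G : length (tys G) = length G.
Proof. apply length_map. Qed.

Lemma hinst_hplus s p q qs : hinst (hplus s p q) qs = hplus s (hinst p qs) (hinst q qs).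
Proof. apply hsubst_hplus. Qed.

Lemma hinst_down s p qs : hinst (down s p) qs = down s (hinst p qs).
Proof. apply hsubst_down. Qed.

Lemma hinst_last qs q : hinst (HVar (length qs)) (qs ++ [q]) = q.
Proof. unfold hinst; simpl. now rewrite app_nth2, Nat.sub_diag by lia. Qed.

Lemma Forall2_snoc_inv_r {S T} (P : S -> T -> Prop) l l' b : Forall2 P l (l' ++ [b]) ->
  exists l0 a, l = l0 ++ [a] /\ Forall2 P l0 l' /\ P a b.
Proof.
  intros H. apply Forall2_app_inv_r in H as (l0 & l1 & H0 & H1 & ->).
  inversion H1 as [|a ? ? ? Ha Hn]; subst. inversion Hn; subst. eauto.
Qed.

(** * Axioms and rules that leave the term unchanged *)

Lemma bounded_ax1 x A : formula A -> bounded [(x, A)] [] (Var x) A.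
Proof.
  (* The 3 is the price of the identity closure; it also covers the size 1 of the variable. *)
  intros HA. exists (hplus (oty A) (HVar 0) (HNum 3)). split.
  - apply hty_hplus; now constructor.
  - intros eta He us ss ks Hus Hss Hks.
    inversion Hus as [|[u q] ? us' ? Hu Hn]; subst. inversion Hn; subst.
    inversion Hss; subst. inversion Hks; subst. simpl in Hu |- *.
    rewrite hinst_hplus. assert (HS := saturated_realizes A HA eta He).
    (* There are no linear arguments; the empty sum is accounted for by [tr_mono] with offset 0. *)
    apply (saturated_tr _ _ HS 0 (clo (Var x) [(x, u)])); [constructor|].
    apply (saturated_tr _ _ HS _ _ _ _ (tr_id u x [])). exact Hu.
  - intros qns Hq. inversion Hq as [|[q n] ? qns' ? [Hu Hn] Hnil]; subst.
    inversion Hnil; subst. simpl in *. exists (n + 3). split.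
    + rewrite hinst_hplus. apply down_val_hplus; auto. apply heq_refl; constructor.
    + unfold occ_sum; simpl. rewrite Nat.eqb_refl. lia.
Qed.

(** The value of a linear argument reaches the bound through the sum of numerals, so the polynomial
    itself is the constant 3 of the identity closure. *)
Lemma bounded_ax2 x L : linear L -> bounded [] [(x, L)] (Var x) L.
Proof.
  intros HL. assert (HA := formula_lin _ HL). exists (HNum 3). split.
  - rewrite oty_linear by assumption. constructor.
  - intros eta He us ss ks Hus Hss Hks. inversion Hus; subst.
    inversion Hss as [|[u q] ? us' ? Hu Hn]; subst. inversion Hn; subst.
    inversion Hks as [|? k ? ks' [Hk _] Hn']; subst. inversion Hn'; subst.
    simpl in Hu, Hk |- *.
    assert (HS := saturated_realizes L HA eta He).
    eapply realizes_heq; auto.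
    + apply (saturated_tr _ _ HS _ _ _ q (tr_id u x [])). exact Hu.
    + rewrite (oty_linear _ HL). simpl.
      eapply heq_trans; [apply heq_hadd_num; [exact Hk|apply heq_refl; constructor]|].
      apply heq_sym. replace (k + 3) with (3 + (k + 0)) by lia. apply heq_num.
  - intros qns Hq. inversion Hq; subst. exists 3. rewrite (oty_linear _ HL).
    split; [apply heq_refl; constructor|]. simpl; unfold occ_sum; simpl; lia.
Qed.

(** Serves the elimination of [FAll] and both rules for [FMu]: the polynomial is kept together with
    the term, because [oty] takes the same value on both formulas. *)
Lemma bounded_sub G D t A B : oty B = oty A ->
  (forall eta, valuation eta -> forall t p, realizes A eta t p -> realizes B eta t p) ->
  bounded G D t A -> bounded G D t B.
Proof.
  intros E HAB [p [H1 H2 H3]]. exists p. split; rewrite E; auto.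
Qed.

Lemma tys_lift_ctx G : tys (lift_ctx G) = tys G.
Proof.
  unfold tys, lift_ctx. rewrite map_map. apply map_ext. intros b; apply oty_fren.
Qed.

Lemma binds_lift_ctx G us : binds (lift_ctx G) us = binds G us.
Proof. unfold binds. now rewrite map_fst_lift_ctx. Qed.

Lemma reals_lift_ctx X eta us G : reals eta us G -> reals (scons X eta) us (lift_ctx G).
Proof.
  induction 1; simpl; constructor; auto.
  apply (realizes_fren _ S (scons X eta)). assumption.
Qed.

Lemma bounded_all_i G D t A :
  bounded (lift_ctx G) (lift_ctx D) t A -> bounded G D t (FAll A).
Proof.
  intros [p [H1 H2 H3]]. rewrite tys_lift_ctx in H1. exists p. split.
  - exact H1.
  - intros eta He us ss ks Hus Hss Hks. split.
    + simpl. apply hty_hplus; [|constructor].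
      eapply hty_hinst; [exact H1|]. eapply reals_hty; eassumption.
    + intros X HX.
      specialize (H2 (scons X eta) (valuation_scons _ _ HX He) us ss ks
        (reals_lift_ctx X _ _ _ Hus) (reals_lift_ctx X _ _ _ Hss) Hks).
      rewrite !binds_lift_ctx in H2. exact H2.
  - intros qns Hq. destruct (H3 qns) as (n & Hn & Hle).
    + clear - Hq. induction Hq as [|qn b qns G Hb _ IH]; simpl; constructor; auto.
      simpl. now rewrite oty_fren.
    + exists n; split; [exact Hn|]. replace (occ_sum t G (map snd qns))
        with (occ_sum t (lift_ctx G) (map snd qns)); [exact Hle|].
      clear. unfold occ_sum. generalize (map snd qns).
      induction G as [|b G IH]; intros [|n ns]; simpl; auto.
Qed.

(** * Application *)

Lemma realizes_concat G1 G2 D1 D2 t u B eta us1 us2 ss1 ss2 p :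
  formula B -> valuation eta -> distinct (G1 ++ G2) (D1 ++ D2) ->
  (forall x, In x (map fst G1 ++ map fst D1) -> fresh x u) ->
  (forall x, In x (map fst G2 ++ map fst D2) -> fresh x t) ->
  length us1 = length G1 -> length us2 = length G2 ->
  length ss1 = length D1 -> length ss2 = length D2 ->
  realizes B eta (App (clo t (binds G1 us1 ++ binds D1 ss1))
                      (clo u (binds G2 us2 ++ binds D2 ss2))) p ->
  realizes B eta (clo (App t u) (binds (G1 ++ G2) (us1 ++ us2) ++
                                 binds (D1 ++ D2) (ss1 ++ ss2))) p.
Proof.
  intros HB He Hd Hu Ht L1 L2 L3 L4 H. rewrite !binds_app by assumption.
  unfold distinct in Hd. rewrite !map_app in Hd.
  (* Concatenation delivers the groups in the order [G1], [D1], [G2], [D2]; exchange moves both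
     linear groups to the end. *)
  assert (Hp : Permutation ((binds G1 us1 ++ binds D1 ss1) ++ (binds G2 us2 ++ binds D2 ss2))
                           ((binds G1 us1 ++ binds G2 us2) ++ (binds D1 ss1 ++ binds D2 ss2))).
  { rewrite <- !app_assoc. apply Permutation_app_head. rewrite !app_assoc.
    apply Permutation_app_tail, Permutation_app_comm. }
  assert (Hnd : NoDup (map fst ((binds G1 us1 ++ binds D1 ss1) ++ (binds G2 us2 ++ binds D2 ss2)))).
  { eapply Permutation_NoDup; [apply Permutation_map, Permutation_sym, Hp|].
    rewrite !map_app, !map_fst_binds by assumption. exact Hd. }
  eapply realizes_perm; [assumption|assumption|exact Hnd|exact Hp|].
  eapply realizes_tr0; [assumption|assumption| |exact H].
  apply (tr_concat t _ u _ []).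
  - exact Hnd.
  - rewrite map_app, !map_fst_binds by assumption. exact Hu.
  - rewrite map_app, !map_fst_binds by assumption. exact Ht.
Qed.

Lemma occ_sum_App t u (G1 G2 D1 D2 : ctx) ns1 ns2 :
  (forall x, In x (map fst G1 ++ map fst D1) -> fresh x u) ->
  (forall x, In x (map fst G2 ++ map fst D2) -> fresh x t) ->
  length ns1 = length G1 ->
  occ_sum (App t u) (G1 ++ G2) (ns1 ++ ns2) = occ_sum t G1 ns1 + occ_sum u G2 ns2.
Proof.
  intros Hu Ht Hl. rewrite occ_sum_app by assumption. f_equal; apply occ_sum_ext;
    intros x Hx; simpl.
  - rewrite (Hu x); [lia|apply in_or_app; auto].
  - rewrite (Ht x); [lia|apply in_or_app; auto].
Qed.

Definition hshift (G : ctx) (p : hop) : hop := hren (fun i => length G + i) p.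

Lemma hty_hshift G1 G2 p s : hty (tys G2) p s -> hty (tys (G1 ++ G2)) (hshift G1 p) s.
Proof.
  intros H. eapply hty_hren; [exact H|]. intros i a Hi.
  rewrite tys_app, nth_error_app2; rewrite length_tys; [|lia].
  now replace (length G1 + i - length G1) with i by lia.
Qed.

Lemma hinst_hshift G1 G2 p s qs1 qs2 : hty (tys G2) p s ->
  length qs1 = length G1 -> length qs2 = length G2 ->
  hinst (hshift G1 p) (qs1 ++ qs2) = hinst p qs2.
Proof.
  intros H L1 L2. eapply hinst_hren; [exact H|rewrite length_tys; lia|].
  intros i Hi. rewrite nth_error_app2 by lia.
  now replace (length G1 + i - length qs1) with i by lia.
Qed.

(** The argument [u] has no linear bindings, so its bound is [p2] plus an empty sum and can be fed
    to [p1] as it stands. *)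
Lemma bounded_imp_e G1 G2 D t u A B :
  formula (FImp A B) -> distinct (G1 ++ G2) D ->
  (forall x, In x (map fst G1 ++ map fst D) -> fresh x u) ->
  (forall x, In x (map fst G2) -> fresh x t) ->
  bounded G1 D t (FImp A B) -> bounded G2 [] u A ->
  bounded (G1 ++ G2) D (App t u) B.
Proof.
  intros HAB Hd Hu Ht [p1 [T1 R1 S1]] [p2 [T2 R2 S2]].
  apply formula_imp_inv in HAB as [HA HB].
  exists (hplus (oty B) (HApp p1 (hshift G1 p2)) (down (oty A) (hshift G1 p2))).
  assert (Ht' : forall x, In x (map fst G2 ++ map fst (@nil (nat * form))) -> fresh x t).
  { intros x Hx. apply Ht. now rewrite app_nil_r in Hx. }
  assert (Ts := hty_hshift G1 G2 _ _ T2).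
  assert (HI : forall qs1 qs2, Forall2 (hty []) qs1 (tys G1) -> Forall2 (hty []) qs2 (tys G2) ->
    hty [] (hinst p1 qs1) (oty (FImp A B)) /\ hty [] (hinst p2 qs2) (oty A) /\
    hinst (hplus (oty B) (HApp p1 (hshift G1 p2)) (down (oty A) (hshift G1 p2))) (qs1 ++ qs2)
    = hplus (oty B) (HApp (hinst p1 qs1) (hinst p2 qs2)) (down (oty A) (hinst p2 qs2))).
  { intros qs1 qs2 Q1 Q2. split; [eapply hty_hinst; eassumption|].
    split; [eapply hty_hinst; eassumption|].
    assert (L1 := Forall2_length Q1). assert (L2 := Forall2_length Q2).
    rewrite hinst_hplus, hinst_down.
    change (hinst (HApp p1 (hshift G1 p2)) (qs1 ++ qs2))
      with (HApp (hinst p1 (qs1 ++ qs2)) (hinst (hshift G1 p2) (qs1 ++ qs2))).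
    rewrite (hinst_app_l _ _ _ _ _ T1) by auto.
    rewrite length_tys in L1, L2. now rewrite (hinst_hshift G1 G2 _ _ _ _ T2). }
  split.
  - apply hty_hplus; [|now apply hty_down].
    econstructor; [|exact Ts]. rewrite tys_app. apply hty_app_l, T1.
  - intros eta He us ss ks Hus Hss Hks.
    apply Forall2_app_inv_r in Hus as (us1 & us2 & H1 & H2 & ->).
    fold (reals eta us1 G1) in H1. fold (reals eta us2 G2) in H2.
    destruct (HI (map snd us1) (map snd us2)) as (P1 & P2 & E);
      [eapply reals_hty; eassumption|eapply reals_hty; eassumption|].
    specialize (R1 eta He us1 ss ks H1 Hss Hks).
    specialize (R2 eta He us2 [] [] H2 (Forall2_nil _) (Forall2_nil _)).
    simpl list_sum in R2.
    eapply realizes_heq in R2; [|assumption|assumption|apply heq_hplus_0, P2].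
    destruct R1 as (_ & _ & R1). specialize (R1 _ _ R2).
    destruct (down_val_exists _ _ P2) as (n & Hn).
    rewrite map_app, E.
    assert (P12 : hty [] (HApp (hinst p1 (map snd us1)) (hinst p2 (map snd us2))) (oty B))
      by (econstructor; eassumption).
    assert (C := realizes_concat G1 G2 D [] t u B eta us1 us2 ss []).
    rewrite !app_nil_r in C. change (binds [] []) with (@nil (nat * term)) in R1.
    rewrite app_nil_r in R1.
    apply C in R1; auto; try (eapply reals_length; eassumption).
    (* Realizability gives the bound [p1 p2] plus the linear sum; the additional [down p2] is filled
       in by monotonicity. *)
    refine (realizes_plus_num _ _ _ _ _ _ _ _ HB He P12 _ _ _ R1).
    + eapply plus_num_app; [exact P1| |exact P2].
      apply plus_num_num; [exact P1|]. apply plus_num_0, P1.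
    + apply plus_num_num; [exact P12|]. apply plus_num_hplus; [exact P12| |exact Hn].
      apply plus_num_0, P12.
    + lia.
  - intros qns Hq. apply Forall2_app_inv_r in Hq as (q1 & q2 & H1 & H2 & ->).
    fold (down_vals q1 G1) in H1. fold (down_vals q2 G2) in H2.
    destruct (HI (map fst q1) (map fst q2)) as (P1 & P2 & E);
      [now apply down_vals_hty|now apply down_vals_hty|].
    destruct (S1 q1 H1) as (n1 & N1 & Le1). destruct (S2 q2 H2) as (n2 & N2 & Le2).
    destruct (down_val_app _ _ _ _ _ P1 P2 N1) as (n & N & Le).
    exists (n + n2). rewrite map_app, E. split.
    + apply down_val_hplus; [econstructor; eassumption|exact N|exact N2].
    + rewrite map_app, (occ_sum_App t u G1 G2 D []); auto.
      * simpl. lia.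
      * rewrite length_map. now apply down_vals_length.
Qed.

(** The bound of the argument is a number and is added, as in the realizability clause for [FLolli];
    the same summand pays for the size of [u]. *)
Lemma bounded_lolli_e G1 G2 D1 D2 t u L B :
  formula (FLolli L B) -> distinct (G1 ++ G2) (D1 ++ D2) ->
  (forall x, In x (map fst G1 ++ map fst D1) -> fresh x u) ->
  (forall x, In x (map fst G2 ++ map fst D2) -> fresh x t) ->
  bounded G1 D1 t (FLolli L B) -> bounded G2 D2 u L ->
  bounded (G1 ++ G2) (D1 ++ D2) (App t u) B.
Proof.
  intros HLB Hd Hu Ht [p1 [T1 R1 S1]] [p2 [T2 R2 S2]].
  apply formula_lolli_inv in HLB as [HL HB]. simpl oty in T1, S1.
  rewrite (oty_linear _ HL) in T2, S2.
  exists (hplus (oty B) p1 (hshift G1 p2)).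
  assert (Ts := hty_hshift G1 G2 _ _ T2).
  assert (HI : forall qs1 qs2, Forall2 (hty []) qs1 (tys G1) -> Forall2 (hty []) qs2 (tys G2) ->
    hty [] (hinst p1 qs1) (oty B) /\ hty [] (hinst p2 qs2) Base /\
    hinst (hplus (oty B) p1 (hshift G1 p2)) (qs1 ++ qs2)
    = hplus (oty B) (hinst p1 qs1) (hinst p2 qs2)).
  { intros qs1 qs2 Q1 Q2. split; [eapply hty_hinst; eassumption|].
    split; [eapply hty_hinst; eassumption|].
    assert (L1 := Forall2_length Q1). assert (L2 := Forall2_length Q2).
    rewrite hinst_hplus, (hinst_app_l _ _ _ _ _ T1) by auto.
    rewrite length_tys in L1, L2. now rewrite (hinst_hshift G1 G2 _ _ _ _ T2). }
  split.
  - apply hty_hplus; [|exact Ts]. rewrite tys_app. apply hty_app_l, T1.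
  - intros eta He us ss ks Hus Hss Hks.
    apply Forall2_app_inv_r in Hus as (us1 & us2 & H1 & H2 & ->).
    apply Forall2_app_inv_r in Hss as (ss1 & ss2 & I1 & I2 & ->).
    apply Forall2_app_inv_l in Hks as (ks1 & ks2 & K1 & K2 & ->).
    fold (reals eta us1 G1) in H1. fold (reals eta us2 G2) in H2.
    fold (reals eta ss1 D1) in I1. fold (reals eta ss2 D2) in I2.
    destruct (HI (map snd us1) (map snd us2)) as (P1 & P2 & E);
      [eapply reals_hty; eassumption|eapply reals_hty; eassumption|].
    specialize (R1 eta He us1 ss1 ks1 H1 I1 K1).
    specialize (R2 eta He us2 ss2 ks2 H2 I2 K2).
    destruct R1 as (_ & _ & R1). specialize (R1 _ _ R2).
    rewrite (oty_linear _ HL) in R1. simpl oty in R1.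
    destruct (num_exists _ P2) as (n & Hn).
    rewrite map_app, E, list_sum_app.
    apply (realizes_concat G1 G2 D1 D2) in R1; auto; try (eapply reals_length; eassumption).
    refine (realizes_plus_num _ _ _ _ _ _ _ _ HB He P1 _ _ _ R1).
    + apply plus_num_hplus; [exact P1|apply plus_num_num, plus_num_0; exact P1|].
      apply heq_hadd_num; [exact Hn|apply heq_refl; constructor].
    + apply plus_num_num; [exact P1|]. apply plus_num_hplus; [exact P1| |exact Hn].
      apply plus_num_0, P1.
    + lia.
  - intros qns Hq. apply Forall2_app_inv_r in Hq as (q1 & q2 & H1 & H2 & ->).
    fold (down_vals q1 G1) in H1. fold (down_vals q2 G2) in H2.
    destruct (HI (map fst q1) (map fst q2)) as (P1 & P2 & E);
      [now apply down_vals_hty|now apply down_vals_hty|].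
    destruct (S1 q1 H1) as (n1 & N1 & Le1). destruct (S2 q2 H2) as (n2 & N2 & Le2).
    exists (n1 + n2). rewrite map_app, E. split.
    + apply down_val_hplus; [exact P1|exact N1|exact N2].
    + rewrite map_app, (occ_sum_App t u G1 G2 D1 D2); auto.
      * simpl. lia.
      * rewrite length_map. now apply down_vals_length.
Qed.

(** * Abstraction *)

(** What an abstraction costs on top of its body: its closure is a value only
    after all bindings have been evaluated and substituted. *)
Definition lam_cost (G D : ctx) : hop :=
  hadd (down_sum 0 (tys G)) (HNum (1 + 2 * length G + 2 * length D)).

Lemma hty_lam_cost G D : hty (tys G) (lam_cost G D) Base.
Proof. apply hty_hadd; [apply (hty_down_sum (tys G) [])|constructor]. Qed.

Lemma hinst_lam_cost G D qns : down_vals qns G ->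
  heq [] (hinst (lam_cost G D) (map fst qns))
    (HNum (list_sum (map snd qns) + (1 + 2 * length G + 2 * length D))) Base.
Proof.
  intros H. apply heq_hadd_num; [|apply heq_refl; constructor].
  apply hsubst_down_sum with (map fst qns).
  - clear D. unfold tys. induction H as [|qn b qns G [_ Hb] _ IH]; simpl; constructor; auto.
  - rewrite length_map, length_tys. now apply down_vals_length.
  - intros j q Hj. now apply nth_error_nth.
Qed.

(** Contexts list the newest variable last, whereas [HLam] binds index 0. *)
Definition hlam_last (n : nat) (a : sty) (p : hop) : hop :=
  HLam a (hren (fun i => if i =? n then 0 else S i) p).

Lemma hty_hlam_last G a p s : hty (G ++ [a]) p s ->
  hty G (hlam_last (length G) a p) (Arr a s).
Proof.
  intros H. constructor. eapply hty_hren; [exact H|]. intros i b Hi.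
  assert (Hl : i < length (G ++ [a])) by (apply nth_error_Some; congruence).
  rewrite length_app in Hl; simpl in Hl.
  destruct (Nat.eqb_spec i (length G)) as [->|E]; simpl.
  - now rewrite nth_error_app2, Nat.sub_diag in Hi by lia.
  - now rewrite nth_error_app1 in Hi by lia.
Qed.

(** With the indices rotated, one beta step supplies the last argument. *)
Lemma heq_hlam_last G a p s qs q : hty (G ++ [a]) p s ->
  Forall2 (hty []) qs G -> hty [] q a ->
  heq [] (HApp (hinst (hlam_last (length G) a p) qs) q) (hinst p (qs ++ [q])) s.
Proof.
  intros Hp Hqs Hq. assert (Hl := Forall2_length Hqs).
  assert (T := hty_hinst _ _ _ _ (hty_hlam_last _ _ _ _ Hp) Hqs).
  unfold hinst, hlam_last in *. cbn [hsubst] in *. inversion T; subst.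
  replace (hsubst (fun i => nth i (qs ++ [q]) (HVar i)) p)
    with (hsubst (scons q HVar) (hsubst (hup (fun i => nth i qs (HVar i)))
      (hren (fun i => if i =? length G then 0 else S i) p))).
  - now apply heq_beta.
  - rewrite hsubst_hren, hsubst_hsubst. eapply hsubst_ext_hty; [exact Hp|].
    intros i Hi. rewrite length_app in Hi; simpl in Hi.
    destruct (Nat.eqb_spec i (length G)) as [->|E]; simpl.
    + now rewrite <- Hl, app_nth2, Nat.sub_diag by lia.
    + rewrite app_nth1 by lia. rewrite hsubst_hren. simpl.
      change (fun x : nat => HVar x) with HVar. apply hsubst_HVar.
Qed.

Lemma occ_sum_lam z t G ns : ~ In z (map fst G) ->
  occ_sum (lam z t) G ns = occ_sum t G ns.
Proof.
  intros H. apply occ_sum_ext. intros x Hx. rewrite occ_lam.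
  destruct (Nat.eqb_spec x z); [subst; tauto|reflexivity].
Qed.

Lemma bounded_imp_i G D z t A B :
  (forall b, In b G -> formula (snd b)) -> formula (FImp A B) ->
  distinct (G ++ [(z, A)]) D -> (forall x, In x (map fst D) -> occ x t <= 1) ->
  bounded (G ++ [(z, A)]) D t B -> bounded G D (lam z t) (FImp A B).
Proof.
  intros HG HAB Hd HD [p [T R S]].
  destruct (formula_imp_inv _ _ HAB) as [HA HB].
  unfold distinct in Hd. rewrite !map_app in Hd. simpl in Hd.
  assert (Hd' : NoDup (map fst G ++ map fst D))
    by (rewrite <- app_assoc in Hd; eapply NoDup_remove_1; exact Hd).
  assert (Hz : ~ In z (map fst G ++ map fst D))
    by (rewrite <- app_assoc in Hd; eapply NoDup_remove_2; exact Hd).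
  rewrite tys_app in T. simpl in T.
  set (h := hlam_last (length G) (oty A) p).
  assert (Th : hty (tys G) h (oty (FImp A B))).
  { unfold h. rewrite <- length_tys. now apply hty_hlam_last. }
  assert (Hh : forall qs q, Forall2 (hty []) qs (tys G) -> hty [] q (oty A) ->
    heq [] (HApp (hinst h qs) q) (hinst p (qs ++ [q])) (oty B)).
  { unfold h. rewrite <- length_tys. intros qs q. now apply heq_hlam_last. }
  assert (Hdown : forall qns, down_vals qns G -> exists n,
    down_val (oty (FImp A B)) (hinst h (map fst qns)) n /\
    size t + occ_sum (lam z t) G (map snd qns) <= n).
  (* Zero for the new variable matches [down], which feeds zero to an abstraction, and makes the
     occurrences of [z] count for nothing. *)
  { intros qns Hq. destruct (S (qns ++ [(hzero (oty A), 0)])) as (n & Hn & Hle).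
    - apply Forall2_app; [exact Hq|]. constructor; [split; simpl|constructor].
      + apply hty_hzero.
      + apply down_val_hzero.
    - exists n. rewrite !map_app in Hn, Hle. simpl in Hn, Hle.
      rewrite occ_sum_app in Hle by (rewrite length_map; now apply down_vals_length).
      split.
      + eapply heq_trans; [|exact Hn]. apply (heq_down (oty B)), Hh; [|apply hty_hzero].
        now apply down_vals_hty.
      + rewrite occ_sum_lam by (intros Hi; apply Hz, in_or_app; auto). lia. }
  exists (hplus (oty (FImp A B)) h (lam_cost G D)). split.
  - apply hty_hplus; [exact Th|apply hty_lam_cost].
  - intros eta He us ss ks Hus Hss Hks.
    destruct (reals_down_vals _ _ _ He HG Hus) as (qns & Eq & Hq & HT).
    assert (Tq := reals_hty _ _ _ Hus).
    assert (Th' := hty_hinst _ _ _ _ Th Tq).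
    assert (Hc := hinst_lam_cost G D qns Hq). rewrite Eq in Hc.
    set (c := list_sum (map snd qns) + (1 + 2 * length G + 2 * length D)) in *.
    rewrite hinst_hplus.
    assert (HP := plus_num_num _ _ _ _ (list_sum ks) Th'
      (plus_num_hplus _ _ _ _ _ _ Th' (plus_num_0 _ _ Th') Hc)).
    split; [eapply heq_hty_l, HP|]. split.
    + destruct (TS_clo_lam G D z t us ss (map snd qns) ks) as (k & Hk & Hle); auto.
      * unfold distinct. now rewrite map_app.
      * intros x Hx. rewrite occ_lam. destruct (x =? z); auto.
      * eapply reals_length; eassumption.
      * eapply reals_length; eassumption.
      * now apply num_vals_TS.
      * destruct (Hdown qns Hq) as (n & Hn & Hle').
        rewrite Eq in Hn.
        (* [n] covers the size of [t] and the copies of nonlinear arguments, [c] one further value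
           of each such argument and all binders, and [list_sum ks] the linear arguments. *)
        exists k, (n + (0 + c + list_sum ks)). split; [exact Hk|].
        split; [|unfold c; lia].
        eapply down_val_plus_num; [exact Th'|exact HP|exact Hn].
    + intros u q Hu. assert (Tu := realizes_hty _ _ _ _ Hu).
      rewrite <- clo_snoc.
      assert (Tp : hty [] (hinst p (map snd us ++ [q])) (oty B)).
      { eapply heq_hty_r, Hh; assumption. }
      assert (R' : realizes B eta (clo t ((binds G us ++ binds D ss) ++ [(z, u)]))
        (hplus (oty B) (hinst p (map snd (us ++ [(u, q)]))) (HNum (list_sum ks)))).
      { eapply realizes_perm; [exact HB|exact He| |
          |apply (R eta He (us ++ [(u, q)]) ss ks); [|exact Hss|exact Hks]].
        - rewrite map_app, !map_fst_binds.
          + rewrite map_app; simpl. exact Hd.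
          + eapply reals_length; eassumption.
          + rewrite !length_app. simpl. f_equal. eapply reals_length; eassumption.
        - rewrite binds_app by (eapply reals_length; eassumption).
          rewrite <- !app_assoc. apply Permutation_app_head, Permutation_app_comm.
        - apply Forall2_app; [exact Hus|]. constructor; [exact Hu|constructor]. }
      rewrite map_app in R'.
      (* Under application the body is bounded by [p] plus the linear sum; the summand [lam_cost],
         which pays for the closed abstraction on its own, is added by monotonicity. *)
      refine (realizes_plus_num _ _ _ _ _ _ _ _ HB He Tp _ _ _ R').
      * apply plus_num_num; [exact Tp|apply plus_num_0, Tp].
      * eapply plus_num_base; [apply Hh; [exact Tq|exact Tu]|].
        eapply plus_num_app; [exact Th'|exact HP|exact Tu].
      * lia.
  - intros qns Hq. destruct (Hdown qns Hq) as (n & Hn & Hle).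
    eexists. rewrite hinst_hplus. split.
    + apply down_val_hplus; [|exact Hn|now apply hinst_lam_cost].
      eapply hty_hinst; [exact Th|now apply down_vals_hty].
    + rewrite size_lam. lia.
Qed.

(** The type translation ignores linear hypotheses, so no [HLam] is formed: the value of the new
    argument joins the sum of the linear ones, and the size bound of the body carries over. *)
Lemma bounded_lolli_i G D z t L B :
  (forall b, In b G -> formula (snd b)) -> formula (FLolli L B) ->
  distinct G (D ++ [(z, L)]) -> (forall x, In x (map fst D) -> occ x t <= 1) ->
  bounded G (D ++ [(z, L)]) t B -> bounded G D (lam z t) (FLolli L B).
Proof.
  intros HG HLB Hd HD [p [T R S]].
  destruct (formula_lolli_inv _ _ HLB) as [HL HB].
  unfold distinct in Hd. rewrite !map_app in Hd. simpl in Hd. rewrite app_assoc in Hd.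
  assert (Hd' : NoDup (map fst G ++ map fst D)) by now apply NoDup_app_remove_r in Hd.
  assert (Hz : ~ In z (map fst G ++ map fst D)).
  { intros Hi. eapply NoDup_snoc_neq; [exact Hd|exact Hi|reflexivity]. }
  assert (Ez : forall ns, occ_sum (lam z t) G ns = occ_sum t G ns).
  { intros ns. apply occ_sum_lam. intros Hi; apply Hz, in_or_app; auto. }
  exists (hplus (oty B) p (lam_cost G D)). split.
  - apply hty_hplus; [exact T|apply hty_lam_cost].
  - intros eta He us ss ks Hus Hss Hks.
    destruct (reals_down_vals _ _ _ He HG Hus) as (qns & Eq & Hq & HT).
    assert (Tq := reals_hty _ _ _ Hus).
    assert (Tp := hty_hinst _ _ _ _ T Tq).
    assert (Hc := hinst_lam_cost G D qns Hq). rewrite Eq in Hc.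
    set (c := list_sum (map snd qns) + (1 + 2 * length G + 2 * length D)) in *.
    rewrite hinst_hplus. simpl oty.
    assert (HP := plus_num_num _ _ _ _ (list_sum ks) Tp
      (plus_num_hplus _ _ _ _ _ _ Tp (plus_num_0 _ _ Tp) Hc)).
    split; [eapply heq_hty_l, HP|]. split.
    + destruct (TS_clo_lam G D z t us ss (map snd qns) ks) as (k & Hk & Hle); auto.
      * unfold distinct. now rewrite map_app.
      * intros x Hx. rewrite occ_lam. destruct (x =? z); auto.
      * eapply reals_length; eassumption.
      * eapply reals_length; eassumption.
      * now apply num_vals_TS.
      * destruct (S qns Hq) as (n & Hn & Hle').
        rewrite Eq in Hn. rewrite Ez in Hle.
        exists k, (n + (0 + c + list_sum ks)). split; [exact Hk|].
        split; [|unfold c; lia].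
        eapply down_val_plus_num; [exact Tp|exact HP|exact Hn].
    + intros u m Hu. rewrite <- clo_snoc.
      destruct (reals_num_vals eta [(u, m)] [(z, L)]) as (ks' & Hks'); auto.
      { intros b [<-|[]]. exact HL. }
      { constructor; [exact Hu|constructor]. }
      inversion Hks' as [|? k ? ks'' [Hk Hj] Hn]; subst. inversion Hn; subst.
      assert (R' : realizes B eta (clo t ((binds G us ++ binds D ss) ++ [(z, u)]))
        (hplus (oty B) (hinst p (map snd us)) (HNum (list_sum (ks ++ [k]))))).
      { rewrite <- app_assoc.
        change (binds D ss ++ [(z, u)]) with (binds D ss ++ binds [(z, L)] [(u, m)]).
        rewrite <- binds_app by (eapply reals_length; eassumption).
        apply (R eta He us (ss ++ [(u, m)]) (ks ++ [k])); [exact Hus| |].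
        - apply Forall2_app; [exact Hss|]. constructor; [exact Hu|constructor].
        - apply Forall2_app; [exact Hks|]. constructor; auto. }
      refine (realizes_plus_num _ _ _ _ _ _ _ _ HB He Tp _ _ _ R').
      * apply plus_num_num; [exact Tp|apply plus_num_0, Tp].
      * apply plus_num_hplus; [exact Tp|exact HP|exact Hk].
      * rewrite list_sum_app; simpl. lia.
  - intros qns Hq. destruct (S qns Hq) as (n & Hn & Hle).
    eexists. rewrite hinst_hplus. split.
    + apply down_val_hplus; [|exact Hn|now apply hinst_lam_cost].
      eapply hty_hinst; [exact T|now apply down_vals_hty].
    + rewrite size_lam, Ez. lia.
Qed.

(** * Contraction, dereliction and weakening *)

Lemma bounded_contr G D x y z t A B :
  formula B -> distinct (G ++ [(x, A); (y, A)]) D -> distinct (G ++ [(z, A)]) D ->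
  (fresh z t \/ z = x \/ z = y) ->
  bounded (G ++ [(x, A); (y, A)]) D t B ->
  bounded (G ++ [(z, A)]) D (merge x y z t) B.
Proof.
  intros HB Hd Hd' Hz [p [T R S]].
  unfold distinct in Hd, Hd'. rewrite !map_app in Hd, Hd'. simpl in Hd, Hd'.
  (* Positions [length G] and [length G + 1] hold [x] and [y]; both are sent to the position of [z],
     which identifies the two variables of [p]. *)
  set (f := fun i => if i =? length G + 1 then length G else i).
  assert (Hf : forall T (l : list T) a i, length l = length G -> i < length l + 2 ->
    nth_error (l ++ [a]) (f i) = nth_error (l ++ [a; a]) i).
  { intros U l a i Hl Hi. unfold f. destruct (Nat.eqb_spec i (length G + 1)) as [->|E].
    - rewrite !nth_error_app2 by lia.
      now replace (length G - length l) with 0 by lia;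
        replace (length G + 1 - length l) with 1 by lia.
    - destruct (Nat.lt_ge_cases i (length l)) as [Hlt|Hge].
      + now rewrite !nth_error_app1 by lia.
      + rewrite !nth_error_app2 by lia. now replace (i - length l) with 0 by lia. }
  rewrite tys_app in T. simpl in T.
  assert (HI : forall qs q, length qs = length G ->
    hinst (hren f p) (qs ++ [q]) = hinst p (qs ++ [q; q])).
  { intros qs q Hl. eapply hinst_hren; [exact T| |].
    - rewrite !length_app, length_tys, Hl. reflexivity.
    - intros i Hi. rewrite length_app in Hi; simpl in Hi. apply Hf; [assumption|lia]. }
  exists (hren f p). split.
  - eapply hty_hren; [exact T|]. intros i a Hi.
    rewrite tys_app. simpl. rewrite Hf; [exact Hi|apply length_tys|].
    assert (Hl : i < length (tys G ++ [oty A; oty A])) by (apply nth_error_Some; congruence).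
    rewrite length_app in Hl. simpl in Hl. lia.
  - intros eta He us ss ks Hus Hss Hks.
    apply Forall2_snoc_inv_r in Hus as (us' & [u q] & -> & Hus & Hu). simpl in Hu.
    assert (Lu := reals_length _ _ _ Hus). assert (Ls := reals_length _ _ _ Hss).
    rewrite map_app, binds_app by assumption. simpl map.
    rewrite HI by (rewrite length_map; assumption).
    (* The contraction generator works on the last two bindings, so the linear bindings are
       exchanged in front of them before it and moved back after it. *)
    eapply realizes_perm; [exact HB|exact He| |
      |eapply realizes_tr0; [exact HB|exact He|apply (tr_contr t (binds G us' ++ binds D ss) x y z u [])|]].
    + rewrite !map_app, !map_fst_binds by assumption. simpl.
      eapply Permutation_NoDup; [|exact Hd']. rewrite <- !app_assoc.
      apply Permutation_app_head, Permutation_app_comm.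
    + rewrite <- !app_assoc. apply Permutation_app_head.
      change (binds [(z, A)] [(u, q)]) with [(z, u)]. apply Permutation_app_comm.
    + rewrite !map_app, !map_fst_binds by assumption. simpl.
      eapply Permutation_NoDup; [|exact Hd]. rewrite <- !app_assoc.
      apply Permutation_app_head, Permutation_app_comm.
    + rewrite !map_app, !map_fst_binds by assumption. simpl.
      eapply Permutation_NoDup; [|exact Hd']. rewrite <- !app_assoc.
      apply Permutation_app_head, Permutation_app_comm.
    + exact Hz.
    + assert (R' : realizes B eta
        (clo t (binds (G ++ [(x, A); (y, A)]) (us' ++ [(u, q); (u, q)]) ++ binds D ss))
        (hplus (oty B) (hinst p (map snd (us' ++ [(u, q); (u, q)]))) (HNum (list_sum ks)))).
      { apply R; auto. apply Forall2_app; [exact Hus|]. repeat (constructor; [exact Hu|]).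
        constructor. }
      rewrite map_app in R'. revert R'. apply realizes_perm; auto.
      * rewrite !map_app, !map_fst_binds.
        -- rewrite map_app. exact Hd.
        -- assumption.
        -- rewrite !length_app, Lu. reflexivity.
      * rewrite binds_app by assumption. rewrite <- !app_assoc.
        apply Permutation_app_head. change (binds [(x, A); (y, A)] [(u, q); (u, q)])
          with [(x, u); (y, u)]. apply Permutation_app_comm.
  - intros qns Hq. apply Forall2_snoc_inv_r in Hq as (qns' & [q n] & -> & Hq & Hn).
    assert (Lq := down_vals_length _ _ Hq).
    destruct (S (qns' ++ [(q, n); (q, n)])) as (m & Hm & Hle).
    { apply Forall2_app; [exact Hq|]. repeat (constructor; [exact Hn|]). constructor. }
    exists m. rewrite !map_app in *. simpl map in *.
    rewrite HI by (rewrite length_map; assumption). split; [exact Hm|].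
    rewrite !occ_sum_app in * by (rewrite length_map; assumption).
    unfold merge at 1. rewrite size_ren.
    rewrite (occ_sum_ext (merge x y z t) t G).
    (* Both old variables carry the same [n], and the occurrences of [z] are those of [x] and [y]
       together. *)
    + unfold occ_sum at 2. unfold occ_sum at 2 in Hle. simpl in Hle |- *.
      rewrite occ_merge; [lia| |exact Hz].
      rewrite <- app_assoc in Hd. apply NoDup_app_remove_l in Hd. simpl in Hd.
      inversion Hd as [|? ? Hx _]; subst. simpl in Hx. intuition congruence.
    + intros w Hw. rewrite <- app_assoc in Hd, Hd'.
      apply occ_merge_other; intros ->; eapply NoDup_app_disjoint;
        [exact Hd|exact Hw| |exact Hd|exact Hw| |exact Hd'|exact Hw|]; simpl; auto.
Qed.

(** The value of [x] moves from the sum of linear arguments into the polynomial, as a new variable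
    of type [Base]. As [x] occurs at most once, adding it once also satisfies the size bound. *)
Lemma bounded_derel G D x t L B :
  formula B -> linear L -> distinct G (D ++ [(x, L)]) -> occ x t <= 1 ->
  bounded G (D ++ [(x, L)]) t B -> bounded (G ++ [(x, L)]) D t B.
Proof.
  intros HB HL Hd Hx [p [T R S]].
  unfold distinct in Hd. rewrite !map_app in Hd. simpl in Hd.
  assert (Hv : hty (tys (G ++ [(x, L)])) (HVar (length G)) Base).
  { constructor. rewrite tys_app, nth_error_app2; rewrite length_tys; [|lia].
    rewrite Nat.sub_diag. simpl. now rewrite oty_linear. }
  assert (HI : forall qs q, length qs = length G ->
    hinst (hplus (oty B) p (HVar (length G))) (qs ++ [q]) = hplus (oty B) (hinst p qs) q).
  { intros qs q Hl. rewrite hinst_hplus, (hinst_app_l _ _ _ _ _ T)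
      by (rewrite length_tys; auto). now rewrite <- Hl, hinst_last. }
  exists (hplus (oty B) p (HVar (length G))). split.
  - apply hty_hplus; [|exact Hv]. rewrite tys_app. apply hty_app_l, T.
  - intros eta He us ss ks Hus Hss Hks.
    apply Forall2_snoc_inv_r in Hus as (us' & [u q] & -> & Hus & Hu). simpl in Hu.
    assert (Lu := reals_length _ _ _ Hus). assert (Ls := reals_length _ _ _ Hss).
    rewrite map_app, binds_app by assumption. simpl map.
    rewrite HI by (rewrite length_map; assumption).
    destruct (reals_num_vals eta [(u, q)] [(x, L)]) as (ks' & Hks'); auto.
    { intros b [<-|[]]. exact HL. }
    { constructor; [exact Hu|constructor]. }
    inversion Hks' as [|? k ? ks'' [Hk Hj] Hn]; subst. inversion Hn; subst.
    assert (Tp := hty_hinst _ _ _ _ T (reals_hty _ _ _ Hus)).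
    assert (R' : realizes B eta (clo t (binds G us' ++ binds (D ++ [(x, L)]) (ss ++ [(u, q)])))
      (hplus (oty B) (hinst p (map snd us')) (HNum (list_sum (ks ++ [k]))))).
    { apply R; auto; apply Forall2_app; auto. }
    refine (realizes_plus_num _ _ _ _ _ _ _ _ HB He Tp _ _ _ _).
    4: { eapply realizes_perm; [exact HB|exact He| | |exact R'].
      - rewrite !map_app, !map_fst_binds.
        + rewrite map_app. exact Hd.
        + rewrite !length_app, Ls. reflexivity.
        + assumption.
      - rewrite binds_app by assumption. rewrite <- !app_assoc.
        apply Permutation_app_head, Permutation_app_comm. }
    + apply plus_num_num, plus_num_0; exact Tp.
    + apply plus_num_num; [exact Tp|]. apply plus_num_hplus; [exact Tp| |exact Hk].
      apply plus_num_0, Tp.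
    + rewrite list_sum_app; simpl. lia.
  - intros qns Hq. apply Forall2_snoc_inv_r in Hq as (qns' & [q n] & -> & Hq & [_ Hn]).
    assert (Lq := down_vals_length _ _ Hq). simpl in Hn. rewrite (oty_linear _ HL) in Hn.
    destruct (S qns' Hq) as (m & Hm & Hle).
    exists (m + n). rewrite !map_app. simpl map.
    rewrite HI by (rewrite length_map; assumption).
    rewrite occ_sum_app by (rewrite length_map; assumption). split.
    + apply down_val_hplus; [|exact Hm|exact Hn].
      eapply hty_hinst; [exact T|now apply down_vals_hty].
    + unfold occ_sum at 2. simpl.
      assert (occ x t * n <= 1 * n) by (apply Nat.mul_le_mono_r; assumption). lia.
Qed.

(** The new binding costs [TS] of its argument plus 2, and [down] of the polynomial of the argument
    bounds this [TS]. *)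
Lemma bounded_weak_last G D x t A C :
  formula A -> formula C -> distinct (G ++ [(x, C)]) D -> fresh x t ->
  bounded G D t A -> bounded (G ++ [(x, C)]) D t A.
Proof.
  intros HA HC Hd Hx [p [T R S]].
  unfold distinct in Hd. rewrite !map_app in Hd. simpl in Hd.
  set (e := hadd (down (oty C) (HVar (length G))) (HNum 2)).
  assert (He : hty (tys (G ++ [(x, C)])) e Base).
  { apply hty_hadd; [|constructor]. apply hty_down. constructor.
    rewrite tys_app, nth_error_app2; rewrite length_tys; [|lia].
    now rewrite Nat.sub_diag. }
  assert (HI : forall qs q n, length qs = length G -> down_val (oty C) q n ->
    exists m, hinst (hplus (oty A) p e) (qs ++ [q]) = hplus (oty A) (hinst p qs) m /\
              heq [] m (HNum (n + 2)) Base).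
  { intros qs q n Hl Hn. exists (hinst e (qs ++ [q])). split.
    - now rewrite hinst_hplus, (hinst_app_l _ _ _ _ _ T) by (rewrite length_tys; auto).
    - change (hinst e (qs ++ [q]))
        with (hadd (hinst (down (oty C) (HVar (length G))) (qs ++ [q])) (HNum 2)).
      rewrite hinst_down, <- Hl, hinst_last.
      apply heq_hadd_num; [exact Hn|apply heq_refl; constructor]. }
  exists (hplus (oty A) p e). split.
  - apply hty_hplus; [|exact He]. rewrite tys_app. apply hty_app_l, T.
  - intros eta Hv us ss ks Hus Hss Hks.
    apply Forall2_snoc_inv_r in Hus as (us' & [u q] & -> & Hus & Hu). simpl in Hu.
    assert (Lu := reals_length _ _ _ Hus). assert (Ls := reals_length _ _ _ Hss).
    rewrite map_app, binds_app by assumption. simpl map.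
    destruct (TS_bound_realizes _ _ _ _ HC Hv Hu) as (j & n & Hj & Hn & Hle).
    destruct (HI (map snd us') q n) as (m & -> & Hm); [now rewrite length_map|exact Hn|].
    assert (Tp := hty_hinst _ _ _ _ T (reals_hty _ _ _ Hus)).
    assert (Hp : Permutation ((binds G us' ++ binds D ss) ++ [(x, u)])
      ((binds G us' ++ binds [(x, C)] [(u, q)]) ++ binds D ss)).
    { rewrite <- !app_assoc. apply Permutation_app_head, Permutation_app_comm. }
    assert (Hnd : NoDup (map fst ((binds G us' ++ binds D ss) ++ [(x, u)]))).
    { eapply Permutation_NoDup; [apply Permutation_map, Permutation_sym, Hp|].
      rewrite !map_app, !map_fst_binds by auto. exact Hd. }
    refine (realizes_plus_num _ _ _ _ _ _ _ _ HA Hv Tp _ _ _ _).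
    4: { eapply realizes_perm; [exact HA|exact Hv|exact Hnd|exact Hp|].
      exact (saturated_tr _ _ (saturated_realizes A HA eta Hv) _ _ _ _
        (tr_weak t _ x u j [] Hnd Hx Hj) (R eta Hv us' ss ks Hus Hss Hks)). }
    + apply plus_num_num, plus_num_num, plus_num_0; exact Tp.
    + apply plus_num_num; [exact Tp|]. apply plus_num_hplus; [exact Tp| |exact Hm].
      apply plus_num_0, Tp.
    + lia.
  - intros qns Hq. apply Forall2_snoc_inv_r in Hq as (qns' & [q n] & -> & Hq & [_ Hn]).
    assert (Lq := down_vals_length _ _ Hq). simpl in Hn.
    destruct (S qns' Hq) as (k & Hk & Hle).
    exists (k + (n + 2)). rewrite !map_app. simpl map.
    destruct (HI (map fst qns') q n) as (m & -> & Hm); [now rewrite length_map|exact Hn|].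
    rewrite occ_sum_app by (rewrite length_map; assumption). split.
    + apply down_val_hplus; [|exact Hk|exact Hm].
      eapply hty_hinst; [exact T|now apply down_vals_hty].
    + unfold occ_sum at 2. simpl. rewrite Hx. lia.
Qed.

(** The value of the argument already belongs to the sum of linear arguments, so the polynomial
    grows only by the 2 of the weakening generator. *)
Lemma bounded_weak_linear_last G D x t A L :
  formula A -> linear L -> distinct G (D ++ [(x, L)]) -> fresh x t ->
  bounded G D t A -> bounded G (D ++ [(x, L)]) t A.
Proof.
  intros HA HL Hd Hx [p [T R S]].
  unfold distinct in Hd. rewrite !map_app in Hd. simpl in Hd.
  exists (hplus (oty A) p (HNum 2)). split.
  - apply hty_hplus; [exact T|constructor].
  - intros eta Hv us ss ks Hus Hss Hks.
    apply Forall2_snoc_inv_r in Hss as (ss' & [u q] & -> & Hss & Hu). simpl in Hu.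
    apply Forall2_app_inv_l in Hks as (ks' & kl & Hks & Hkl & ->).
    inversion Hkl as [|? k ? ks'' [Hk (j & Hj & Hle)] Hn]; subst. inversion Hn; subst.
    assert (Lu := reals_length _ _ _ Hus). assert (Ls := reals_length _ _ _ Hss).
    assert (Tp := hty_hinst _ _ _ _ T (reals_hty _ _ _ Hus)).
    rewrite binds_app, hinst_hplus by assumption.
    assert (Hnd : NoDup (map fst ((binds G us ++ binds D ss') ++ [(x, u)]))).
    { rewrite !map_app, !map_fst_binds by auto. now rewrite <- app_assoc. }
    refine (realizes_plus_num _ _ _ _ _ _ _ _ HA Hv Tp _ _ _ _).
    4: { rewrite app_assoc.
      exact (saturated_tr _ _ (saturated_realizes A HA eta Hv) _ _ _ _
        (tr_weak t _ x u j [] Hnd Hx Hj) (R eta Hv us ss' ks' Hus Hss Hks)). }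
    + apply plus_num_num, plus_num_num, plus_num_0; exact Tp.
    + apply plus_num_num, plus_num_num, plus_num_0; exact Tp.
    + rewrite list_sum_app; simpl in *. lia.
  - intros qns Hq. destruct (S qns Hq) as (k & Hk & Hle).
    exists (k + 2). rewrite hinst_hplus. split; [|lia].
    apply down_val_hplus; [|exact Hk|apply heq_refl; constructor].
    eapply hty_hinst; [exact T|now apply down_vals_hty].
Qed.

(** Hypotheses are peeled off from the right, so each new nonlinear name takes the next index and
    the indices already used in the polynomial stay put. *)
Lemma bounded_weak G G' D D' t A :
  formula A -> distinct (G ++ G') (D ++ D') ->
  (forall b, In b G' -> formula (snd b)) -> (forall b, In b D' -> linear (snd b)) ->
  (forall x, In x (map fst G' ++ map fst D') -> fresh x t) ->
  bounded G D t A -> bounded (G ++ G') (D ++ D') t A.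
Proof.
  intros HA Hd HG HD Hx H. unfold distinct in Hd.
  induction D' as [|[y L] D' IH] using rev_ind.
  - rewrite app_nil_r in *. induction G' as [|[y C] G' IH] using rev_ind.
    + now rewrite app_nil_r.
    + rewrite app_assoc in *. rewrite !map_app in *. apply bounded_weak_last; auto.
      * apply (HG (y, C)). apply in_or_app; simpl; auto.
      * unfold distinct. rewrite !map_app. exact Hd.
      * apply Hx. rewrite !in_app_iff; simpl; auto.
      * apply IH.
        -- rewrite <- app_assoc in Hd. eapply NoDup_remove_1, Hd.
        -- intros b Hb. apply HG, in_or_app; auto.
        -- intros x Hi. apply Hx. rewrite !in_app_iff in *; simpl in *; tauto.
  - rewrite app_assoc. apply bounded_weak_linear_last; auto.
    + apply (HD (y, L)). apply in_or_app; simpl; auto.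
    + unfold distinct. now rewrite <- (app_assoc D).
    + apply Hx. rewrite map_app, !in_app_iff; simpl; auto.
    + apply IH.
      * rewrite !app_assoc in *. rewrite map_app in Hd. now apply NoDup_app_remove_r in Hd.
      * intros b Hb. apply HD, in_or_app; auto.
      * intros x Hi. apply Hx. rewrite map_app, !in_app_iff in *; tauto.
Qed.

(** * Exchange in both contexts *)

Lemma nth_error_swap {T} (l1 l2 : list T) a b i :
  nth_error (l1 ++ b :: a :: l2)
    (if i =? length l1 then S i else if i =? S (length l1) then length l1 else i)
  = nth_error (l1 ++ a :: b :: l2) i.
Proof.
  destruct (Nat.eqb_spec i (length l1)) as [->|E1].
  - rewrite !nth_error_app2 by lia.
    now replace (S (length l1) - length l1) with 1 by lia;
      replace (length l1 - length l1) with 0 by lia.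
  - destruct (Nat.eqb_spec i (S (length l1))) as [->|E2].
    + rewrite !nth_error_app2 by lia.
      now replace (S (length l1) - length l1) with 1 by lia;
        replace (length l1 - length l1) with 0 by lia.
    + destruct (Nat.lt_ge_cases i (length l1)).
      * now rewrite !nth_error_app1 by lia.
      * rewrite !nth_error_app2 by lia.
        now replace (i - length l1) with (S (S (i - length l1 - 2))) by lia.
Qed.

Lemma bounded_swap l1 a b l2 D t A : formula A -> distinct (l1 ++ a :: b :: l2) D ->
  bounded (l1 ++ a :: b :: l2) D t A -> bounded (l1 ++ b :: a :: l2) D t A.
Proof.
  intros HA Hd [p [T R S]]. unfold distinct in Hd. rewrite map_app in Hd.
  set (f := fun i => if i =? length l1 then Datatypes.S i
                     else if i =? Datatypes.S (length l1) then length l1 else i).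
  assert (HI : forall q1 qa qb q2, length q1 = length l1 -> length q2 = length l2 ->
    hinst (hren f p) (q1 ++ qb :: qa :: q2) = hinst p (q1 ++ qa :: qb :: q2)).
  { intros q1 qa qb q2 E1 E2. eapply hinst_hren; [exact T| |].
    - rewrite length_tys, !length_app; simpl. lia.
    - intros i _. unfold f. rewrite <- E1. apply nth_error_swap. }
  exists (hren f p). split.
  - eapply hty_hren; [exact T|]. intros i s Hi. rewrite tys_app in *. simpl in *.
    unfold f. rewrite <- (length_tys l1). rewrite nth_error_swap. exact Hi.
  - intros eta He us ss ks Hus Hss Hks.
    apply Forall2_app_inv_r in Hus as (us1 & us' & H1 & H' & ->).
    inversion H' as [|rb ? us'' ? Hb H'']; subst. inversion H'' as [|ra ? us2 ? Ha H2]; subst.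
    fold (reals eta us1 l1) in H1. fold (reals eta us2 l2) in H2.
    assert (L1 := reals_length _ _ _ H1). assert (L2 := reals_length _ _ _ H2).
    assert (Ls := reals_length _ _ _ Hss).
    rewrite map_app. simpl map. rewrite HI by now rewrite length_map.
    assert (R' := R eta He (us1 ++ ra :: rb :: us2) ss ks).
    rewrite map_app in R'. simpl map in R'.
    assert (Hin : reals eta (us1 ++ ra :: rb :: us2) (l1 ++ a :: b :: l2)).
    { apply Forall2_app; [exact H1|]. repeat (constructor; [assumption|]). exact H2. }
    specialize (R' Hin Hss Hks). revert R'. apply realizes_perm; auto.
    + rewrite map_app, !map_fst_binds; auto. eapply reals_length, Hin.
    + apply Permutation_app_tail. rewrite !binds_app by assumption.
      apply Permutation_app_head. apply perm_swap.
  - intros qns Hq. apply Forall2_app_inv_r in Hq as (q1 & q' & H1 & H' & ->).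
    inversion H' as [|rb ? us'' ? Hb H'']; subst. inversion H'' as [|ra ? q2 ? Ha H2]; subst.
    fold (down_vals q1 l1) in H1. fold (down_vals q2 l2) in H2.
    assert (L1 := down_vals_length _ _ H1). assert (L2 := down_vals_length _ _ H2).
    destruct (S (q1 ++ ra :: rb :: q2)) as (n & Hn & Hle).
    { apply Forall2_app; [exact H1|]. repeat (constructor; [assumption|]). exact H2. }
    exists n. rewrite !map_app in *. simpl map in *.
    rewrite HI by now rewrite length_map. split; [exact Hn|].
    rewrite occ_sum_app in * by now rewrite length_map.
    unfold occ_sum at 2. unfold occ_sum at 2 in Hle. simpl in *. lia.
Qed.

(** The polynomial does not mention linear names and the sum of their values is symmetric, so it
    serves unchanged. *)
Lemma bounded_linear_swap l1 a b l2 G t A : formula A -> distinct G (l1 ++ a :: b :: l2) ->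
  bounded G (l1 ++ a :: b :: l2) t A -> bounded G (l1 ++ b :: a :: l2) t A.
Proof.
  intros HA Hd [p [T R S]]. unfold distinct in Hd. rewrite map_app in Hd.
  exists p. split; [exact T| |exact S].
  intros eta He us ss ks Hus Hss Hks.
  apply Forall2_app_inv_r in Hss as (ss1 & ss' & H1 & H' & ->).
  inversion H' as [|rb ? ss'' ? Hb H'']; subst. inversion H'' as [|ra ? ss2 ? Ha H2]; subst.
  apply Forall2_app_inv_l in Hks as (ks1 & ks' & K1 & K' & ->).
  inversion K' as [|? kb ? ks'' Kb K'']; subst. inversion K'' as [|? ka ? ks2 Ka K2]; subst.
  fold (reals eta ss1 l1) in H1. fold (reals eta ss2 l2) in H2.
  assert (L1 := reals_length _ _ _ H1). assert (L2 := reals_length _ _ _ H2).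
  assert (Lu := reals_length _ _ _ Hus).
  assert (Hin : reals eta (ss1 ++ ra :: rb :: ss2) (l1 ++ a :: b :: l2)).
  { apply Forall2_app; [exact H1|]. repeat (constructor; [assumption|]). exact H2. }
  assert (R' := R eta He us (ss1 ++ ra :: rb :: ss2) (ks1 ++ ka :: kb :: ks2) Hus Hin).
  replace (list_sum (ks1 ++ kb :: ka :: ks2)) with (list_sum (ks1 ++ ka :: kb :: ks2))
    by (rewrite !list_sum_app; simpl; lia).
  eapply realizes_perm; [exact HA|exact He| | |apply R'].
  - rewrite map_app, !map_fst_binds; auto. eapply reals_length, Hin.
  - apply Permutation_app_head. rewrite !binds_app by assumption.
    apply Permutation_app_head. apply perm_swap.
  - apply Forall2_app; [exact K1|]. repeat (constructor; [assumption|]). exact K2.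
Qed.

Lemma distinct_perm G G' D D' : Permutation G G' -> Permutation D D' ->
  distinct G D -> distinct G' D'.
Proof.
  intros HG HD. apply Permutation_NoDup, Permutation_map. now apply Permutation_app.
Qed.

Lemma bounded_perm G G' D D' t A : formula A -> distinct G D ->
  Permutation G G' -> Permutation D D' -> bounded G D t A -> bounded G' D' t A.
Proof.
  intros HA Hd HG HD H.
  cut (distinct G' ([] ++ D') /\ bounded G' ([] ++ D') t A); [tauto|].
  apply (Permutation_swap_ind (fun D => distinct G' D /\ bounded G' D t A)) with D; auto.
  - intros l1 a b l2 [H1 H2]. split; [|now apply bounded_linear_swap].
    eapply distinct_perm; [reflexivity| |exact H1]. apply Permutation_app_head, perm_swap.
  - simpl. split; [eapply distinct_perm; [exact HG|reflexivity|exact Hd]|].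
    cut (distinct ([] ++ G') D /\ bounded ([] ++ G') D t A); [tauto|].
    apply (Permutation_swap_ind (fun G => distinct G D /\ bounded G D t A)) with G; auto.
    intros l1 a b l2 [H1 H2]. split; [|now apply bounded_swap].
    eapply distinct_perm; [|reflexivity|exact H1]. apply Permutation_app_head, perm_swap.
Qed.

(** * Induction on derivations *)

Lemma dial_fresh_disjoint G D t A l : dial G D t A ->
  (forall x, In x l -> ~ In x (map fst G ++ map fst D)) -> forall x, In x l -> fresh x t.
Proof. intros H Hl x Hx. eapply dial_fresh; eauto. Qed.

Lemma NoDup_interleave {T} (l1 l2 l3 l4 : list T) :
  NoDup ((l1 ++ l2) ++ (l3 ++ l4)) -> NoDup ((l1 ++ l3) ++ (l2 ++ l4)).
Proof.
  apply Permutation_NoDup. rewrite <- !app_assoc. apply Permutation_app_head.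
  rewrite !app_assoc. apply Permutation_app_tail, Permutation_app_comm.
Qed.

Lemma distinct_disjoint (G1 G2 D1 D2 : ctx) x : distinct (G1 ++ G2) (D1 ++ D2) ->
  In x (map fst G1 ++ map fst D1) -> ~ In x (map fst G2 ++ map fst D2).
Proof.
  intros Hd H1 H2. unfold distinct in Hd. rewrite !map_app in Hd.
  apply NoDup_interleave in Hd. eapply NoDup_app_disjoint; eauto.
Qed.

Lemma dial_bounded G D t A : dial G D t A -> bounded G D t A.
Proof.
  induction 1 as [x A HA|x L HL|G D t L H IH|G D t L HL H IH|G D t A H IH
    |G D t A L HL H IH|G1 G2 D t u A B Hd H1 IH1 H2 IH2|G D z t A B H IH
    |G1 G2 D1 D2 t u L B Hd H1 IH1 H2 IH2|G D z t L B H IH|G D x y z t A B Hd H IH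
    |G D x t L B H IH|G G' D D' t B Hd H1 H2 H IH|G G' D D' t A HG HD H IH].
  - now apply bounded_ax1.
  - now apply bounded_ax2.
  - assert (HL := formula_mu_inv _ (proj2 (proj2 (dial_formula _ _ _ _ H)))).
    revert IH. apply bounded_sub.
    + rewrite oty_fsubst1 by assumption. apply oty_linear, HL.
    + intros eta He. now apply realizes_mu_unfold.
  - revert IH. apply bounded_sub.
    + rewrite oty_fsubst1 by assumption. symmetry. apply oty_linear, HL.
    + intros eta He. now apply realizes_mu_fold.
  - now apply bounded_all_i.
  - revert IH. apply bounded_sub.
    + exact (oty_fsubst1 A L HL).
    + intros eta He s p [_ Hs]. apply realizes_fsubst1; auto.
      apply Hs. now apply saturated_realizes_Base.
  - assert (HAB := proj2 (proj2 (dial_formula _ _ _ _ H1))).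
    rewrite <- (app_nil_r D) in Hd.
    apply bounded_imp_e with A; auto.
    + now rewrite app_nil_r in Hd.
    + eapply dial_fresh_disjoint; [exact H2|]. intros x. now apply distinct_disjoint.
    + eapply dial_fresh_disjoint; [exact H1|]. intros x Hx Hx'.
      eapply distinct_disjoint in Hx'; [|exact Hd]. apply Hx'. now rewrite app_nil_r.
  - destruct (dial_formula _ _ _ _ H) as (HG & _ & HB).
    apply bounded_imp_i; auto.
    + intros b Hb. apply HG, in_or_app; auto.
    + apply formula_imp; auto. apply (HG (z, A)), in_or_app; simpl; auto.
    + eapply dial_distinct, H.
    + apply (dial_occ_linear _ _ _ _ H).
  - assert (HLB := proj2 (proj2 (dial_formula _ _ _ _ H1))).
    apply bounded_lolli_e with L; auto.
    + eapply dial_fresh_disjoint; [exact H2|]. intros x. now apply distinct_disjoint.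
    + eapply dial_fresh_disjoint; [exact H1|]. intros x Hx Hx'.
      now eapply distinct_disjoint in Hx'; [|exact Hd].
  - destruct (dial_formula _ _ _ _ H) as (HG & HD & HB).
    apply bounded_lolli_i; auto.
    + apply formula_lolli; auto. apply (HD (z, L)), in_or_app; simpl; auto.
    + eapply dial_distinct, H.
    + intros x Hx. apply (dial_occ_linear _ _ _ _ H). rewrite map_app.
      apply in_or_app; auto.
  - assert (HB := proj2 (proj2 (dial_formula _ _ _ _ H))).
    apply bounded_contr; auto.
    + eapply dial_distinct, H.
    (* A [z] other than [x] and [y] lies outside the context of the premise by distinctness of the
       conclusion, hence does not occur in [t]. *)
    + destruct (Nat.eq_dec z x); [auto|]. destruct (Nat.eq_dec z y); [auto|]. left.
      eapply dial_fresh; [exact H|]. rewrite map_app. simpl.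
      unfold distinct in Hd. rewrite !map_app, <- app_assoc in Hd. simpl in Hd.
      apply NoDup_remove_2 in Hd. rewrite !in_app_iff in *. simpl. intuition congruence.
  - destruct (dial_formula _ _ _ _ H) as (HG & HD & HB).
    apply bounded_derel; auto.
    + apply (HD (x, L)), in_or_app; simpl; auto.
    + eapply dial_distinct, H.
    + apply (dial_occ_linear _ _ _ _ H). rewrite map_app. apply in_or_app; simpl; auto.
  - assert (HB := proj2 (proj2 (dial_formula _ _ _ _ H))).
    apply bounded_weak; auto.
    eapply dial_fresh_disjoint; [exact H|]. intros x Hx Hx'.
    now eapply distinct_disjoint in Hx'; [|exact Hd].
  - assert (HB := proj2 (proj2 (dial_formula _ _ _ _ H))).
    eapply bounded_perm; [exact HB|eapply dial_distinct, H|exact HG|exact HD|exact IH].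
Qed.

(** [G] is x1:C1,...,xa:Ca and [D] is y1:M1,...,yb:Mb; the lists [us] and [ss]
    collect the pairs (ui,qi) and (sj,mj). *)
Theorem theorem4 (G D : ctx) (t : term) (A : form) (Ht : dial G D t A) :
  exists p : hop,
    hty (map (fun b => oty (snd b)) G) p (oty A) /\
    (forall eta : nat -> term -> hop -> Prop, valuation eta ->
      forall us ss : list (term * hop),
        Forall2 (fun r b => realizes (snd b) eta (fst r) (snd r)) us G ->
        Forall2 (fun r b => realizes (snd b) eta (fst r) (snd r)) ss D ->
        realizes A eta
          (clo t (combine (map fst G ++ map fst D) (map fst us ++ map fst ss)))
          (fold_left (hplus (oty A)) (map snd ss) (hinst p (map snd us)))) /\
    (forall qs : list hop,
        Forall2 (fun q b => hty [] q (oty (snd b))) qs G ->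
        exists (ns : list nat) (n : nat),
          Forall2 (fun qb k => down_val (oty (snd (snd qb))) (fst qb) k)
            (combine qs G) ns /\
          down_val (oty A) (hinst p qs) n /\
          size t + list_sum (map (fun bk => occ (fst (fst bk)) t * snd bk)
                                 (combine G ns)) <= n).
Proof.
  destruct (dial_formula _ _ _ _ Ht) as (_ & HD & HA).
  destruct (dial_bounded _ _ _ _ Ht) as [p [T R S]].
  exists p. split; [exact T|]. split.
  - intros eta He us ss Hus Hss.
    (* Numerals equal to the polynomials in [ss] are chosen here; the final equality turns their sum
       back into the iterated addition of these polynomials. *)
    destruct (reals_num_vals _ _ _ He HD Hss) as (ks & Hks).
    specialize (R eta He us ss ks Hus Hss Hks).
    rewrite combine_app by (rewrite !length_map; symmetry; eapply Forall2_length, Hus).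
    eapply realizes_heq; [exact HA|exact He|exact R|].
    apply heq_sym, heq_fold_hplus.
    + clear - Hks. induction Hks as [|r k ss ks [H _] _ IH]; simpl; constructor; auto.
    + eapply hty_hinst; [exact T|]. eapply reals_hty, Hus.
  - intros qs Hqs.
    (* Normalization provides each closed argument with a numeral for its [down]. *)
    assert (Hex : exists qns, map fst qns = qs /\ down_vals qns G).
    { clear - Hqs. induction Hqs as [|q b qs G Hq _ (qns & E & IH)].
      - exists []. split; [reflexivity|constructor].
      - destruct (down_val_exists _ _ Hq) as (n & Hn). exists ((q, n) :: qns).
        split; [simpl; congruence|]. constructor; auto. }
    destruct Hex as (qns & <- & Hq). destruct (S qns Hq) as (n & Hn & Hle).
    exists (map snd qns), n. split; [|split; [exact Hn|exact Hle]].
    clear - Hq. induction Hq as [|qn b qns G [_ Hb] _ IH]; simpl; constructor; auto.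
Qed.
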